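(* For any finite interval $I=(\mu_1,\mu_2)$, $-\infty<\mu_1<\mu_2<\infty$, there exists a Sturm–Liouville expression $$l[y]=-y''+p(t)y,\qquad t\in(0,\infty),$$ with a real-valued function $p$ on $(0,\infty)$ satisfying $p\in L_1(0,c)$ for every $c\in(0,\infty)$, such that the deficiency indices of the minimal operator $L_0$ generated by $l[y]$ in $L_2(0,\infty)$ are $n_+(L_0)=n_-(L_0)=1$ and the following statements hold: 1) for all $\lambda\in I$ the equation $l[y]-\lambda y=0$ has a unique (up to a constant factor) nontrivial solution which lies in $L_2(0,\infty)$, i.e. the space of its solutions belonging to $L_2(0,\infty)$ is one-dimensional; 2) for any self-adjoint extension $\widetilde A\supset L_0$ (in $L_2(0,\infty)$) the interval $I$ contains infinitely many points of the essential spectrum $\sigma_e(\widetilde A)$.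
   Context: $L_2(0,\infty)$ is the Hilbert space of square-integrable complex-valued functions on $(0,\infty)$. Let $\mathcal D(l)$ be the set of functions $y$ on $(0,\infty)$ such that $y$ and $y'$ are locally absolutely continuous. The maximal operator $L$ is $Ly=l[y]$ on $\mathcal D(L)=\{y\in\mathcal D(l)\cap L_2(0,\infty):l[y]\in L_2(0,\infty)\}$. The minimal operator $L_0$ is the closure of the restriction of $L$ to functions in $\mathcal D(L)$ with compact support in $(0,\infty)$; it is a densely defined symmetric operator with $L_0^*=L$. The deficiency indices are $n_\pm(L_0)=\dim\operatorname{Ker}(L_0^*-z)$, $z\in\mathbb C_\pm$. Solutions of $l[y]-\lambda y=0$ are functions $y\in\mathcal D(l)$ satisfying the equation almost everywhere. For a self-adjoint operator $T$ the discrete spectrum $\sigma_d(T)$ is the set of all isolated eigenvalues of $T$ with finite multiplicity (isolated as points of $\sigma(T)$), and $\sigma_e(T)=\sigma(T)\setminus\sigma_d(T)$ is the essential spectrum. *)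

(* Defs.v *)
From mathcomp Require Import all_boot all_order all_algebra.
From mathcomp Require Import all_classical all_reals all_analysis.
From mathcomp Require Import complex.

Set Implicit Arguments.
Unset Strict Implicit.
Unset Printing Implicit Defensive.

Import Order.TTheory GRing.Theory Num.Theory.
Import numFieldNormedType.Exports.
Import ComplexField.Normc.

Local Open Scope classical_set_scope.
Local Open Scope ring_scope.
Local Open Scope complex_scope.

Definition half_line (R : realType) : set R := `]0, +oo[%classic.
Arguments half_line : clear implicits.

(* The Hilbert space L_2(0, oo) is handled through representatives
   f : R -> R[i]: values outside (0, oo) are irrelevant, and equality of
   vectors is equality almost everywhere on (0, oo), [eqL2]. *)
Definition eqL2 (R : realType) (f g : R -> R[i]) : Prop :=
  ae_eq (@lebesgue_measure R) (half_line R) f g.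

Definition complex_measurable (R : realType) (f : R -> R[i]) : Prop :=
  measurable_fun (half_line R) (fun t => complex.Re (f t)) /\
  measurable_fun (half_line R) (fun t => complex.Im (f t)).

Definition L2 (R : realType) : set (R -> R[i]) :=
  [set f | complex_measurable f /\
    (\int[@lebesgue_measure R]_(t in half_line R)
       (normc (f t) ^+ 2)%:E < +oo)%E].

Definition integralC (R : realType) (f : R -> R[i]) : R[i] :=
  Rintegral (@lebesgue_measure R) (half_line R) (fun t => complex.Re (f t)) +i*
  Rintegral (@lebesgue_measure R) (half_line R) (fun t => complex.Im (f t)).

Definition innerL2 (R : realType) (f g : R -> R[i]) : R[i] :=
  integralC (fun t => f t * (g t)^*).

Definition normL2 (R : realType) (f : R -> R[i]) : R :=
  Num.sqrt (Rintegral (@lebesgue_measure R) (half_line R)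
              (fun t => normc (f t) ^+ 2)).

Definition lin_comb (R : realType) (n : nat) (c : 'I_n -> R[i])
    (e : 'I_n -> R -> R[i]) : R -> R[i] :=
  fun t => \sum_(i < n) c i * e i t.

(* E, as a subspace of L_2(0, oo), has a basis of n vectors. *)
Definition has_dim (R : realType) (E : set (R -> R[i])) (n : nat) : Prop :=
  exists e : 'I_n -> R -> R[i],
    [/\ forall i, E (e i),
        forall c, eqL2 (lin_comb c e) (fun=> 0) -> forall i, c i = 0 &
        forall y, E y -> exists c, eqL2 y (lin_comb c e)].

(* An operator T in L_2(0, oo) is given by its graph: T (u, f) means that u is
   in the domain of T and that T u = f. *)
Definition graph (R : realType) := set ((R -> R[i]) * (R -> R[i])).

Definition is_operator (R : realType) (T : graph R) : Prop :=
  [/\ forall u f, T (u, f) -> L2 u /\ L2 f,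
      forall u f v g, T (u, f) -> L2 v -> L2 g -> eqL2 u v -> eqL2 f g ->
        T (v, g),
      T (fun=> 0, fun=> 0),
      forall c u f v g, T (u, f) -> T (v, g) ->
        T ((c \*o u) \+ v, (c \*o f) \+ g) &
      forall u f g, T (u, f) -> T (u, g) -> eqL2 f g].

Definition densely_defined (R : realType) (T : graph R) : Prop :=
  forall v, L2 v -> forall e : R, 0 < e ->
    exists u f, T (u, f) /\ normL2 (u \- v) < e.

Definition closure_op (R : realType) (T : graph R) : graph R :=
  [set uf | [/\ L2 uf.1, L2 uf.2 &
    forall e : R, 0 < e -> exists v g,
      [/\ T (v, g), normL2 (uf.1 \- v) < e & normL2 (uf.2 \- g) < e]]].

Definition adjoint_op (R : realType) (T : graph R) : graph R :=
  [set vw | [/\ L2 vw.1, L2 vw.2 &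
    forall u f, T (u, f) -> innerL2 f vw.1 = innerL2 u vw.2]].

Definition self_adjoint (R : realType) (T : graph R) : Prop :=
  [/\ is_operator T, densely_defined T & T = adjoint_op T].

(* Ker (T - z) *)
Definition ker_op (R : realType) (T : graph R) (z : R[i]) : set (R -> R[i]) :=
  [set y | T (y, z \*o y)].

Definition deficiency_plus (R : realType) (T : graph R) (n : nat) : Prop :=
  forall z : R[i], 0 < complex.Im z -> has_dim (ker_op (adjoint_op T) z) n.

Definition deficiency_minus (R : realType) (T : graph R) (n : nat) : Prop :=
  forall z : R[i], complex.Im z < 0 -> has_dim (ker_op (adjoint_op T) z) n.

(* T - z is a bijection from its domain onto L_2(0, oo), with bounded
   inverse. *)
Definition resolvent_set (R : realType) (T : graph R) : set R[i] :=
  [set z |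
    [/\ forall u v f g, T (u, f) -> T (v, g) ->
          eqL2 (f \- (z \*o u)) (g \- (z \*o v)) -> eqL2 u v,
        forall h, L2 h ->
          exists u f, T (u, f) /\ eqL2 (f \- (z \*o u)) h &
        exists M : R, forall u f, T (u, f) ->
          normL2 u <= M * normL2 (f \- (z \*o u))]].

Definition spectrum (R : realType) (T : graph R) : set R[i] :=
  ~` resolvent_set T.

Definition eigenvalue_op (R : realType) (T : graph R) (z : R[i]) : Prop :=
  exists y, ker_op T z y /\ ~ eqL2 y (fun=> 0).

Definition isolated_spectrum (R : realType) (T : graph R) (z : R[i]) : Prop :=
  spectrum T z /\
  exists e : R, 0 < e /\
    forall w, spectrum T w -> normc (w - z) < e -> w = z.

Definition discrete_spectrum (R : realType) (T : graph R) : set R[i] :=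
  [set z | [/\ isolated_spectrum T z, eigenvalue_op T z &
               exists n, has_dim (ker_op T z) n]].

Definition essential_spectrum (R : realType) (T : graph R) : set R[i] :=
  spectrum T `\` discrete_spectrum T.

Definition abs_continuous (R : realType) (a b : R) (f : R -> R[i]) : Prop :=
  forall e : R, 0 < e -> exists d : R, 0 < d /\
    forall (n : nat) (x y : 'I_n -> R),
      (forall i, a <= x i /\ x i <= y i /\ y i <= b) ->
      (forall i j, i != j -> y i <= x j \/ y j <= x i) ->
      \sum_(i < n) (y i - x i) < d ->
      \sum_(i < n) normc (f (y i) - f (x i)) < e.

Definition loc_abs_continuous (R : realType) (f : R -> R[i]) : Prop :=
  forall a b : R, 0 < a -> a <= b -> abs_continuous a b f.

Definition derivableC (R : realType) (f : R -> R[i]) (t : R) : Prop :=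
  derivable (fun s => complex.Re (f s) : R) t 1 /\
  derivable (fun s => complex.Im (f s) : R) t 1.

(* A meaningful value at t only when [derivableC f t]. *)
Definition derivC (R : realType) (f : R -> R[i]) : R -> R[i] :=
  fun t => derive1 (fun s => complex.Re (f s) : R) t +i*
           derive1 (fun s => complex.Im (f s) : R) t.

(* y' exists everywhere on (0, oo); as y' is locally absolutely continuous,
   y'' then exists almost everywhere. *)
Definition Dl (R : realType) : set (R -> R[i]) :=
  [set y | [/\ forall t, 0 < t -> derivableC y t,
               loc_abs_continuous y & loc_abs_continuous (derivC y)]].

Definition sturm_liouville (R : realType) (p : R -> R) (y : R -> R[i]) :
    R -> R[i] :=
  fun t => - derivC (derivC y) t + (p t)%:C * y t.

(* The operator u |-> l[u] with domain { u in D | u, l[u] in L_2(0, oo) }. *)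
Definition sl_restriction (R : realType) (p : R -> R) (D : set (R -> R[i])) :
    graph R :=
  [set yf | [/\ L2 yf.1, L2 yf.2 &
    exists u, [/\ D u, eqL2 yf.1 u & eqL2 yf.2 (sturm_liouville p u)]]].

Definition maximal_operator (R : realType) (p : R -> R) : graph R :=
  sl_restriction p (@Dl R).

Definition compactly_supported (R : realType) : set (R -> R[i]) :=
  [set y | exists a b : R, [/\ 0 < a, a <= b &
    forall t, 0 < t -> (t < a \/ b < t) -> y t = 0]].

Definition minimal_operator (R : realType) (p : R -> R) : graph R :=
  closure_op (sl_restriction p (@Dl R `&` @compactly_supported R)).

Definition solution (R : realType) (p : R -> R) (lambda : R[i]) :
    set (R -> R[i]) :=
  [set y | Dl y /\ eqL2 (sturm_liouville p y \- (lambda \*o y))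
                        (fun=> 0)].

Definition integrable_near_zero (R : realType) (p : R -> R) : Prop :=
  forall c : R, 0 < c ->
    (@lebesgue_measure R).-integrable `]0, c[%classic (fun t => (p t)%:E).

(* Main.v *)
Require Import Defs.
From HB Require Import structures.
From mathcomp Require Import all_boot all_order all_algebra.
From mathcomp Require Import all_classical all_reals all_analysis.
From mathcomp Require Import complex measurable_realfun.
From mathcomp Require Import zify ring lra.
(* again, because derivC is also the name of a lemma on polynomials *)
Require Import Defs.

Set Implicit Arguments.
Unset Strict Implicit.
Unset Printing Implicit Defensive.

Import Order.TTheory GRing.Theory Num.Theory.
Import numFieldNormedType.Exports.
Import ComplexField.Normc.

Local Open Scope classical_set_scope.
Local Open Scope ring_scope.
Local Open Scope complex_scope.

(** The potential is p = level + Phi'' / Phi with a positive C^2 profile Phi.  The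
    half-line is cut into cells of length l; in the k-th cell Phi is a tiny
    constant eps k on the left half (a trough) and 1 on most of the right half (a
    well), and the level equals a number lev k from the trough through the well up
    to the next trough.  Where the level is constant, Phi solves l[y] = (lev k) y.
    The numbers lev k are in I, each of them has distances at least d k > 0 from all
    the others, and they have infinitely many limit points in I, also at distance at
    least d k from lev k ([exists_levels]).  The depths eps k are then chosen small
    compared with d k and d (k - 1).

    Essential spectrum.  Phi, cut off in the two troughs around the k-th well, is a
    compactly supported quasi-mode for lev k with an error of order
    eps k + eps (k + 1) ([exists_quasimode]).  A self-adjoint operator has a point
    of its spectrum within the error of each quasi-mode
    ([spectrum_near_approximate_eigenvalue]).  For every self-adjoint extension, a
    limit point of the levels is thus a limit of points of the spectrum, distinct
    from it because the error is smaller than d k; so it is not an isolated point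
    of the spectrum ([essential_spectrum_quasimodes]).

    Real solutions.  Let lambda be in I.  The intervals of radius d k / 2 about the
    levels are disjoint, so |lambda - lev k| >= d k / 2 for all k but at most one.  Write
    y = Phi v and w = Phi y' - Phi' y; then v' = w / Phi^2 and
    w' = - (lambda - level) Phi^2 v.  Going backwards through a cell, the well
    produces a flux w of size at least d k l v / 32, and in the trough v' =
    w / (eps k)^2 makes v much larger than it was: v at least doubles in every
    cell ([cell_decay]).  Hence the solutions which start with w = 0 at a far cell
    have, after normalization, a mass bounded independently of the starting point,
    and compactness yields an L_2 solution ([exists_L2_csol_real]).

    Dimensions.  The wells are windows of a fixed length, infinitely many, on which
    p >= mu1; this excludes two linearly independent L_2 solutions, at every
    spectral parameter ([limit_point_bounded_below]).  At a nonreal parameter an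
    L_2 solution exists by Weyl's argument ([exists_L2_csol_nonreal]).  The kernel
    of L_0^* - z consists of the L_2 solutions: one inclusion is Green's identity
    ([solution_adjoint]), the other the regularity of weak solutions
    ([weak_solution]).  Both rest on the fundamental theorem of calculus for
    absolutely continuous functions ([ac_derive1]), obtained from the total
    variation and the Radon--Nikodym theorem. *)

(** * Absolutely continuous functions *)
Section AbsolutelyContinuous.
Variable R : realType.
Implicit Types (a b e d : R) (f G : R -> R).
Notation mu := (@lebesgue_measure R).
Notation TV := total_variation.

Definition real_ac a b f := forall e, 0 < e -> exists d, 0 < d /\
  forall (n : nat) (x y : 'I_n -> R),
    (forall i, a <= x i /\ x i <= y i /\ y i <= b) ->
    (forall i j, i != j -> y i <= x j \/ y j <= x i) ->
    \sum_(i < n) (y i - x i) < d ->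
    \sum_(i < n) `|f (y i) - f (x i)| < e.

Lemma real_ac_finType a b f e : real_ac a b f -> 0 < e -> exists d, 0 < d /\
  forall (T : finType) (x y : T -> R),
    (forall i, a <= x i /\ x i <= y i /\ y i <= b) ->
    (forall i j, i != j -> y i <= x j \/ y j <= x i) ->
    \sum_i (y i - x i) < d ->
    \sum_i `|f (y i) - f (x i)| < e.
Proof.
move=> acf e0; have [d [d0 H]] := acf _ e0; exists d; split => // T x y xy dis s.
rewrite (reindex (@enum_val T predT)) /=; last exact/onW_bij/enum_val_bij.
apply: (H #|T| (x \o @enum_val T predT) (y \o @enum_val T predT)) => [i|i j ij|].
- exact: xy.
- by apply: dis; rewrite (inj_eq enum_val_inj).
- by move: s; rewrite (reindex (@enum_val T predT)) //=; exact/onW_bij/enum_val_bij.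
Qed.

(** A bound on all the sums of choices passes to the sum of the suprema, and
    each set is bounded because the other choices can be frozen. *)
Lemma sum_sup_le n (S : 'I_n -> set R) e :
  (forall i, S i !=set0) ->
  (forall g : 'I_n -> R, (forall i, S i (g i)) -> \sum_i g i <= e) ->
  (forall i, has_ubound (S i)) /\ \sum_i sup (S i) <= e.
Proof.
move=> S0 H; have [g0 Sg0] := choice S0.
have ub i : has_ubound (S i).
  exists (e - \sum_(j | j != i) g0 j) => x Sx.
  have := H (fun j => if j == i then x else g0 j) => /(_ _)/wrap[].
    by move=> j; case: ifP => // /eqP ->.
  rewrite (bigD1 i) //= eqxx (eq_bigr g0) => [|j /negbTE -> //].
  by move=> ?; rewrite lerBrDr.
split => //; rewrite leNgt; apply/negP => he.
set c := (\sum_i sup (S i) - e) / (n.+1)%:R.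
have c0 : 0 < c by rewrite divr_gt0 ?ltr0n // subr_gt0.
have Sc i : exists x, S i x /\ sup (S i) - c < x.
  by have [x Sx xc] := sup_adherent c0 (conj (S0 i) (ub i)); exists x.
have [g Sg] := choice Sc.
have /= := H g (fun i => (Sg i).1); apply/negP; rewrite -ltNge.
have : \sum_i (sup (S i) - c) <= \sum_i g i.
  by apply: ler_sum => i _; exact/ltW/(Sg i).2.
apply: lt_le_trans; rewrite sumrB sumr_const card_ord -mulr_natr.
have -> : c * n%:R = (\sum_i sup (S i) - e) - c.
  have n1 : (n.+1%:R : R) != 0 by rewrite pnatr_eq0.
  have -> : n%:R = n.+1%:R - 1 :> R by rewrite -natr1 addrK.
  by rewrite /c mulrBr mulr1 divfK.
lra.
Qed.

Lemma itv_partition_disjoint a b s (i j : 'I_(size s)) : itv_partition a b s ->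
  i != j -> nth b (a :: s) i.+1 <= nth b (a :: s) j \/
            nth b (a :: s) j.+1 <= nth b (a :: s) i.
Proof.
move=> [pas _]; wlog ij : i j / (i < j)%N => [H|] ij'.
  have [lt_ij|lt_ji] := orP (etrans (esym (neq_ltn i j)) ij'); first exact: H.
  by have [| |] := H j i lt_ji; [rewrite eq_sym|right|left].
left; have sas : sorted <=%O (a :: s).
  by apply: sub_path pas => x y; exact: ltW.
by apply: (sorted_leq_nth le_trans le_refl b sas) => //; rewrite inE /= ltnS // ltnW.
Qed.

Lemma itv_partition_step a b s (i : 'I_(size s)) : itv_partition a b s ->
  a <= nth b (a :: s) i /\ nth b (a :: s) i <= nth b (a :: s) i.+1 /\
  nth b (a :: s) i.+1 <= b.
Proof.
move=> abs; split; last split.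
- by apply: (itv_partition_nth_ge _ abs); rewrite ltnW // ltnS.
- have [pas _] := abs; have sas : sorted <=%O (a :: s).
    by apply: sub_path pas => x y; exact: ltW.
  by apply: (sorted_leq_nth le_trans le_refl b sas) => //; rewrite inE /= ltnS // ltnW.
- by apply: (itv_partition_nth_le _ abs); rewrite ltnS.
Qed.

Lemma itv_partition_sum a b s g : itv_partition a b s ->
  \sum_(i < size s) (g (nth b (a :: s) i.+1) - g (nth b (a :: s) i)) = g b - g a :> R.
Proof.
move=> abs; rewrite -(big_mkord xpredT (fun i => g (nth b (a :: s) i.+1) - g (nth b (a :: s) i))).
rewrite (telescope_sumr (fun i => g (nth b (a :: s) i))) //.
by rewrite (itv_partition_nth_size b abs).
Qed.

(** Subdividing each of finitely many disjoint intervals gives again finitely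
    many disjoint intervals of the same total length, so the modulus of absolute
    continuity of f bounds the sum of the variations as well. *)
Lemma sum_total_variation_ac a b f e : real_ac a b f -> 0 < e -> exists d, 0 < d /\
  forall (n : nat) (x y : 'I_n -> R),
    (forall i, a <= x i /\ x i <= y i /\ y i <= b) ->
    (forall i j, i != j -> y i <= x j \/ y j <= x i) ->
    \sum_(i < n) (y i - x i) < d ->
    (forall i, bounded_variation (x i) (y i) f) /\
    \sum_(i < n) fine (TV (x i) (y i) f) <= e.
Proof.
move=> acf e0; have [d [d0 H]] := real_ac_finType acf e0.
exists d; split => // n x y xy dis sd.
have [i||bv sume] := @sum_sup_le n (fun i => variations (x i) (y i) f) e.
- have [xi|xi] := eqVneq (x i) (y i).
    by exists 0; rewrite xi variationsxx.
  by apply: variations_neq0; rewrite lt_neqAle xi; have [_ []] := xy i.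
- move=> g Vg; have Pg i : exists s, itv_partition (x i) (y i) s /\ variation (x i) (y i) f s = g i.
    by have [s abs <-] := Vg i; exists s.
  have [s Hs] := choice Pg.
  pose T := {i : 'I_n & 'I_(size (s i))}.
  pose X (t : T) := nth (y (tag t)) (x (tag t) :: s (tag t)) (tagged t).
  pose Y (t : T) := nth (y (tag t)) (x (tag t) :: s (tag t)) (tagged t).+1.
  have -> : \sum_i g i = \sum_(t : T) `|f (Y t) - f (X t)|.
    rewrite (eq_bigr (fun i => \sum_(j < size (s i))
      `|f (nth (y i) (x i :: s i) j.+1) - f (nth (y i) (x i :: s i) j)|)).
      by rewrite sig_big_dep.
    by move=> i _; rewrite -(Hs i).2 /variation big_mkord.
  apply/ltW/H => [t|t u tu|].
  + have [h1 [h2 h3]] := itv_partition_step (tagged t) (Hs (tag t)).1.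
    have [k1 [k2 k3]] := xy (tag t).
    by split; [exact: le_trans h1|split => //; exact: le_trans k3].
  + case: t u tu => [i j] [i' j'] tu.
    have [ii'|ii'] := eqVneq i i'.
      subst i'; apply: (itv_partition_disjoint (Hs i).1).
      by apply/negP => /eqP /= jj; move: tu; rewrite jj eqxx.
    have [_ [_ h1]] := itv_partition_step j (Hs i).1.
    have [h2 _] := itv_partition_step j' (Hs i').1.
    have [_ [_ h1']] := itv_partition_step j' (Hs i').1.
    have [h2' _] := itv_partition_step j (Hs i).1.
    have [xx|xx] := dis i i' ii'; [left|right].
      exact: le_trans (le_trans xx h2).
    exact: le_trans (le_trans xx h2').
  + rewrite (le_lt_trans _ sd) //.
    have -> : \sum_(t : T) (Y t - X t) = \sum_i \sum_(j < size (s i))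
        (nth (y i) (x i :: s i) j.+1 - nth (y i) (x i :: s i) j).
      by rewrite sig_big_dep.
    by apply: ler_sum => i _; rewrite (itv_partition_sum idfun (Hs i).1).
split => //; apply: le_trans sume; apply: ler_sum => i _.
rewrite /total_variation ereal_sup_EFin //.
have [xi|xi] := eqVneq (x i) (y i).
  by exists 0; rewrite xi variationsxx.
by apply: variations_neq0; rewrite lt_neqAle xi; have [_ []] := xy i.
Qed.

Lemma real_acW a b c d f : a <= c -> d <= b -> real_ac a b f -> real_ac c d f.
Proof.
move=> ac db acf e e0; have [k [k0 H]] := acf e e0; exists k; split => // n x y xy.
apply: H => i; have [h1 [h2 h3]] := xy i.
by split; [exact: le_trans h1|split => //; exact: le_trans db].
Qed.

(** The variation is finite on intervals shorter than the modulus for 1, and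
    finitely many of them cover [a, b]. *)
Lemma real_ac_bounded_variation a b f : a <= b -> real_ac a b f ->
  bounded_variation a b f.
Proof.
move=> ab acf; have [d [d0 H]] := sum_total_variation_ac acf ltr01.
have short x y : a <= x -> x <= y -> y <= b -> y - x < d -> bounded_variation x y f.
  move=> ax xy yb yxd; have [|||h _] := H 1%N (fun=> x) (fun=> y).
  - by [].
  - by move=> i j; rewrite !ord1.
  - by rewrite big_ord1.
  exact: h ord0.
have [N Nd] : exists N : nat, (b - a) < N%:R * (d / 2).
  exists (Num.bound ((b - a) / (d / 2))).
  by rewrite -ltr_pdivrMr ?divr_gt0 // archi_boundP // divr_ge0 ?subr_ge0 // ltW ?divr_gt0.
have step (n : nat) x : a <= x -> x <= b -> x - a <= n%:R * (d / 2) -> bounded_variation a x f.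
  elim: n x => [|n IH] x ax xb xn.
    have -> : x = a by apply/eqP; rewrite eq_le ax andbT; lra.
    exact: bounded_variationxx.
  have [xd|xd] := ltP (x - d / 2) a; first by apply: short => //; lra.
  apply/bounded_variationP => //.
  have x2 : x - d / 2 <= x by lra.
  rewrite (total_variationD _ xd x2) fin_numD; apply/andP; split; apply/bounded_variationP => //.
    by apply: IH => //; [lra|move: xn; rewrite -natr1 mulrDl mul1r; lra].
  by apply: short => //; lra.
exact: (step N b ab (lexx b) (ltW Nd)).
Qed.

Lemma real_ac_TV a b f : a <= b -> real_ac a b f ->
  real_ac a b (fine \o TV a ^~ f).
Proof.
move=> ab acf e e0; have e20 : 0 < e / 2 by lra.
have [d [d0 H]] := sum_total_variation_ac acf e20.
exists d; split => // n x y xy dis sd.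
have [_ h] := H n x y xy dis sd.
have he : e / 2 < e by lra.
apply: le_lt_trans (le_lt_trans h he); apply: ler_sum => i _ /=; have [h1 [h2 h3]] := xy i.
have bv u v : a <= u -> u <= v -> v <= b -> TV u v f \is a fin_num.
  move=> au uv vb; apply/bounded_variationP => //; apply: real_ac_bounded_variation => //.
  exact: real_acW acf.
rewrite (total_variationD f h1 h2) fineD ?bv // ?(le_trans h2 h3) //.
by rewrite addrAC subrr add0r ger0_norm // fine_ge0 // total_variation_ge0.
Qed.

Lemma open_inf_notin (E : set R) : open E -> has_lbound E -> ~ E (inf E).
Proof.
move=> oE lE Ei; have /nbhs_ballP[r /= r0 br] : nbhs (inf E) E by exact: open_nbhs_nbhs.
have : E (inf E - r / 2).
  by apply: br; rewrite /ball /= opprB addrCA subrr addr0 gtr0_norm; lra.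
by move=> /(ge_inf lE); lra.
Qed.

Let clip a b x := Num.max a (Num.min x b).

Let clip_in a b x : a <= b -> a <= clip a b x <= b.
Proof. by move=> ab; rewrite /clip le_max lexx /= ge_max ab ge_min lexx orbT. Qed.

Let clip_id a b x : a <= x <= b -> clip a b x = x.
Proof. by move=> /andP[ax xb]; rewrite /clip (min_idPl xb) (max_idPr ax). Qed.

Let clip_le a b x y : x <= y -> clip a b x <= clip a b y.
Proof.
move=> xy; rewrite /clip /Num.max /Num.min.
by repeat case: ifPn; rewrite -?leNgt; lra.
Qed.

Let clip_dist a b x y : x <= y -> clip a b y - clip a b x <= y - x.
Proof.
move=> xy; rewrite /clip; rewrite /Num.max /Num.min.
by repeat case: ifPn; rewrite -?leNgt; lra.
Qed.

(** Absolute continuity of G makes its Lebesgue--Stieltjes measure vanish on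
    null sets: a null set lies in an open set of small measure, whose components
    are countably many disjoint intervals of small total length.  The density is
    the Radon--Nikodym derivative.  G is extended by constants outside [a, b] so
    that it defines a measure on the line. *)
Lemma nondecreasing_ac_integral a b G : a < b ->
  {in `[a, b] &, {homo G : x y / x <= y}} -> real_ac a b G ->
  exists h : R -> R, mu.-integrable setT (EFin \o h) /\
    forall x, a <= x <= b -> G x - G a = \int[mu]_(t in `[a, x]) h t.
Proof.
move=> ab ndG acG; pose H x := G (clip a b x).
have inab x : clip a b x \in `[a, b] by rewrite in_itv /= clip_in // ltW.
have ndH : {homo H : x y / x <= y} by move=> x y xy; apply: ndG => //; exact: clip_le.
have acH e : 0 < e -> exists d, 0 < d /\ forall n (x y : 'I_n -> R),
    (forall i, x i <= y i) -> (forall i j, i != j -> y i <= x j \/ y j <= x i) ->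
    \sum_(i < n) (y i - x i) < d -> \sum_(i < n) `|H (y i) - H (x i)| < e.
  move=> e0; have [d [d0 K]] := acG e e0; exists d; split => // n x y xy dis s.
  apply: (K n (clip a b \o x) (clip a b \o y)) => [i|i j ij|] /=.
  - have /andP[-> _] := clip_in (x i) (ltW ab); have /andP[_ ->] := clip_in (y i) (ltW ab).
    by split => //; split => //; exact: clip_le.
  - by have [h|h] := dis i j ij; [left|right]; exact: clip_le.
  - by apply: le_lt_trans s; apply: ler_sum => i _; exact: clip_dist.
have rcH x : H @ at_right x --> H x.
  apply/cvgrPdist_lt => e e0; have [d [d0 K]] := acH e e0.
  near=> y; have xy : x < y by near: y; exact: nbhs_right_gt.
  have := K 1%N (fun=> x) (fun=> y); rewrite !big_ord1 distrC; apply.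
  - by move=> _; exact: ltW.
  - by move=> i j; rewrite !ord1.
  - by rewrite ltrBlDl; near: y; apply: nbhs_right_lt; rewrite ltrDl.
pose cum : cumulative R R := HB.pack H (isCumulative.Build R _ R H ndH rcH).
pose nu0 := lebesgue_stieltjes_measure cum.
have nu0_oc x y : x <= y -> nu0 `]x, y]%classic = (H y - H x)%:E.
  move=> xy; rewrite /nu0 /lebesgue_stieltjes_measure /measure_extension measurable_mu_extE /=.
    by rewrite wlength_itv_bnd.
  exact: is_ocitv.
have mD : measurable (`]a, b]%classic : set (measurableTypeR R)) by exact: measurable_itv.
have finD : (nu0 `]a, b]%classic < +oo)%E by rewrite nu0_oc ?ltW // ltry.
pose nu : {finite_measure set (measurableTypeR R) -> \bar R} := mfrestr mD finD.
have numu : nu `<< mu.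
  apply/null_content_dominatesP => N mN muN0.
  apply/eqP; rewrite eq_le measure_ge0 andbT; apply/lee_addgt0Pr => e e0; rewrite add0e.
  have [d [d0 K]] := acH e e0.
  have [|U0 [oU0 NU0 muU0]] := @lebesgue_regularity_outer R N d mN _ d0.
    by rewrite muN0 ltry.
  pose U := U0 `&` `](a - 1), (b + 1)[%classic.
  have oU : open U by apply: openI => //; exact: interval_open.
  pose I := open_disjoint_itv oU.
  have mI q : measurable (I q : set (measurableTypeR R)).
    by apply: open_measurable; exact: open_disjoint_itv_open.
  have IU q : I q `<=` U.
    by rewrite (open_disjoint_itv_bigcup oU) => t It; exists q.
  have lI q : has_lbound (I q).
    by exists (a - 1) => t /IU[_]; rewrite /= in_itv /= => /andP[/ltW].
  have uI q : has_ubound (I q).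
    by exists (b + 1) => t /IU[_]; rewrite /= in_itv /= => /andP[_ /ltW].
  pose x q := if pselect (I q = set0) then b + 1 else inf (I q).
  pose y q := if pselect (I q = set0) then b + 1 else sup (I q).
  have xyE q : (I q = set0 /\ x q = b + 1 /\ y q = b + 1) \/
      (exists t, I q t) /\ x q = inf (I q) /\ y q = sup (I q).
    rewrite /x /y; case: pselect => /= h; first by left.
    by right; split => //; exact/set0P/eqP.
  have xy q : x q <= y q.
    have [[_ [-> ->]] //|[[t It] [-> ->]]] := xyE q.
    by apply: (@le_trans _ _ t); [exact: ge_inf|exact: ub_le_sup].
  have ooI q : `](x q), (y q)[%classic `<=` I q.
    have [[_ [-> ->]]|[[t It] [-> ->]]] := xyE q => s /=; rewrite in_itv /= => /andP[xs sy].
      by have := lt_trans xs sy; rewrite ltxx.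
    have [u Iu us] := inf_lt (ex_intro _ t It) xs.
    have [v Iv sv] := sup_gt (ex_intro _ t It) sy.
    by apply: (open_disjoint_itv_is_interval Iu Iv); rewrite (ltW us) (ltW sv).
  have Ioc q : I q `<=` `](x q), (y q)]%classic.
    move=> t It; have [[I0 _]|[_ [-> ->]]] := xyE q; first by rewrite I0 in It.
    rewrite /= in_itv /= (ub_le_sup (uI q) It) andbT lt_neqAle (ge_inf (lI q) It) andbT.
    apply/eqP => it; apply: (@open_inf_notin (I q)) => //; first exact: open_disjoint_itv_open.
    by rewrite it.
  have muI q : ((y q - x q)%:E <= mu (I q))%E.
    have -> : ((y q - x q)%:E = mu `](x q), (y q)[%classic)%E.
      rewrite lebesgue_measure_itv /= lte_fin; case: ltP => // yx.
      by congr EFin; have := xy q; lra.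
    by apply: le_measure; rewrite ?inE //; exact: measurable_itv.
  have nuI q : (nu0 (I q) <= (H (y q) - H (x q))%:E)%E.
    by rewrite -nu0_oc //; apply: le_measure; rewrite ?inE //; exact: measurable_itv.
  have tI : trivIset setT I by exact: open_disjoint_itv_trivIset.
  have UE : U = \bigcup_q I q by exact: open_disjoint_itv_bigcup.
  have muU : (mu U < d%:E)%E.
    apply: (@le_lt_trans _ _ (mu U0)).
      by apply: le_measure; rewrite ?inE; [exact: open_measurable..|exact: subIsetl].
    rewrite -(setDUK NU0) measureU //; last 2 first.
    - by apply: measurableD => //; exact: open_measurable.
    - by rewrite setDIK.
    by rewrite muN0 add0e.
  have sumx n : \sum_(q < n) (y q - x q) < d.
    rewrite -lte_fin; apply: le_lt_trans muU; rewrite UE measure_bigcup //=.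
    apply: (@le_trans _ _ (\sum_(0 <= q < n) mu (I q))%E).
      by rewrite big_mkord -sumEFin; apply: lee_sum => q _.
    apply: (le_trans (nneseries_lim_ge n (fun _ _ _ => measure_ge0 _ _))).
    by rewrite (eq_eseriesl (P := xpredT) (Q := fun q => q \in setT)) // => q; rewrite in_setT.
  have sumH n : (\sum_(0 <= q < n) nu0 (I q) <= e%:E)%E.
    apply: (@le_trans _ _ (\sum_(q < n) `|H (y q) - H (x q)|)%:E).
      rewrite big_mkord -sumEFin; apply: lee_sum => q _; apply: (le_trans (nuI q)).
      by rewrite lee_fin ler_norm.
    rewrite lee_fin; apply/ltW/K => // i j ij.
    have sup_le q : y q <= b + 1.
      have [[_ [_ ->]] //|[nI [_ ->]]] := xyE q; apply: ge_sup => // t /IU[_].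
      by rewrite /= in_itv /= => /andP[_ /ltW].
    have [[_ [xi _]]|[[s Is] _]] := xyE i; first by right; rewrite xi.
    have [[_ [xj _]]|[[t It] _]] := xyE j; first by left; rewrite xj.
    have [|h] := leP (y i) (x j); first by left.
    right; rewrite leNgt; apply/negP => h'.
    have xyi : x i < y i.
      have := Ioc i _ Is; rewrite /= in_itv /= => /andP[]; exact: lt_le_trans.
    have xyj : x j < y j.
      have := Ioc j _ It; rewrite /= in_itv /= => /andP[]; exact: lt_le_trans.
      (* overlapping intervals would have a common point in the disjoint components *)
  have [m] : exists m, [/\ x i < m, m < y i, x j < m & m < y j].
      exists ((Num.max (x i) (x j) + Num.min (y i) (y j)) / 2).
      clear -xyi xyj h h'; rewrite /Num.max /Num.min.
      by split; repeat case: ifPn; rewrite -?leNgt; lra.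
    move=> [m1 m2 m3 m4].
    have mi : I i m by apply: ooI; rewrite /= in_itv /= m1.
    have mj : I j m by apply: ooI; rewrite /= in_itv /= m3.
    have /trivIsetP/(_ (i : nat) (j : nat) Logic.I Logic.I ij) := tI.
    by move=> E; have : (I i `&` I j) m by []; rewrite E.
  apply: (@le_trans _ _ (nu0 U)).
    apply: le_measure; rewrite ?inE; [exact: measurableI|exact: open_measurable|].
    move=> t [Nt]; rewrite /= in_itv /= => /andP[at_ tb]; split; first exact: NU0.
    by rewrite /= in_itv /=; lra.
  rewrite UE /nu0 measure_semi_bigcup //; last by rewrite -UE; exact: open_measurable.
  apply: lime_le; first exact: is_cvg_nneseries.
  by apply: nearW => n; exact: sumH.
pose h t := fine (Radon_Nikodym_SigmaFinite.f nu mu t).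
have hf : EFin \o h = Radon_Nikodym_SigmaFinite.f nu mu.
  by apply/funext => t; rewrite /h /= fineK //; exact: Radon_Nikodym_SigmaFinite.f_fin_num.
exists h; split; first by rewrite hf; exact: Radon_Nikodym_SigmaFinite.f_integrable.
move=> x /andP[ax xb].
have aE : clip a b a = a by apply: clip_id; rewrite lexx ltW.
have xE : clip a b x = x by apply: clip_id; rewrite ax.
have nuE : nu `]a, x]%classic = (G x - G a)%:E.
  rewrite -[LHS]/(nu0 (`]a, x]%classic `&` `]a, b]%classic)) setIidl.
    by rewrite nu0_oc // /H aE xE.
  by move=> t /=; rewrite !in_itv /= => /andP[-> /le_trans ->].
rewrite /Rintegral -integral_itv_obnd_cbnd; last first.
  rewrite (_ : (fun t => (h t)%:E) = EFin \o h) // hf; apply: measurable_funTS.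
  by apply: (measurable_int mu); exact: Radon_Nikodym_SigmaFinite.f_integrable.
by rewrite (_ : (fun t => (h t)%:E) = EFin \o h) // hf -Radon_Nikodym_SigmaFinite.f_integral // nuE.
Unshelve. all: by end_near. Qed.

(** Jordan decomposition: f = V - (V - f) with V the variation of f on [a, t];
    both terms are nondecreasing and absolutely continuous. *)
Lemma ac_integral a b f : a < b -> real_ac a b f ->
  exists h : R -> R, mu.-integrable setT (EFin \o h) /\
    forall x, a <= x <= b -> f x - f a = \int[mu]_(t in `[a, x]) h t.
Proof.
move=> ab acf; pose V := fine \o TV a ^~ f.
have acV : real_ac a b V by apply: real_ac_TV => //; exact: ltW.
have TVfin x y : a <= x -> x <= y -> y <= b -> TV x y f \is a fin_num.
  move=> ax xy yb; apply/bounded_variationP => //; apply: real_ac_bounded_variation => //.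
  exact: real_acW acf.
have VB x y : a <= x -> x <= y -> y <= b -> `|f y - f x| <= V y - V x.
  move=> ax xy yb; rewrite /V /= (total_variationD f ax xy) fineD ?TVfin ?(le_trans xy yb) //.
  rewrite addrAC subrr add0r -lee_fin fineK ?TVfin //; exact: total_variation_ge.
have ndV : {in `[a, b] &, {homo V : x y / x <= y}}.
  move=> x y; rewrite !in_itv /= => /andP[ax _] /andP[_ yb] xy.
  by rewrite -subr_ge0; apply: le_trans (VB x y ax xy yb).
have acW : real_ac a b (fun x => V x - f x).
  move=> e e0; have e20 : 0 < e / 2 by lra.
  have [d1 [d10 K1]] := acV _ e20; have [d2 [d20 K2]] := acf _ e20.
  exists (Num.min d1 d2); split; first by rewrite lt_min d10.
  move=> n x y xy dis; rewrite lt_min => /andP[s1 s2].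
  have := ltrD (K1 n x y xy dis s1) (K2 n x y xy dis s2).
  rewrite -splitr -big_split /=; apply: le_lt_trans; apply: ler_sum => i _.
  by rewrite opprD addrACA -opprD (le_trans (ler_normB _ _)).
have ndW : {in `[a, b] &, {homo (fun x => V x - f x) : x y / x <= y}}.
  move=> x y; rewrite !in_itv /= => /andP[ax _] /andP[_ yb] xy.
  by have := VB x y ax xy yb; have := ler_norm (f y - f x); lra.
have [g [ig Hg]] := nondecreasing_ac_integral ab ndV acV.
have [k [ik Hk]] := nondecreasing_ac_integral ab ndW acW.
exists (g \- k); split.
  by rewrite (_ : EFin \o _ = (EFin \o g) \- (EFin \o k))%E //; exact: integrableB.
move=> x axb; rewrite RintegralB //=; last 2 first.
- exact: integrableS ig.
- exact: integrableS ik.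
by rewrite -Hg // -Hk //; lra.
Qed.

(** Since the values of [derive1] at the exceptional points are arbitrary, the
    density is a separate function [h], which is measurable. *)
Lemma ac_derive1 a b f : a < b -> real_ac a b f ->
  exists h : R -> R, [/\ mu.-integrable setT (EFin \o h),
    forall x, a <= x <= b -> f x - f a = \int[mu]_(t in `[a, x]) h t &
    {ae mu, forall t, a < t < b -> derivable f t 1 /\ derive1 f t = h t}].
Proof.
move=> ab acf; have [h [ih Hh]] := ac_integral ab acf; exists h; split => //.
have iha : forall y, mu.-integrable [set` Interval (BLeft a) (BRight y)] (EFin \o h).
  by move=> y; apply: integrableS ih.
have lh : locally_integrable setT h.
  have := @integrable_locally R h setT measurableT ih; rewrite patch_setT //.
have ae1 := FTC1 iha lh.
move: ae1; apply: filterS; first exact: (ae_filter_ringOfSetsType mu).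
move=> t Ht /andP[at_ tb].
have [|dF F'] := Ht; first by rewrite /= lte_fin.
have nf : \forall s \near t, f a + \int[mu]_(u in `[a, s]) h u = f s.
  have tab : t \in `]a, b[ by rewrite in_itv /= at_.
  apply: filterS (near_in_itvoo tab) => s; rewrite in_itv /= => /andP[as_ sb].
  by rewrite -Hh ?(ltW as_) ?(ltW sb) // addrCA subrr addr0.
have dF' : is_derive t 1 (fun s => f a + \int[mu]_(u in `[a, s]) h u) (h t).
  have dI : is_derive t 1 (fun s => \int[mu]_(u in `[a, s]) h u) (h t).
    by apply: (DeriveDef dF); rewrite -derive1E.
  by rewrite -[h t]add0r; exact: (is_deriveD (is_derive_cst (f a) t 1) dI).
have [df <-] := near_eq_is_derive nf dF'.
by rewrite derive1E.
Qed.
End AbsolutelyContinuous.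

(** * Antiderivatives and comparison of increments *)
Section Calculus.
Variable R : realType.
Implicit Types (a b t : R) (f g : R -> R).
Notation mu := (@lebesgue_measure R).

(** The second integral is the one that counts for negative t: the integral
    over a reversed interval is 0. *)
Definition prim f t : R :=
  \int[mu]_(s in `[0, t]) f s - \int[mu]_(s in `[t, 0]) f s.

Lemma continuous_integrable f a b : continuous f ->
  mu.-integrable `[a, b] (EFin \o f).
Proof.
move=> cf; apply: continuous_compact_integrable; first exact: segment_compact.
exact: continuous_subspaceT.
Qed.

Lemma Rintegral_chasles f a b c : continuous f -> a <= b -> b <= c ->
  \int[mu]_(s in `[a, c]) f s =
  \int[mu]_(s in `[a, b]) f s + \int[mu]_(s in `[b, c]) f s.
Proof.
move=> cf ab bc.
have := @Rintegral_itvB R f (BLeft a) (BRight c) b (continuous_integrable _ _ cf).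
rewrite !bnd_simp => /(_ ab bc) H.
rewrite -(Rintegral_itv_obnd_cbnd (r := b)); first by rewrite -H addrC subrK.
apply: integrableS (continuous_integrable b c cf) => //.
by apply: subset_itvr; rewrite bnd_simp.
Qed.

Lemma Rintegral_itv1 f a : \int[mu]_(s in `[a, a]) f s = 0.
Proof. by rewrite set_itv1 Rintegral_set1. Qed.

Lemma prim_from f m t : continuous f -> m <= 0 -> m <= t ->
  prim f t = \int[mu]_(s in `[m, t]) f s - \int[mu]_(s in `[m, 0]) f s.
Proof.
move=> cf m0 mt; rewrite /prim; have [t0|t0] := leP 0 t.
  rewrite (Rintegral_chasles cf m0 t0) [RHS]addrC addKr.
  have [->|tn0] := eqVneq t 0; first by rewrite Rintegral_itv1 subrr.
  rewrite [X in _ - X](_ : _ = 0) ?subr0 //.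
  by rewrite set_itv_ge ?Rintegral_set0 // bnd_simp -ltNge lt_neqAle eq_sym tn0.
rewrite (Rintegral_chasles cf mt (ltW t0)) opprD addNKr.
by rewrite set_itv_ge ?Rintegral_set0 ?sub0r // bnd_simp -ltNge.
Qed.

Lemma prim0 f : prim f 0 = 0.
Proof. by rewrite /prim subrr. Qed.

Lemma primE f a b : continuous f -> a <= b ->
  prim f b - prim f a = \int[mu]_(t in `[a, b]) f t.
Proof.
move=> cf ab; pose m := Num.min a 0.
have m0 : m <= 0 by rewrite /m ge_min lexx orbT.
have ma : m <= a by rewrite /m ge_min lexx.
rewrite !(@prim_from f m) ?(le_trans ma ab) // (Rintegral_chasles cf ma ab); ring.
Qed.

Lemma is_derive_prim f t : continuous f -> is_derive t 1 (prim f) (f t).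
Proof.
move=> cf; pose m := Num.min t 0 - 1.
have m0 : m < 0 by rewrite /m ltrBlDr (@le_lt_trans _ _ 0) ?ge_min ?lexx ?orbT //; lra.
have mt : m < t by rewrite /m ltrBlDr (@le_lt_trans _ _ t) ?ge_min ?lexx //; lra.
have tt1 : t < t + 1 by lra.
have [dI I'] := continuous_FTC1_closed tt1 (continuous_integrable m (t + 1) cf) mt (cf t).
have nf : \forall s \near t,
    (\int[mu]_(u in `[m, s]) f u) - (\int[mu]_(u in `[m, 0]) f u) = prim f s.
  have tab : t \in `]m, (t + 1)[ by rewrite in_itv /= mt tt1.
  apply: filterS (near_in_itvoo tab) => s; rewrite in_itv /= => /andP[ms _].
  by rewrite (@prim_from f m) // ltW.
have dI' : is_derive t 1 (fun s => \int[mu]_(u in `[m, s]) f u) (f t).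
  by apply: (DeriveDef dI); rewrite -derive1E.
apply: near_eq_is_derive nf _; rewrite -[f t]subr0.
exact: (is_deriveB dI' (is_derive_cst (\int[mu]_(u in `[m, 0]) f u) t 1)).
Qed.

Lemma primB f g t : continuous f -> continuous g ->
  prim (fun s => f s - g s) t = prim f t - prim g t.
Proof.
by move=> cf cg; rewrite /prim !RintegralB //=; try exact: continuous_integrable; ring.
Qed.

Lemma le_of_eq (x y : R) : x = y -> x <= y.
Proof. by move=> ->. Qed.

Lemma is_derive_continuous f t d : is_derive t 1 f d -> {for t, continuous f}.
Proof. by move=> [df _]; apply/differentiable_continuous/derivable1_diffP. Qed.

(** Integral estimates are used in this form, so that no integral has to be
    written down: only antiderivatives of the two sides matter. *)
Lemma ler_increment a b f g (f' g' : R -> R) : a <= b ->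
  (forall t, a <= t <= b -> is_derive t 1 f (f' t)) ->
  (forall t, a <= t <= b -> is_derive t 1 g (g' t)) ->
  (forall t, a <= t <= b -> f' t <= g' t) ->
  f b - f a <= g b - g a.
Proof.
move=> ab df dg le; pose h t := g t - f t.
have dh t : t \in `]a, b[ -> is_derive t 1 h (g' t - f' t).
  rewrite in_itv /= => /andP[/ltW at_ /ltW tb].
  by apply: is_deriveB; [apply: dg|apply: df]; rewrite at_.
have ch : {within `[a, b], continuous h}.
  apply: derivable_within_continuous => t; rewrite in_itv /= => tab.
  by have [] : is_derive t 1 h (g' t - f' t) by apply: is_deriveB; [exact: dg|exact: df].
have [c cab hE] := MVT_segment ab dh ch.
move: cab; rewrite in_itv /= => cab; have := le _ cab.
rewrite -subr_ge0 => le0.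
have : 0 <= h b - h a by rewrite hE mulr_ge0 // subr_ge0.
by rewrite /h; lra.
Qed.

Lemma ler_norm_increment a b f g (f' g' : R -> R) : a <= b ->
  (forall t, a <= t <= b -> is_derive t 1 f (f' t)) ->
  (forall t, a <= t <= b -> is_derive t 1 g (g' t)) ->
  (forall t, a <= t <= b -> `|f' t| <= g' t) ->
  `|f b - f a| <= g b - g a.
Proof.
move=> ab df dg le; rewrite ler_norml; apply/andP; split.
  rewrite lerNl.
  have := @ler_increment a b (fun t => - f t) g (fun t => - f' t) g' ab.
  move=> H; apply: le_trans (H _ dg _); first by rewrite opprB opprK addrC.
    by move=> t tab; apply: is_deriveN; exact: df.
  by move=> t tab; have := le t tab; rewrite ler_norml; lra.
apply: (@ler_increment a b f g f' g' ab df dg) => t tab.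
by have := le t tab; rewrite ler_norml; lra.
Qed.

Lemma is_derive_eq' f t (d d' : R) : is_derive t 1 f d -> d = d' -> is_derive t 1 f d'.
Proof. by move=> ? <-. Qed.

Lemma dMul f g t (df dg : R) : is_derive t 1 f df -> is_derive t 1 g dg ->
  is_derive t 1 (fun s => f s * g s) (df * g t + f t * dg).
Proof.
move=> hf hg; apply: is_derive_eq' (is_deriveM hf hg) _.
by rewrite /GRing.scale /=; ring.
Qed.

Lemma dAdd f g t (df dg : R) : is_derive t 1 f df -> is_derive t 1 g dg ->
  is_derive t 1 (fun s => f s + g s) (df + dg).
Proof. exact: is_deriveD. Qed.

Lemma dSub f g t (df dg : R) : is_derive t 1 f df -> is_derive t 1 g dg ->
  is_derive t 1 (fun s => f s - g s) (df - dg).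
Proof. exact: is_deriveB. Qed.

Lemma dOpp f t (df : R) : is_derive t 1 f df -> is_derive t 1 (fun s => - f s) (- df).
Proof. exact: is_deriveN. Qed.

Lemma dCst (c t : R) : is_derive t 1 (fun=> c) 0.
Proof. exact: is_derive_cst. Qed.

Lemma dId t : is_derive t (1 : R) (fun s : R => s) 1.
Proof. exact: is_derive_id. Qed.

Lemma dScale (c : R) f t (df : R) : is_derive t 1 f df -> is_derive t 1 (fun s => c * f s) (c * df).
Proof. by move=> hf; apply: is_derive_eq' (dMul (dCst c t) hf) _; rewrite mul0r add0r. Qed.

Lemma dInv f t (df : R) : f t != 0 -> is_derive t 1 f df ->
  is_derive t 1 (fun s => (f s)^-1) (- df / f t ^+ 2).
Proof.
move=> f0 hf; apply: is_derive_eq' (is_deriveV f0 hf) _.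
by rewrite /GRing.scale /=; field.
Qed.

Lemma dComp f g t (df dg : R) : is_derive t 1 f df -> is_derive (f t) 1 g dg ->
  is_derive t 1 (fun s => g (f s)) (dg * df).
Proof. by move=> hf hg; exact: is_derive1_comp. Qed.

End Calculus.

(** * Linear differential systems *)
Section Picard.
Variable R : realType.

Lemma continuous_bounded (f : R -> R) (a b : R) : continuous f ->
  exists K : R, 0 <= K /\ forall t, a <= t <= b -> `|f t| <= K.
Proof.
move=> cf; have [ab|ba] := leP a b; last first.
  by exists 0; split => // t /andP[h1 h2]; have := lt_le_trans ba (le_trans h1 h2); rewrite ltxx.
have cn : {within `[a, b], continuous (fun t => `|f t|)}.
  by apply: continuous_subspaceT => t; apply: continuous_comp; [exact: cf|exact: norm_continuous].
have [c _ Hc] := EVT_max ab cn.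
by exists `|f c|; split => // t tab; apply: Hc; rewrite in_itv.
Qed.

(** Limits of geometrically convergent sequences are handled without topology:
    every bound with a factor 2^-k for all k is a bound by 0. *)
Lemma le0_geometric (x C : R) : (forall k, x <= C / 2 ^+ k) -> x <= 0.
Proof.
move=> H; rewrite leNgt; apply/negP => x0.
have C0 : 0 < C by have := H 0%N; rewrite expr0 divr1; exact: lt_le_trans.
have [k Ck] : exists k : nat, C / x < k%:R.
  by exists (Num.bound (C / x)); rewrite archi_boundP // divr_ge0 // ltW.
have : (k%:R : R) < 2 ^+ k by rewrite -natrX ltr_nat ltn_expl.
have := H k; rewrite ler_pdivlMr ?exprn_gt0 // => h1 h2.
rewrite ltr_pdivrMr // mulrC in Ck.
have : x * k%:R < x * 2 ^+ k by rewrite ltr_pM2l.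
by lra.
Qed.

(** The rate of convergence is part of the notion, for every admissible constant
    C, so that the same limit can be estimated locally uniformly in a parameter. *)
Definition geometric_limit (u : nat -> R) (l : R) :=
  forall C, (forall k, `|u k.+1 - u k| <= C / 2 ^+ k) ->
    forall k, `|u k - l| <= 2 * C / 2 ^+ k.

Lemma exists_geometric_limit (u : nat -> R) (C : R) :
  (forall k, `|u k.+1 - u k| <= C / 2 ^+ k) -> exists l, geometric_limit u l.
Proof.
move=> HC.
have P (D : R) k : 2 * D / 2 ^+ k.+1 = D / 2 ^+ k.
  by rewrite exprS; field; rewrite expf_neq0.
have dist (D : R) : (forall k, `|u k.+1 - u k| <= D / 2 ^+ k) -> forall k j,
    `|u (k + j)%N - u k| <= 2 * D / 2 ^+ k - 2 * D / 2 ^+ (k + j).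
  move=> HD k; elim=> [|j IH]; first by rewrite addn0 !subrr normr0.
  rewrite addnS P; have := HD (k + j)%N.
  have -> : u (k + j).+1 - u k = (u (k + j).+1 - u (k + j)%N) + (u (k + j)%N - u k) by ring.
  move=> h; apply: le_trans (ler_normD _ _) _; apply: le_trans (lerD h IH) _.
  lra.
have C0 : 0 <= C by have := HC 0%N; rewrite expr0 divr1; exact: le_trans (normr_ge0 _).
pose S := [set u k - 2 * C / 2 ^+ k | k in [set: nat]].
have ab k m : u k - 2 * C / 2 ^+ k <= u m + 2 * C / 2 ^+ m.
  have pos j : 0 <= 2 * C / 2 ^+ j by rewrite !mulr_ge0 // invr_ge0 exprn_ge0.
  have [km|mk] := leqP k m.
    have := dist C HC k (m - k)%N; rewrite subnKC // ler_norml.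
    by have := pos m; lra.
  have := dist C HC m (k - m)%N; rewrite subnKC ?(ltnW mk) // ler_norml.
  by have := pos k; lra.
have ubS : has_ubound S by exists (u 0%N + 2 * C / 2 ^+ 0) => _ [k _ <-]; exact: ab.
have S0 : S !=set0 by exists (u 0%N - 2 * C / 2 ^+ 0); exists 0%N.
have lC k : `|u k - sup S| <= 2 * C / 2 ^+ k.
  have h1 : u k - 2 * C / 2 ^+ k <= sup S by apply: ub_le_sup => //; exists k.
  have h2 : sup S <= u k + 2 * C / 2 ^+ k by apply: ge_sup => // _ [m _ <-]; exact: ab.
  by rewrite ler_norml; lra.
exists (sup S) => D HD k; rewrite -subr_le0; apply: (@le0_geometric _ (2 * C)) => j.
have D0 : 0 <= D by have := HD 0%N; rewrite expr0 divr1; exact: le_trans (normr_ge0 _).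
have pos : 0 <= 2 * D / 2 ^+ (k + j) by rewrite !mulr_ge0 // invr_ge0 exprn_ge0.
have cj : 2 * C / 2 ^+ (k + j) <= 2 * C / 2 ^+ j.
  rewrite ler_wpM2l ?mulr_ge0 // lef_pV2 ?posrE ?exprn_gt0 //.
  by rewrite ler_weXn2l ?leq_addl //; lra.
have := dist D HD k j; have := lC (k + j)%N; rewrite !ler_norml => h1 h2.
have : `|u k - sup S| <= 2 * D / 2 ^+ k + 2 * C / 2 ^+ j by rewrite ler_norml; lra.
by lra.
Qed.

Section LinearSystem.
Variables (n : nat) (A : 'I_n -> 'I_n -> R -> R) (y0 : 'I_n -> R).
Hypothesis cA : forall i j, continuous (A i j).

Let rhs (y : 'I_n -> R -> R) i t := \sum_j A i j t * y j t.

(* the Picard iterates *)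
Let Y := fix Y (k : nat) (i : 'I_n) (t : R) : R :=
  if k is k'.+1 then y0 i + prim (rhs (Y k') i) t else y0 i.

Let continuous_rhs y i : (forall j, continuous (y j)) -> continuous (rhs y i).
Proof.
move=> cy; rewrite /rhs; have cj j : continuous (fun t => A i j t * y j t).
  by move=> t; apply: cvgM; [exact: cA|exact: cy].
elim: (index_enum _) => [|j s IH].
  rewrite (_ : (fun _ => _) = fun=> 0); first exact: cst_continuous.
  by apply/funext => t; rewrite big_nil.
rewrite (_ : (fun _ => _) = fun t => A i j t * y j t + \sum_(j <- s) A i j t * y j t).
  by move=> t; apply: cvgD; [exact: cj|exact: IH].
by apply/funext => t; rewrite big_cons.
Qed.

Let continuous_Y k i : continuous (Y k i).
Proof.
elim: k i => [|k IH] i; first exact: cst_continuous.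
move=> t; apply: (@is_derive_continuous _ _ _ (0 + rhs (Y k) i t)).
apply: (@dAdd R (fun=> y0 i) (prim (rhs (Y k) i)) t 0 (rhs (Y k) i t)).
by apply: is_derive_prim; exact: continuous_rhs.
Qed.

Let rhs_bound T : exists L, 0 < L /\ forall (y : 'I_n -> R -> R) t M,
  - T <= t <= T -> (forall j, `|y j t| <= M) -> forall i, `|rhs y i t| <= L * M.
Proof.
have KA ij : exists K, 0 <= K /\ forall t, - T <= t <= T -> `|A ij.1 ij.2 t| <= K.
  exact: continuous_bounded.
have [K HK] := choice KA.
pose L := \sum_i \sum_j K (i, j).
have L0 : 0 <= L by apply: sumr_ge0 => i _; apply: sumr_ge0 => j _; exact: (HK _).1.
exists (L + 1); split; first by lra.
move=> y t M tT yM i; rewrite /rhs; apply: le_trans (ler_norm_sum _ _ _) _.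
have M0 : 0 <= M by apply: le_trans (yM i).
apply: (@le_trans _ _ (\sum_j K (i, j) * M)).
  apply: ler_sum => j _; rewrite normrM; apply: ler_pM => //.
  exact: (HK (i, j)).2.
rewrite -mulr_suml ler_wpM2r //; apply: (@le_trans _ _ L); last by lra.
rewrite /L [leRHS](bigD1 i) //= lerDl; apply: sumr_ge0 => i' _; apply: sumr_ge0 => j _.
exact: (HK _).1.
Qed.

Let dexp (c t : R) : is_derive t 1 (fun s => expR (c * s)) (c * expR (c * t)).
Proof.
apply: is_derive_eq' (dComp (dScale c (dId t)) (is_derive_expR _)) _.
by rewrite mulr1 mulrC.
Qed.

(* Integration of a bound that grows like an exponential in |t|, on either
   side of 0. *)
Let prim_exp_bound f (L M t : R) : continuous f -> 0 < L ->
  (forall s, `|s| <= `|t| -> `|f s| <= L * M * expR (2 * L * `|s|)) ->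
  `|prim f t| <= M / 2 * expR (2 * L * `|t|).
Proof.
move=> cf L0 Hf.
have M0 : 0 <= M.
  have := le_trans (normr_ge0 _) (Hf 0 _); rewrite normr0 mulr0 expR0 mulr1 => /(_ (normr_ge0 _)).
  by rewrite pmulr_rge0.
have [t0|t0] := leP 0 t.
  have := @ler_norm_increment R 0 t (prim f) (fun s => M / 2 * expR (2 * L * s)) f
    (fun s => M / 2 * (2 * L * expR (2 * L * s))) t0.
  rewrite prim0 subr0 mulr0 expR0 (ger0_norm t0) => /(_ _)/wrap[].
    by move=> s _; exact: is_derive_prim.
  move=> /(_ _)/wrap[]; first by move=> s _; apply: dScale; exact: dexp.
  move=> /(_ _)/wrap[].
    move=> s /andP[s0 st]; have := Hf s; rewrite (ger0_norm s0) (ger0_norm t0) => /(_ st)/le_trans; apply.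
    by apply: le_of_eq; field.
  move=> h; apply: le_trans h _; rewrite lerBlDr lerDl; lra.
have := @ler_norm_increment R t 0 (prim f) (fun s => - (M / 2) * expR (- (2 * L) * s)) f
    (fun s => - (M / 2) * (- (2 * L) * expR (- (2 * L) * s))) (ltW t0).
rewrite prim0 sub0r normrN mulr0 expR0 (ltr0_norm t0) => /(_ _)/wrap[].
  by move=> s _; exact: is_derive_prim.
move=> /(_ _)/wrap[]; first by move=> s _; apply: dScale; exact: dexp.
move=> /(_ _)/wrap[].
  move=> s /andP[ts s0]; have := Hf s; rewrite (ler0_norm s0) (ltr0_norm t0) lerN2.
  move=> /(_ ts)/le_trans; apply.
  have -> : 2 * L * - s = - (2 * L) * s by ring.
  by apply: le_of_eq; field.
have -> : - (2 * L) * t = 2 * L * - t by ring.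
by move=> h; apply: le_trans h _; lra.
Qed.

(** In the norm weighted by expR (2 L |t|), with L a bound of the system on
    [-T, T], each Picard step halves the distance of consecutive iterates, on the
    whole of [-T, T]; hence the solution is global. *)
Lemma exists_linear_system_solution : exists y : 'I_n -> R -> R,
  (forall i, y i 0 = y0 i) /\
  forall i (t : R), is_derive t 1 (y i) (\sum_j A i j t * y j t).
Proof.
have step T : 0 <= T -> exists C, forall t, - T <= t <= T -> forall i k,
    `|Y k.+1 i t - Y k i t| <= C / 2 ^+ k.
  move=> T0; have [L [L0 HL]] := rhs_bound T.
  have [B [B0 HB]] : exists B : R, 0 <= B /\ forall i t, - T <= t <= T -> `|Y 1 i t - Y 0 i t| <= B.
    have KB i : exists K, 0 <= K /\ forall t, - T <= t <= T -> `|Y 1 i t - Y 0 i t| <= K.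
      by apply: continuous_bounded => t; apply: cvgB; exact: continuous_Y.
    have [K HK] := choice KB; exists (\sum_i K i); split; first by apply: sumr_ge0 => i _; exact: (HK i).1.
    move=> i t tT; apply: le_trans ((HK i).2 t tT) _.
    by rewrite (bigD1 i) //= lerDl; apply: sumr_ge0 => j _; exact: (HK j).1.
  have key k i t : - T <= t <= T -> `|Y k.+1 i t - Y k i t| <= B / 2 ^+ k * expR (2 * L * `|t|).
    elim: k i t => [|k IH] i t tT.
      rewrite expr0 divr1; apply: le_trans (HB i t tT) _; rewrite ler_peMr // -expR0 ler_expR.
      by rewrite !mulr_ge0 // ltW.
    have -> : Y k.+2 i t - Y k.+1 i t =
        prim (fun s => rhs (fun j s => Y k.+1 j s - Y k j s) i s) t.
      rewrite -[LHS]/(y0 i + prim (rhs (Y k.+1) i) t - (y0 i + prim (rhs (Y k) i) t)).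
      rewrite opprD addrACA subrr add0r -primB; try by apply: continuous_rhs => j; exact: continuous_Y.
      congr prim; apply/funext => s; rewrite /rhs -sumrB; apply: eq_bigr => j _.
      by rewrite mulrBr.
    have -> : B / 2 ^+ k.+1 = (B / 2 ^+ k) / 2.
      by rewrite exprS; field; rewrite expf_neq0.
    apply: prim_exp_bound => //.
      by apply: continuous_rhs => j s; apply: cvgB; exact: continuous_Y.
    move=> s st; rewrite -mulrA.
    have sT : - T <= s <= T.
      by rewrite -ler_norml; apply: le_trans st _; move: tT; rewrite -ler_norml.
    by apply: HL => // j; exact: IH.
  exists (B * expR (2 * L * T)) => t tT i k; apply: le_trans (key k i t tT) _.
  rewrite mulrAC ler_wpM2r ?invr_ge0 ?exprn_ge0 // ler_wpM2l // ler_expR.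
  apply: ler_wpM2l; first by rewrite mulr_ge0 // ltW.
  by rewrite ler_norml.
pose Cst T : R := if pselect (0 <= T) is left T0 then sval (cid (step T T0)) else 0.
have stepC T : 0 <= T -> forall t, - T <= t <= T -> forall i k,
    `|Y k.+1 i t - Y k i t| <= Cst T / 2 ^+ k.
  by move=> T0; rewrite /Cst; case: pselect => // T0'; case: cid.
have exl (it : 'I_n * R) : exists l, geometric_limit (fun k => Y k it.1 it.2) l.
  case: it => i t; apply: (@exists_geometric_limit _ (Cst `|t|)) => k; apply: stepC => //.
  by rewrite -ler_norml.
have [y Hy] := choice exl.
pose z i t := y (i, t).
have zC T t : 0 <= T -> - T <= t <= T -> forall i k, `|Y k i t - z i t| <= 2 * Cst T / 2 ^+ k.
  by move=> T0 tT i; apply: (Hy (i, t)) => k; exact: stepC.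
have cz i : continuous (z i).
  move=> t; apply/cvgrPdist_lt => e e0; pose T := `|t| + 1.
  have T0 : 0 <= T by rewrite /T addr_ge0.
  have [k ke] : exists k, 2 * Cst T / 2 ^+ k < e / 3.
    apply: contrapT => /forallNP H; have := @le0_geometric (e / 3) (2 * Cst T).
    move=> /(_ _)/wrap[]; last by lra.
    by move=> k; rewrite leNgt; apply/negP.
  have tT : - T <= t <= T by rewrite -ler_norml /T; lra.
  near=> s.
  have sT : - T <= s <= T.
    rewrite -ler_norml /T; have -> : s = t - (t - s) by ring.
    apply: le_trans (ler_normB _ _) _; rewrite lerD2l; apply: ltW; near: s.
    exact: (nbhsx_ballx t 1 ltr01).
  have h1 := zC T t T0 tT i k; have h2 := zC T s T0 sT i k.
  have h3 : `|Y k i t - Y k i s| < e / 3.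
    by near: s; move: (@continuous_Y k i t) => /cvgrPdist_lt; apply; lra.
  by move: h1 h2 h3; rewrite !ler_norml !ltr_norml; lra.
have zE i t : z i t = y0 i + prim (rhs z i) t.
  apply/eqP; rewrite -subr_eq0 -normr_le0; pose T := `|t|.
  have T0 : 0 <= T by rewrite /T.
  have [L [L0 HL]] := rhs_bound T.
  apply: (@le0_geometric _ (2 * Cst T * (1 + L * T))) => k.
  have tT : - T <= t <= T by rewrite -ler_norml.
  have h1 := zC T t T0 tT i k.+1.
  have h2 : `|prim (rhs (Y k) i) t - prim (rhs z i) t| <= L * (2 * Cst T / 2 ^+ k) * T.
    rewrite -primB; try by apply: continuous_rhs => j //; exact: continuous_Y.
    have cd : continuous (fun s => rhs (Y k) i s - rhs z i s).
      by move=> s; apply: cvgB; apply: continuous_rhs => j //; exact: continuous_Y.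
    have bd s : - T <= s <= T -> `|rhs (Y k) i s - rhs z i s| <= L * (2 * Cst T / 2 ^+ k).
      move=> sT; rewrite (_ : _ - _ = rhs (fun j s => Y k j s - z j s) i s).
        by apply: HL => // j; exact: zC.
      by rewrite /rhs -sumrB; apply: eq_bigr => j _; rewrite mulrBr.
    set B := L * _ in bd *.
    have lin s : is_derive s (1 : R) (fun s => B * s) (B * 1) by apply: dScale.
    have [t0|t0] := leP 0 t.
      have := @ler_norm_increment R 0 t (prim (fun s => rhs (Y k) i s - rhs z i s)) _ _ _ t0
        (fun s _ => is_derive_prim s cd) (fun s _ => lin s) => /(_ _)/wrap[].
        move=> s /andP[s0 st]; rewrite mulr1; apply: bd; move: tT; lra.
      by rewrite prim0 subr0 mulr0 subr0 /T (ger0_norm t0).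
    have := @ler_norm_increment R t 0 (prim (fun s => rhs (Y k) i s - rhs z i s)) _ _ _ (ltW t0)
        (fun s _ => is_derive_prim s cd) (fun s _ => lin s) => /(_ _)/wrap[].
      move=> s /andP[s0 st]; rewrite mulr1; apply: bd; move: tT; lra.
    by rewrite prim0 sub0r mulr0 sub0r normrN /T (ltr0_norm t0) mulrN.
  have -> : z i t - (y0 i + prim (rhs z i) t) =
      (prim (rhs (Y k) i) t - prim (rhs z i) t) - (Y k.+1 i t - z i t) by rewrite /=; ring.
  apply: le_trans (ler_normB _ _) _; apply: le_trans (lerD h2 h1) _.
  rewrite mulrDr mulr1 mulrDl addrC; apply: lerD; last by apply: le_of_eq; ring.
  have C0 : 0 <= 2 * Cst T / 2 ^+ k by have := zC T t T0 tT i k; exact: le_trans.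
  have -> : 2 * Cst T / 2 ^+ k.+1 = (2 * Cst T / 2 ^+ k) / 2.
    by rewrite exprS; field; rewrite expf_neq0.
  by lra.
exists z; split=> i; first by rewrite zE prim0 addr0.
move=> t; rewrite (_ : z i = fun t => y0 i + prim (rhs z i) t); last exact/funext/zE.
apply: (@is_derive_eq' _ _ _ (0 + rhs z i t)); last by rewrite add0r.
apply: dAdd.
by apply: is_derive_prim; exact: continuous_rhs.
Unshelve. all: by end_near. Qed.
End LinearSystem.
End Picard.

(** * Solutions of the Sturm--Liouville equation *)
Section ComplexCalculus.
Variable R : realType.
Implicit Types (f g : R -> R[i]) (t : R) (z : R[i]).

Definition dC f t (d : R[i]) :=
  is_derive t 1 (fun s => complex.Re (f s)) (complex.Re d) /\
  is_derive t 1 (fun s => complex.Im (f s)) (complex.Im d).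

Lemma dC_eq f t d d' : dC f t d -> d = d' -> dC f t d'.
Proof. by move=> h <-. Qed.

Lemma dC_cst (c : R[i]) t : dC (fun=> c) t 0.
Proof. by split; exact: dCst. Qed.

Lemma dC_add f g t df dg : dC f t df -> dC g t dg -> dC (fun s => f s + g s) t (df + dg).
Proof.
move=> [f1 f2] [g1 g2]; split; rewrite ?raddfD /=.
  rewrite (_ : (fun s => _) = fun s => complex.Re (f s) + complex.Re (g s)); first exact: dAdd.
  by apply/funext => s; rewrite raddfD.
rewrite (_ : (fun s => _) = fun s => complex.Im (f s) + complex.Im (g s)); first exact: dAdd.
by apply/funext => s; rewrite raddfD.
Qed.

Lemma dC_opp f t df : dC f t df -> dC (fun s => - f s) t (- df).
Proof.
move=> [f1 f2]; split; rewrite raddfN /=.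
  rewrite (_ : (fun s => _) = fun s => - complex.Re (f s)); first exact: dOpp.
  by apply/funext => s; rewrite raddfN.
rewrite (_ : (fun s => _) = fun s => - complex.Im (f s)); first exact: dOpp.
by apply/funext => s; rewrite raddfN.
Qed.

Lemma dC_sub f g t df dg : dC f t df -> dC g t dg -> dC (fun s => f s - g s) t (df - dg).
Proof. by move=> hf hg; apply: dC_add => //; exact: dC_opp. Qed.

Lemma ReM (x y : R[i]) : complex.Re (x * y) = complex.Re x * complex.Re y - complex.Im x * complex.Im y.
Proof. by case: x y => [a b] [c d]. Qed.

Lemma ImM (x y : R[i]) : complex.Im (x * y) = complex.Re x * complex.Im y + complex.Im x * complex.Re y.
Proof. by case: x y => [a b] [c d]. Qed.

Lemma ReJ (x : R[i]) : complex.Re (x^*) = complex.Re x. Proof. by case: x. Qed.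
Lemma ImJ (x : R[i]) : complex.Im (x^*) = - complex.Im x. Proof. by case: x. Qed.
Lemma ReD (x y : R[i]) : complex.Re (x + y) = complex.Re x + complex.Re y.
Proof. exact: raddfD. Qed.
Lemma ImD (x y : R[i]) : complex.Im (x + y) = complex.Im x + complex.Im y.
Proof. exact: raddfD. Qed.
Lemma ReN (x : R[i]) : complex.Re (- x) = - complex.Re x. Proof. exact: raddfN. Qed.
Lemma ImN (x : R[i]) : complex.Im (- x) = - complex.Im x. Proof. exact: raddfN. Qed.

Definition ReIm := (ReM, ImM, ReJ, ImJ, ReD, ImD, ReN, ImN).

Lemma complexP (x y : R[i]) : complex.Re x = complex.Re y -> complex.Im x = complex.Im y -> x = y.
Proof. by case: x y => [a b] [c d] /= -> ->. Qed.

Lemma dC_mul f g t df dg : dC f t df -> dC g t dg ->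
  dC (fun s => f s * g s) t (df * g t + f t * dg).
Proof.
move=> [f1 f2] [g1 g2]; split; rewrite !ReIm.
  rewrite (_ : (fun s => _) = fun s => complex.Re (f s) * complex.Re (g s) - complex.Im (f s) * complex.Im (g s)).
    by apply: is_derive_eq' (dSub (dMul f1 g1) (dMul f2 g2)) _; ring.
  by apply/funext => s; rewrite ReM.
rewrite (_ : (fun s => _) = fun s => complex.Re (f s) * complex.Im (g s) + complex.Im (f s) * complex.Re (g s)).
  by apply: is_derive_eq' (dAdd (dMul f1 g2) (dMul f2 g1)) _; ring.
by apply/funext => s; rewrite ImM.
Qed.

Lemma dC_scale c f t df : dC f t df -> dC (fun s => c * f s) t (c * df).
Proof. by move=> hf; apply: dC_eq (dC_mul (dC_cst c t) hf) _; rewrite mul0r add0r. Qed.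

Lemma dC_conj f t df : dC f t df -> dC (fun s => (f s)^*) t (df^*).
Proof.
move=> [f1 f2]; split; rewrite ?ReIm.
  rewrite (_ : (fun s => _) = fun s => complex.Re (f s)) //.
  by apply/funext => s; rewrite ReJ.
rewrite (_ : (fun s => _) = fun s => - complex.Im (f s)); first exact: dOpp.
by apply/funext => s; rewrite ImJ.
Qed.

Lemma dC_real (u : R -> R) t (d : R) : is_derive t 1 u d -> dC (fun s => (u s)%:C) t d%:C.
Proof. by move=> hu; split => //=; exact: dCst. Qed.

Lemma dC_eq_cst f : (forall t, dC f t 0) -> forall t, f t = f 0.
Proof.
have aux (u : R -> R) : (forall t, is_derive t (1:R) u 0) -> forall t, u t = u 0.
  move=> du t; have inc a b : a <= b -> u b = u a.
    move=> ab; apply/eqP; rewrite -subr_eq0 -normr_le0.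
    have := @ler_norm_increment R a b u (fun=> 0) (fun=> 0) (fun=> 0) ab (fun t _ => du t)
      (fun t _ => dCst 0 t) => /(_ _)/wrap[].
      by move=> s _; rewrite normr0.
    by rewrite subrr.
  by have [t0|/ltW t0] := leP 0 t; [exact: inc|exact/esym/inc].
move=> df t; apply: complexP.
  by apply: (aux (fun s => complex.Re (f s))) => s; have [] := df s.
by apply: (aux (fun s => complex.Im (f s))) => s; have [] := df s.
Qed.

Variable p : R -> R.

(** The solution comes with its derivative, so that the first-order system is
    stated without iterated derivatives; for continuous p all solutions are of
    this classical kind. *)
Definition csol z (y y' : R -> R[i]) := forall t : R,
  dC y t (y' t) /\ dC y' t (((p t)%:C - z) * y t).

Definition rsol (lam : R) (u u' : R -> R) := forall t : R,
  is_derive t 1 u (u' t) /\ is_derive t 1 u' ((p t - lam) * u t).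

Lemma csol_lin z a b y1 y1' y2 y2' : csol z y1 y1' -> csol z y2 y2' ->
  csol z (fun t => a * y1 t + b * y2 t) (fun t => a * y1' t + b * y2' t).
Proof.
move=> h1 h2 t; have [d1 d1'] := h1 t; have [d2 d2'] := h2 t; split.
  by apply: dC_add; exact: dC_scale.
by apply: dC_eq (dC_add (dC_scale a d1') (dC_scale b d2')) _; ring.
Qed.

Lemma csol_rsol lam y y' : csol lam%:C y y' ->
  rsol lam (fun t => complex.Re (y t)) (fun t => complex.Re (y' t)).
Proof.
move=> h t; have [[d1 _] [d2 _]] := h t; split => //.
by apply: is_derive_eq' d2 _; rewrite !ReIm /= oppr0 addr0 mul0r subr0.
Qed.

Lemma rsol_csol lam u u' : rsol lam u u' ->
  csol lam%:C (fun t => (u t)%:C) (fun t => (u' t)%:C).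
Proof.
move=> h t; have [d1 d2] := h t; split; first exact: dC_real.
by apply: dC_eq (dC_real d2) _; apply: complexP; rewrite !ReIm /=; ring.
Qed.

Lemma rsol_lin lam a b u1 u1' u2 u2' : rsol lam u1 u1' -> rsol lam u2 u2' ->
  rsol lam (fun t => a * u1 t + b * u2 t) (fun t => a * u1' t + b * u2' t).
Proof.
move=> h1 h2 t; have [d1 d1'] := h1 t; have [d2 d2'] := h2 t; split.
  by apply: dAdd; exact: dScale.
by apply: is_derive_eq' (dAdd (dScale a d1') (dScale b d2')) _; ring.
Qed.

Lemma wronskian_cst z y1 y1' y2 y2' : csol z y1 y1' -> csol z y2 y2' ->
  forall t, y1 t * y2' t - y1' t * y2 t = y1 0 * y2' 0 - y1' 0 * y2 0.
Proof.
move=> h1 h2; apply: (@dC_eq_cst (fun t => y1 t * y2' t - y1' t * y2 t)) => t.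
have [d1 d1'] := h1 t; have [d2 d2'] := h2 t.
by apply: dC_eq (dC_sub (dC_mul d1 d2') (dC_mul d1' d2)) _; ring.
Qed.

Definition fundamental z s1 s1' s2 s2' := [/\ csol z s1 s1', csol z s2 s2' &
  forall t, s1 t * s2' t - s1' t * s2 t = 1].

Hypothesis cp : continuous p.

Lemma exists_csol z a b : exists y y', [/\ csol z y y', y 0 = a & y' 0 = b].
Proof.
(* the components are Re y, Im y, Re y', Im y' *)
pose A (i j : 'I_4) (t : R) : R :=
  match val i, val j with
  | 0, 2 => 1 | 1, 3 => 1
  | 2, 0 => p t - complex.Re z | 2, 1 => complex.Im z
  | 3, 0 => - complex.Im z | 3, 1 => p t - complex.Re z
  | _, _ => 0 end.
have cA i j : continuous (A i j).
  have c1 : continuous (fun t => p t - complex.Re z).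
    by move=> t; apply: cvgB; [exact: cp|exact: cst_continuous].
  rewrite /A; case: i j => [[|[|[|[|i]]]] Hi] [[|[|[|[|j]]]] Hj] //=;
    by [exact: cst_continuous | exact: c1].
pose y0 (i : 'I_4) : R := nth 0 [:: complex.Re a; complex.Im a; complex.Re b; complex.Im b] i.
have [y [y00 dy]] := exists_linear_system_solution y0 cA.
have A0 (i : 'I_4) t : \sum_j A i j t * y j t =
  A i (inord 0) t * y (inord 0) t + A i (inord 1) t * y (inord 1) t +
  A i (inord 2) t * y (inord 2) t + A i (inord 3) t * y (inord 3) t.
  rewrite !big_ord_recl big_ord0 addr0 !addrA.
  by do 3?congr (_ + _); congr (A i _ t * y _ t); apply/val_inj; rewrite /= inordK.
exists (fun t => y (inord 0) t +i* y (inord 1) t), (fun t => y (inord 2) t +i* y (inord 3) t).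
split.
- move=> t; have d i := dy i t; split; split => /=.
  + by apply: is_derive_eq' (d (inord 0)) _; rewrite A0 /A /= !inordK //=; ring.
  + by apply: is_derive_eq' (d (inord 1)) _; rewrite A0 /A /= !inordK //=; ring.
  + by apply: is_derive_eq' (d (inord 2)) _; rewrite A0 /A /= !inordK //= !ReIm /=; ring.
  + by apply: is_derive_eq' (d (inord 3)) _; rewrite A0 /A /= !inordK //= !ReIm /=; ring.
- by rewrite !y00 /y0 !inordK //=; exact: complexP.
- by rewrite !y00 /y0 !inordK //=; exact: complexP.
Qed.

Lemma exists_fundamental z : exists s1 s1' s2 s2', fundamental z s1 s1' s2 s2'.
Proof.
have [s1 [s1' [h1 a1 b1]]] := exists_csol z 1 0.
have [s2 [s2' [h2 a2 b2]]] := exists_csol z 0 1.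
exists s1, s1', s2, s2'; split => // t.
by rewrite (wronskian_cst h1 h2) a1 b1 a2 b2; ring.
Qed.

Lemma exists_real_fundamental (lam : R) : exists u1 u1' u2 u2', [/\ rsol lam u1 u1',
  rsol lam u2 u2' & forall t, u1 t * u2' t - u1' t * u2 t = 1].
Proof.
have [s1 [s1' [h1 a1 b1]]] := exists_csol lam%:C 1 0.
have [s2 [s2' [h2 a2 b2]]] := exists_csol lam%:C 0 1.
have r1 := csol_rsol h1; have r2 := csol_rsol h2.
do 4 eexists; split; [exact: r1|exact: r2|] => t.
have := wronskian_cst (rsol_csol r1) (rsol_csol r2) t.
rewrite a1 b1 a2 b2 /= => /(congr1 (@complex.Re R)).
by rewrite !ReIm /= => h; lra.
Qed.

End ComplexCalculus.

(** * The Hilbert space of square-integrable functions *)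
Section HilbertSpace.
Variable R : realType.
Notation mu := (@lebesgue_measure R).
Notation D := (half_line R).
Implicit Types (f g h u v : R -> R[i]) (c z : R[i]).

Lemma measurable_half_line : measurable (D : set (measurableTypeR R)).
Proof. exact: measurable_itv. Qed.
Hint Resolve measurable_half_line : core.

Lemma normc2 (x : R[i]) : normc x ^+ 2 = complex.Re x ^+ 2 + complex.Im x ^+ 2.
Proof. by case: x => a b /=; rewrite sqr_sqrtr // addr_ge0 // sqr_ge0. Qed.

Lemma normc2_ge0 (x : R[i]) : 0 <= normc x ^+ 2.
Proof. by rewrite normc2 addr_ge0 // sqr_ge0. Qed.

Lemma normc_ge0 (x : R[i]) : 0 <= normc x.
Proof. by case: x => a b /=; exact: sqrtr_ge0. Qed.

Lemma complex_measurableM f g : complex_measurable f -> complex_measurable g ->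
  complex_measurable (fun t => f t * g t).
Proof.
move=> [f1 f2] [g1 g2]; split.
  under eq_fun do rewrite ReM.
  by apply: measurable_funB; exact: measurable_funM.
under eq_fun do rewrite ImM.
by apply: measurable_funD; exact: measurable_funM.
Qed.

Lemma complex_measurableD f g : complex_measurable f -> complex_measurable g ->
  complex_measurable (fun t => f t + g t).
Proof.
move=> [f1 f2] [g1 g2]; split.
  by under eq_fun do rewrite ReD; exact: measurable_funD.
by under eq_fun do rewrite ImD; exact: measurable_funD.
Qed.

Lemma complex_measurable_cst c : complex_measurable (fun _ : R => c).
Proof. by split; exact: measurable_cst. Qed.

Lemma complex_measurable_conj f : complex_measurable f -> complex_measurable (fun t => (f t)^*).
Proof.
move=> [f1 f2]; split; first by under eq_fun do rewrite ReJ.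
by under eq_fun do rewrite ImJ; apply: measurable_funN.
Qed.

Lemma L2_integrable f : L2 f ->
  mu.-integrable D (fun t => (normc (f t) ^+ 2)%:E).
Proof.
move=> [[m1 m2] fin]; apply/integrableP; split.
  apply/measurable_EFinP; under eq_fun do rewrite normc2.
  by apply: measurable_funD; apply: measurable_funX.
move: fin; congr (_ < _)%E; apply: eq_integral => t _ /=.
by rewrite ger0_norm // normc2_ge0.
Qed.

Lemma integrable_L2 f : complex_measurable f ->
  mu.-integrable D (fun t => (normc (f t) ^+ 2)%:E) -> L2 f.
Proof.
move=> mf /integrableP[_ fin]; split => //.
move: fin; congr (_ < _)%E; apply: eq_integral => t _ /=.
by rewrite ger0_norm // normc2_ge0.
Qed.

Lemma normcM2 (x y : R[i]) : normc (x * y) ^+ 2 = normc x ^+ 2 * normc y ^+ 2.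
Proof. by rewrite !normc2 !ReIm; ring. Qed.

Lemma normcD2 (x y : R[i]) : normc (x + y) ^+ 2 <= 2 * normc x ^+ 2 + 2 * normc y ^+ 2.
Proof.
rewrite !normc2 !ReIm; have := sqr_ge0 (complex.Re x - complex.Re y).
by have := sqr_ge0 (complex.Im x - complex.Im y); lra.
Qed.

Lemma integrable_le (k1 k2 : R -> R) : measurable_fun D k1 ->
  mu.-integrable D (EFin \o k2) -> (forall t, `|k1 t| <= k2 t) ->
  mu.-integrable D (EFin \o k1).
Proof.
move=> m1 i2 le; apply: le_integrable i2 => //; first exact/measurable_EFinP.
by move=> t _ /=; rewrite lee_fin (le_trans (le t)) // ler_norm.
Qed.

Lemma L2_lin c f g : L2 f -> L2 g -> L2 (fun t => c * f t + g t).
Proof.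
move=> Lf Lg; apply: integrable_L2.
  apply: complex_measurableD; last by case: Lg.
  by apply: complex_measurableM; [exact: complex_measurable_cst|case: Lf].
have i1 := integrableZl measurable_half_line (2 * normc c ^+ 2) (L2_integrable Lf).
have i2 := integrableZl measurable_half_line 2 (L2_integrable Lg).
have i3 := integrableD measurable_half_line i1 i2.
apply: (integrable_le _ i3).
  have [[]] : L2 f by []; have [[]] : L2 g by [].
  move=> m1 m2 _ m3 m4 _; under eq_fun do rewrite normc2 !ReIm.
  apply: measurable_funD; apply: measurable_funX; apply: measurable_funD => //.
    by apply: measurable_funB; apply: measurable_funM => //; exact: measurable_cst.
  by apply: measurable_funD; apply: measurable_funM => //; exact: measurable_cst.
move=> t; rewrite ger0_norm ?normc2_ge0 // -mulrA -normcM2; exact: normcD2.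
Qed.

Lemma L20 : L2 (fun _ : R => 0 : R[i]).
Proof.
split; first exact: complex_measurable_cst.
by under eq_integral do rewrite normc2 /= expr0n /= addr0; rewrite integral0 ltry.
Qed.

Lemma L2Z c f : L2 f -> L2 (c \*o f).
Proof.
move=> Lf; rewrite (_ : c \*o f = fun t => c * f t + 0); first exact: L2_lin L20.
by apply/funext => t; rewrite addr0.
Qed.

Lemma L2B f g : L2 f -> L2 g -> L2 (f \- g).
Proof.
move=> Lf Lg; rewrite (_ : f \- g = fun t => -1 * g t + f t); first exact: L2_lin.
by apply/funext => t; rewrite mulN1r addrC.
Qed.

Lemma inner_integrable f g : L2 f -> L2 g ->
  mu.-integrable D (fun t => (complex.Re (f t * (g t)^*))%:E) /\
  mu.-integrable D (fun t => (complex.Im (f t * (g t)^*))%:E).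
Proof.
move=> Lf Lg; have i3 := integrableD measurable_half_line (L2_integrable Lf) (L2_integrable Lg).
have [m1 m2] : complex_measurable (fun t => f t * (g t)^*).
  by apply: complex_measurableM; [case: Lf|apply: complex_measurable_conj; case: Lg].
have amgm (a b c d : R) : `|a * b + c * d| <= a ^+ 2 + c ^+ 2 + (b ^+ 2 + d ^+ 2).
  have := sqr_ge0 (a - b); have := sqr_ge0 (a + b); have := sqr_ge0 (c - d).
  by have := sqr_ge0 (c + d); rewrite ler_norml; lra.
split; apply: (integrable_le _ i3) => // t; rewrite !normc2 !ReIm.
  by rewrite mulrN opprK; exact: amgm.
rewrite mulrN addrC [X in _ <= _ + X]addrC -mulrN; apply: le_trans (amgm _ _ _ _) _.
by rewrite sqrrN; lra.
Qed.

Lemma innerL2_lin c f1 f2 g : L2 f1 -> L2 f2 -> L2 g ->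
  innerL2 (fun t => c * f1 t + f2 t) g = c * innerL2 f1 g + innerL2 f2 g.
Proof.
move=> L1 L2' Lg; have [r1 i1] := inner_integrable L1 Lg; have [r2 i2] := inner_integrable L2' Lg.
have Zr (k : R) (w : R -> R) : mu.-integrable D (EFin \o w) -> mu.-integrable D (EFin \o (fun t => k * w t)).
  by move=> iw; apply: (integrableZl measurable_half_line k iw).
have iB (w1 w2 : R -> R) : mu.-integrable D (EFin \o w1) -> mu.-integrable D (EFin \o w2) ->
    mu.-integrable D (EFin \o (fun t => w1 t - w2 t)).
  by move=> i3 i4; exact: (integrableB measurable_half_line i3 i4).
have iD (w1 w2 : R -> R) : mu.-integrable D (EFin \o w1) -> mu.-integrable D (EFin \o w2) ->
    mu.-integrable D (EFin \o (fun t => w1 t + w2 t)).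
  by move=> i3 i4; exact: (integrableD measurable_half_line i3 i4).
apply: complexP; rewrite !ReIm /=.
  rewrite -!RintegralZl // -RintegralB //; try exact: Zr.
  rewrite -RintegralD //; last by apply: iB; exact: Zr.
  by apply: eq_Rintegral => t _; rewrite !ReIm; ring.
rewrite -!RintegralZl // -RintegralD //; try exact: Zr.
rewrite -RintegralD //; last by apply: iD; exact: Zr.
by apply: eq_Rintegral => t _; rewrite !ReIm; ring.
Qed.

Lemma innerL2_conj f g : L2 f -> L2 g -> innerL2 g f = (innerL2 f g)^*.
Proof.
move=> Lf Lg; have [r i] := inner_integrable Lf Lg; apply: complexP; rewrite !ReIm /=.
  by apply: eq_Rintegral => t _; rewrite !ReIm; ring.
rewrite -mulN1r -RintegralZl //; apply: eq_Rintegral => t _; rewrite !ReIm; ring.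
Qed.

Lemma innerL2_self f : innerL2 f f = (normL2 f ^+ 2)%:C.
Proof.
apply: complexP => /=.
  rewrite /normL2 sqr_sqrtr; last by apply: Rintegral_ge0 => t _; exact: normc2_ge0.
  by apply: eq_Rintegral => t _; rewrite normc2 !ReIm; ring.
rewrite (@eq_Rintegral _ _ _ mu D (fun=> 0)); first by rewrite Rintegral_cst // mul0r.
by move=> t _; rewrite !ReIm; ring.
Qed.

Lemma normL2_ge0 f : 0 <= normL2 f.
Proof. exact: sqrtr_ge0. Qed.

Lemma innerL20l g : innerL2 (fun=> 0) g = 0.
Proof.
apply: complexP => /=; rewrite (@eq_Rintegral _ _ _ mu D (fun=> 0)) ?Rintegral_cst // ?mul0r //;
  by move=> t _; rewrite mul0r.
Qed.

(** The expansion of the square of a norm is the only identity that the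
    inequalities below and the spectral estimates need. *)
Lemma normL2_sqr_lin c f g : L2 f -> L2 g ->
  normL2 (fun t => c * f t + g t) ^+ 2 =
  normc c ^+ 2 * normL2 f ^+ 2 + 2 * complex.Re (c * innerL2 f g) + normL2 g ^+ 2.
Proof.
move=> Lf Lg; have Ll := L2_lin c Lf Lg.
have : innerL2 (fun t => c * f t + g t) (fun t => c * f t + g t) =
   c * (c^* * innerL2 f f + innerL2 f g) + (c^* * (innerL2 f g)^* + innerL2 g g).
  rewrite innerL2_lin // (innerL2_conj Ll Lf) innerL2_lin //.
  rewrite (innerL2_conj Ll Lg) innerL2_lin // (innerL2_conj Lf Lg).
  rewrite !innerL2_self; congr (_ * _ + _); apply: complexP; rewrite !ReIm /=; ring.
rewrite !innerL2_self => /(congr1 (@complex.Re R)); rewrite !ReIm /= normc2 => ->.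
ring.
Qed.

Lemma cauchy_schwarz f g : L2 f -> L2 g -> normc (innerL2 f g) <= normL2 f * normL2 g.
Proof.
move=> Lf Lg; set w := innerL2 f g.
suff : normc w ^+ 2 <= (normL2 f * normL2 g) ^+ 2.
  by rewrite ler_sqr ?nnegrE ?mulr_ge0 ?normL2_ge0 ?normc_ge0.
(* the norm of g - s w^* f, for all real s, at w = <f, g> *)
have quad (s : R) : 0 <= s ^+ 2 * normc w ^+ 2 * normL2 f ^+ 2 - 2 * s * normc w ^+ 2 + normL2 g ^+ 2.
  have := sqr_ge0 (normL2 (fun t => (- s%:C * w^*) * f t + g t)).
  rewrite normL2_sqr_lin // -/w !normc2 !ReIm /= => H; apply: le_trans H _.
  by apply: le_of_eq; ring.
set n := normc w ^+ 2 in quad *; have n0 : 0 <= n by exact: normc2_ge0.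
set F := normL2 f in quad *; set G := normL2 g in quad *.
have [F0|F0] := eqVneq F 0.
  have [nz|nz] := eqVneq n 0; first by rewrite nz sqr_ge0.
  have n1 : 0 < n by rewrite lt_neqAle eq_sym nz.
  have := quad ((G ^+ 2 + 1) / n); rewrite F0 expr0n /= mulr0 add0r.
  have -> : 2 * ((G ^+ 2 + 1) / n) * n = 2 * (G ^+ 2 + 1) by field.
  by have := sqr_ge0 G; lra.
have F2 : 0 < F ^+ 2 by rewrite exprn_gt0 // lt_neqAle eq_sym F0 normL2_ge0.
have := quad ((F ^+ 2)^-1).
have -> : (F ^+ 2)^-1 ^+ 2 * n * F ^+ 2 - 2 * (F ^+ 2)^-1 * n + G ^+ 2 = (F ^+ 2 * G ^+ 2 - n) / F ^+ 2.
  by field.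
by rewrite pmulr_lge0 ?invr_gt0 // subr_ge0 exprMn.
Qed.

Lemma normL2_triangle f g : L2 f -> L2 g -> normL2 (f \+ g) <= normL2 f + normL2 g.
Proof.
move=> Lf Lg; rewrite -ler_sqr ?nnegrE ?addr_ge0 ?normL2_ge0 //.
have -> : f \+ g = fun t => 1 * f t + g t by apply/funext => t; rewrite mul1r.
have n1 : normc (1 : R[i]) ^+ 2 = 1 by rewrite normc2 /= expr1n expr0n /= addr0.
rewrite normL2_sqr_lin // n1 !mul1r.
have : complex.Re (innerL2 f g) <= normc (innerL2 f g).
  rewrite (le_trans (ler_norm _)) // -ler_sqr ?nnegrE ?normc_ge0 // real_normK ?num_real //.
  by rewrite normc2 lerDl sqr_ge0.
have := cauchy_schwarz Lf Lg; rewrite sqrrD -mulr_natl; lra.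
Qed.

Lemma normL2Z c f : L2 f -> normL2 (c \*o f) = normc c * normL2 f.
Proof.
move=> Lf; apply/eqP; rewrite -(@eqrXn2 _ 2) ?mulr_ge0 ?normL2_ge0 ?normc_ge0 //.
have -> : c \*o f = fun t => c * f t + (fun=> 0) t by apply/funext => t; rewrite addr0.
rewrite normL2_sqr_lin //; last exact: L20.
rewrite (innerL2_conj L20 Lf) innerL20l rmorph0 mulr0 /= mulr0 addr0.
have : innerL2 (fun=> 0 : R[i]) (fun=> 0) = 0 by exact: innerL20l.
rewrite innerL2_self => /(congr1 (@complex.Re R)) /= ->; rewrite addr0.
by rewrite exprMn.
Qed.

Lemma eqL2_refl f : eqL2 f f.
Proof. exact: ae_eq_refl. Qed.

Lemma eqL2_trans f g h : eqL2 f g -> eqL2 g h -> eqL2 f h.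
Proof. exact: ae_eq_trans. Qed.

Lemma eqL2_comp2 (op : R[i] -> R[i] -> R[i]) f f' g g' : eqL2 f f' -> eqL2 g g' ->
  eqL2 (fun t => op (f t) (g t)) (fun t => op (f' t) (g' t)).
Proof.
move=> H1 H2; have F : Filter (almost_everywhere mu) by exact: ae_filter_ringOfSetsType.
by apply: filterS2 H1 H2 => t h1 h2 Dt; rewrite h1 // h2.
Qed.

Lemma eqL2_Rintegral (op : R[i] -> R) f g : eqL2 f g ->
  measurable_fun D (fun t => op (f t)) -> measurable_fun D (fun t => op (g t)) ->
  Rintegral mu D (fun t => op (f t)) = Rintegral mu D (fun t => op (g t)).
Proof.
move=> H m1 m2; congr fine; apply: ae_eq_integral => //; try exact/measurable_EFinP.
have F : Filter (almost_everywhere mu) by exact: ae_filter_ringOfSetsType.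
by apply: filterS H => t h Dt; rewrite h.
Qed.

Lemma eqL2_inner f f' g g' : L2 f -> L2 f' -> L2 g -> L2 g' -> eqL2 f f' -> eqL2 g g' ->
  innerL2 f g = innerL2 f' g'.
Proof.
move=> [mf _] [mf' _] [mg _] [mg' _] ef eg.
have E := eqL2_comp2 (fun x y => x * y^*) ef eg.
have [m1 m2] : complex_measurable (fun t => f t * (g t)^*).
  by apply: complex_measurableM => //; exact: complex_measurable_conj.
have [m3 m4] : complex_measurable (fun t => f' t * (g' t)^*).
  by apply: complex_measurableM => //; exact: complex_measurable_conj.
apply: complexP => /=.
  exact: (eqL2_Rintegral (op := @complex.Re R) E).
exact: (eqL2_Rintegral (op := @complex.Im R) E).
Qed.

Lemma eqL2_norm f f' : L2 f -> L2 f' -> eqL2 f f' -> normL2 f = normL2 f'.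
Proof.
move=> Lf Lf' e; have := eqL2_inner Lf Lf' Lf Lf' e e; rewrite !innerL2_self.
move=> /(congr1 (@complex.Re R)) /= /eqP; rewrite eqrXn2 ?normL2_ge0 // => /eqP.
exact.
Qed.

Lemma normL2_eq0 f : L2 f -> normL2 f = 0 -> eqL2 f (fun=> 0).
Proof.
move=> Lf n0; have i := L2_integrable Lf.
have fin : (\int[mu]_(t in D) (normc (f t) ^+ 2)%:E)%E \is a fin_num by exact: integrable_fin_num.
have I0 : (\int[mu]_(t in D) `|(normc (f t) ^+ 2)%:E| = 0)%E.
  under eq_integral do rewrite gee0_abs ?lee_fin ?normc2_ge0 //.
  rewrite -(fineK fin); congr EFin; apply/eqP; rewrite eq_le.
  move/eqP: n0; rewrite /normL2 sqrtr_eq0 => -> /=.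
  by apply: fine_ge0; apply: integral_ge0 => t _; rewrite lee_fin normc2_ge0.
have mf : measurable_fun D (fun t => (normc (f t) ^+ 2)%:E) by exact: measurable_int i.
have F : Filter (almost_everywhere mu) by exact: ae_filter_ringOfSetsType.
move: I0 => /(ae_eq_integral_abs mu measurable_half_line mf); apply: filterS => t h Dt.
have := h Dt => /= -[]; rewrite normc2 => /eqP.
rewrite paddr_eq0 ?sqr_ge0 // !sqrf_eq0 => /andP[/eqP h1 /eqP h2].
exact: complexP.
Qed.

End HilbertSpace.

(** * Calculus of absolutely continuous functions *)
Section AbsolutelyContinuousCalculus.
Variable R : realType.
Notation mu := (@lebesgue_measure R).
Implicit Types (a b t : R) (f g k : R -> R).

Lemma real_ac_bounded a b f : real_ac a b f ->
  exists M, 0 <= M /\ forall t, a <= t <= b -> `|f t| <= M.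
Proof.
move=> acf; have [ab|ba] := leP a b; last first.
  by exists 0; split => // t /andP[h1 h2]; have := lt_le_trans ba (le_trans h1 h2); rewrite ltxx.
have fin := (bounded_variationP f ab).1 (real_ac_bounded_variation ab acf).
have V0 : 0 <= fine (total_variation a b f) by rewrite fine_ge0 // total_variation_ge0.
exists (`|f a| + fine (total_variation a b f)); split; first by rewrite addr_ge0.
move=> t /andP[at_ tb].
have h : `|f t - f a| <= fine (total_variation a b f).
  rewrite -lee_fin fineK // (total_variationD f at_ tb); apply: le_trans (total_variation_ge f at_) _.
  by rewrite leeDl // total_variation_ge0.
have -> : f t = f a + (f t - f a) by ring.
by apply: le_trans (ler_normD _ _) _; rewrite lerD2l.
Qed.

(** Every closure property of absolute continuity is an instance of this
    comparison of increments. *)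
Lemma real_ac_le2 a b f g h (A B : R) : 0 <= A -> 0 <= B ->
  (forall x y, a <= x -> x <= y -> y <= b ->
     `|h y - h x| <= A * `|f y - f x| + B * `|g y - g x|) ->
  real_ac a b f -> real_ac a b g -> real_ac a b h.
Proof.
move=> A0 B0 le acf acg e e0; set K := A + B + 1.
have K0 : 0 < K by rewrite /K; lra.
have [d1 [d10 K1]] := acf _ (divr_gt0 e0 K0); have [d2 [d20 K2]] := acg _ (divr_gt0 e0 K0).
exists (Num.min d1 d2); split; first by rewrite lt_min d10.
move=> n x y xy dis; rewrite lt_min => /andP[s1 s2].
have l1 := ltW (K1 n x y xy dis s1); have l2 := ltW (K2 n x y xy dis s2).
apply: (@le_lt_trans _ _ (\sum_(i < n) (A * `|f (y i) - f (x i)| + B * `|g (y i) - g (x i)|))).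
  by apply: ler_sum => i _; have [h1 [h2 h3]] := xy i; exact: le.
rewrite big_split /= -!mulr_sumr.
apply: le_lt_trans (lerD (ler_wpM2l A0 l1) (ler_wpM2l B0 l2)) _.
rewrite -mulrDl mulrA ltr_pdivrMr // mulrC ltr_pM2l // /K; lra.
Qed.

Lemma real_acD a b f g : real_ac a b f -> real_ac a b g -> real_ac a b (fun t => f t + g t).
Proof.
apply: (@real_ac_le2 a b f g _ 1 1) => // x y _ _ _; rewrite !mul1r opprD addrACA.
exact: ler_normD.
Qed.

Lemma real_acN a b f : real_ac a b f -> real_ac a b (fun t => - f t).
Proof.
move=> acf; apply: (@real_ac_le2 a b f f _ 1 0) => // x y _ _ _.
by rewrite mul1r mul0r addr0 -opprD normrN.
Qed.

Lemma real_acB a b f g : real_ac a b f -> real_ac a b g -> real_ac a b (fun t => f t - g t).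
Proof. by move=> acf acg; apply: real_acD => //; exact: real_acN. Qed.

Lemma real_acM a b f g : real_ac a b f -> real_ac a b g -> real_ac a b (fun t => f t * g t).
Proof.
move=> acf acg; have [A [A0 HA]] := real_ac_bounded acf; have [B [B0 HB]] := real_ac_bounded acg.
apply: (@real_ac_le2 a b f g _ B A) => // x y ax xy yb.
have -> : f y * g y - f x * g x = (f y - f x) * g y + f x * (g y - g x) by ring.
apply: le_trans (ler_normD _ _) _; rewrite !normrM; apply: lerD.
  by rewrite mulrC ler_wpM2r // HB // yb (le_trans ax xy).
by rewrite ler_wpM2r // HA // ax (le_trans xy yb).
Qed.

Lemma C1_real_ac a b f (f' : R -> R) : (forall t : R, is_derive t 1 f (f' t)) -> continuous f' ->
  real_ac a b f.
Proof.
move=> df cf'; have [K [K0 HK]] := continuous_bounded a b cf'.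
have acid : real_ac a b idfun.
  move=> e e0; exists e; split => // n x y xy _; apply: le_lt_trans; apply: ler_sum => i _ /=.
  by have [_ [h _]] := xy i; rewrite ger0_norm // subr_ge0.
apply: (@real_ac_le2 a b idfun idfun _ K 0) => // x y ax xy yb.
rewrite mul0r addr0 /= (ger0_norm (x := y - x)) ?subr_ge0 // mulrBr.
apply: (@ler_norm_increment R x y f (fun t => K * t) f' (fun=> K * 1)) => // t /andP[xt ty].
by rewrite mulr1 HK // (le_trans ax xt) (le_trans ty yb).
Qed.

(** The integral of |k| over a union of small total length is small. *)
Lemma integral_real_ac a b k : mu.-integrable setT (EFin \o k) ->
  real_ac a b (fun t => \int[mu]_(s in `[a, t]) k s).
Proof.
move=> ik e e0; have [d [d0 Hd]] := integral_normr_continuous ik e0.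
exists d; split => // n x y xy dis sd.
have ik' A : measurable A -> mu.-integrable A (EFin \o k) by move=> mA; exact: integrableS ik.
have mk : measurable_fun setT k by apply/measurable_EFinP; exact: measurable_int ik.
pose F i : set (measurableTypeR R) := `](x i), (y i)]%classic.
have mF i : measurable (F i) by exact: measurable_itv.
have inc i : `|\int[mu]_(s in `[a, y i]) k s - \int[mu]_(s in `[a, x i]) k s| <= \int[mu]_(s in F i) `|k s|.
  have [h1 [h2 h3]] := xy i; rewrite Rintegral_itvB ?bnd_simp //; last exact: ik'.
  by apply: le_normr_Rintegral => //; exact: ik'.
have tF : trivIset setT F.
  apply/trivIsetP => i j _ _ ij; apply/seteqP; split => // s []; rewrite /F /= !in_itv /= => /andP[h1 h2] /andP[h3 h4].
  have [h|h] := dis i j ij.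
    by have := lt_le_trans h3 (le_trans h2 h); rewrite ltxx.
  by have := lt_le_trans h1 (le_trans h4 h); rewrite ltxx.
have muF i : mu (F i) = (y i - x i)%:E.
  have [h1 [h2 h3]] := xy i; rewrite /F lebesgue_measure_itv /= lte_fin; case: ltP => // yx.
  by congr EFin; move: h2 yx; lra.
have mU : measurable (\big[setU/set0]_(i < n) F i) by apply: bigsetU_measurable => i _.
have UE : (\int[mu]_(s in \big[setU/set0]_(i < n) F i) `|k s|%:E =
   \sum_(i < n) \int[mu]_(s in F i) `|k s|%:E)%E.
  rewrite ge0_integral_bigsetU //.
  - exact: index_enum_uniq.
  - by apply: sub_trivIset tF.
  - by apply: measurable_funTS; apply/measurable_EFinP/measurableT_comp.
have muU : (mu (\big[setU/set0]_(i < n) F i) < d%:E)%E.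
  rewrite measure_bigsetU_ord // (eq_bigr (fun i => (y i - x i)%:E)) => [|i _]; last exact: muF.
  by rewrite sumEFin lte_fin.
apply: le_lt_trans (Hd _ mU muU).
apply: (@le_trans _ _ (\sum_(i < n) \int[mu]_(s in F i) `|k s|)).
  by apply: ler_sum => i _; exact: inc.
rewrite [leRHS]/Rintegral UE.
have -> : (\sum_(i < n) \int[mu]_(s in F i) `|k s|%:E = \sum_(i < n) (\int[mu]_(s in F i) `|k s|)%R%:E)%E.
  apply: eq_bigr => i _; rewrite fineK //; apply: integrable_fin_num => //.
  by apply: (integrable_abse (ik' (F i) (mF i))).
by rewrite sumEFin.
Qed.

End AbsolutelyContinuousCalculus.

(** * Integration by parts *)
Section GreenIdentity.
Variable R : realType.
Notation mu := (@lebesgue_measure R).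
Notation D := (half_line R).
Implicit Types (a b t : R) (f g : R -> R[i]).

Let ae_filter_mu : Filter (almost_everywhere mu).
Proof. exact: ae_filter_ringOfSetsType. Qed.
Existing Instance ae_filter_mu.

Lemma real_ac_ftc a b (f g : R -> R) : a < b -> real_ac a b f ->
  mu.-integrable `[a, b] (EFin \o g) ->
  {ae mu, forall t, a < t < b -> is_derive t 1 f (g t)} ->
  forall x, a <= x <= b -> f x - f a = \int[mu]_(t in `[a, x]) g t.
Proof.
move=> ab acf ig dg x /andP[ax xb]; have [h [ih fh dh]] := ac_derive1 ab acf.
rewrite fh ?ax //; congr fine.
have iS k : mu.-integrable `[a, b] (EFin \o k) -> measurable_fun `]a, x[ (EFin \o k).
  move=> ik; apply: (measurable_int mu); apply: integrableS ik => //.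
  by move=> s /=; rewrite !in_itv /= => /andP[/ltW -> /ltW/le_trans ->].
have ihab : mu.-integrable `[a, b] (EFin \o h) by exact: integrableS ih.
have E k : mu.-integrable `[a, b] (EFin \o k) ->
    (\int[mu]_(t in `[a, x]) (k t)%:E = \int[mu]_(t in `]a, x[) (k t)%:E)%E.
  move=> ik; rewrite integral_itv_bndoo //.
  by have := iS _ ik.
rewrite !E //; apply: ae_eq_integral => //; try exact: iS.
apply: filterS2 dg dh => t h1 h2 /=; rewrite in_itv /= => /andP[at_ tx].
have tab : a < t < b by rewrite at_ (lt_le_trans tx xb).
have [_ <-] := h2 tab; have [_ <-] := h1 tab; by rewrite derive1E.
Qed.

(** An absolutely continuous function whose almost everywhere derivative has a
    continuous version is continuously differentiable; this turns the weak
    derivatives of the variation of constants into classical ones. *)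
Lemma real_ac_C1 m (f g : R -> R) : (forall a b, real_ac a b f) -> continuous g ->
  {ae mu, forall t, m < t -> is_derive t 1 f (g t)} ->
  forall t : R, m < t -> is_derive t 1 f (g t).
Proof.
move=> acf cg dg t mt; pose a := (m + t) / 2; pose b := t + 1.
have ab : a < b by rewrite /a /b; lra.
have H := @real_ac_ftc a b f g ab (acf a b) (continuous_integrable a b cg).
have {}H x : a <= x <= b -> f x = f a - prim g a + prim g x.
  move=> xab; have dg' : {ae mu, forall t, a < t < b -> is_derive t 1 f (g t)}.
    by apply: filterS dg => s ds /andP[as_ _]; apply: ds; apply: lt_trans as_; rewrite /a; lra.
  have := H dg' x xab; rewrite -primE //; last by case/andP: xab.
  by move=> h; rewrite -[f x](subrK (f a)) h; ring.
have tab : t \in `]a, b[ by rewrite in_itv /= /a /b; lra.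
apply: (@near_eq_is_derive _ _ _ (fun x => f a - prim g a + prim g x)).
  apply: filterS (near_in_itvoo tab) => s; rewrite in_itv /= => /andP[as_ sb].
  by rewrite -H // !ltW.
apply: is_derive_eq' (dAdd (dCst (f a - prim g a) t) (is_derive_prim t cg)) _.
by rewrite add0r.
Qed.

Lemma real_ac_continuous (f : R -> R) : (forall a b, real_ac a b f) -> continuous f.
Proof.
move=> acf t; apply/cvgrPdist_lt => e e0; have [d [d0 H]] := acf (t - 1) (t + 1) e e0.
near=> s; have st : `|t - s| < Num.min d 1.
  by near: s; apply: (nbhsx_ballx t (Num.min d 1)); rewrite lt_min d0 ltr01.
move: st; rewrite lt_min => /andP[sd s1].
have [st|/ltW ts] := leP s t.
  have := H 1%N (fun=> s) (fun=> t); rewrite !big_ord1; apply.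
  - by move=> _; move: s1; rewrite ger0_norm; lra.
  - by move=> i j; rewrite !ord1.
  - by move: sd; rewrite ger0_norm //; lra.
have := H 1%N (fun=> t) (fun=> s); rewrite !big_ord1 distrC; apply.
- by move=> _; move: s1; rewrite ler0_norm; lra.
- by move=> i j; rewrite !ord1.
- by move: sd; rewrite ler0_norm; lra.
Unshelve. all: by end_near. Qed.

Lemma real_ac_ext a b (f g : R -> R) : (forall t, a <= t <= b -> f t = g t) ->
  real_ac a b f -> real_ac a b g.
Proof.
move=> fg acf; apply: (@real_ac_le2 _ a b f f g 1 0) => // x y ax xy yb.
by rewrite mul1r mul0r addr0 !fg ?ax ?yb ?(le_trans ax xy) ?(le_trans xy yb).
Qed.

Definition cac a b f := real_ac a b (fun t => complex.Re (f t)) /\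
  real_ac a b (fun t => complex.Im (f t)).

Lemma Re_le_normc (x : R[i]) : `|complex.Re x| <= normc x.
Proof.
rewrite -ler_sqr ?nnegrE ?normc_ge0 // real_normK ?num_real // normc2 lerDl.
exact: sqr_ge0.
Qed.

Lemma Im_le_normc (x : R[i]) : `|complex.Im x| <= normc x.
Proof.
rewrite -ler_sqr ?nnegrE ?normc_ge0 // real_normK ?num_real // normc2 lerDr.
exact: sqr_ge0.
Qed.

Lemma normc_le_ReIm (x : R[i]) : normc x <= `|complex.Re x| + `|complex.Im x|.
Proof.
rewrite -ler_sqr ?nnegrE ?normc_ge0 ?addr_ge0 // normc2 sqrrD !real_normK ?num_real //.
by rewrite -addrA lerD2l lerDr mulrn_wge0 // mulr_ge0.
Qed.

Lemma abs_continuous_cac a b f : abs_continuous a b f <-> cac a b f.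
Proof.
split=> [acf|[ac1 ac2] e e0].
  split=> e e0; have [d [d0 H]] := acf e e0; exists d; split => // n x y xy dis s;
    apply: le_lt_trans (H n x y xy dis s); apply: ler_sum => i _.
    by rewrite -ReN -ReD; exact: Re_le_normc.
  by rewrite -ImN -ImD; exact: Im_le_normc.
have e20 : 0 < e / 2 by lra.
have [d1 [d10 H1]] := ac1 _ e20; have [d2 [d20 H2]] := ac2 _ e20.
exists (Num.min d1 d2); split; first by rewrite lt_min d10.
move=> n x y xy dis; rewrite lt_min => /andP[s1 s2].
have := ltrD (H1 n x y xy dis s1) (H2 n x y xy dis s2).
rewrite -splitr -big_split /=; apply: le_lt_trans; apply: ler_sum => i _.
by rewrite -!ReN -!ReD -!ImN -!ImD; exact: normc_le_ReIm.
Qed.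

Lemma cac_mul a b f g : cac a b f -> cac a b g -> cac a b (fun t => f t * g t).
Proof.
move=> [f1 f2] [g1 g2]; split; rewrite /=.
  by under eq_fun do rewrite ReM; exact: (real_acB (real_acM f1 g1) (real_acM f2 g2)).
by under eq_fun do rewrite ImM; exact: (real_acD (real_acM f1 g2) (real_acM f2 g1)).
Qed.

Lemma cac_sub a b f g : cac a b f -> cac a b g -> cac a b (fun t => f t - g t).
Proof.
move=> [f1 f2] [g1 g2]; split; rewrite /=.
  by under eq_fun do rewrite ReD ReN; exact: (real_acB f1 g1).
by under eq_fun do rewrite ImD ImN; exact: (real_acB f2 g2).
Qed.

Lemma cac_conj a b f : cac a b f -> cac a b (fun t => (f t)^*).
Proof.
move=> [f1 f2]; split; rewrite /=.
  by under eq_fun do rewrite ReJ.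
by under eq_fun do rewrite ImJ; exact: (real_acN f2).
Qed.

Definition ccont f := continuous (fun t => complex.Re (f t)) /\ continuous (fun t => complex.Im (f t)).

Lemma dC_ccont f (f' : R -> R[i]) : (forall t, dC f t (f' t)) -> ccont f.
Proof.
by move=> df; split=> t; have [d1 d2] := df t; [exact: is_derive_continuous d1|exact: is_derive_continuous d2].
Qed.

Lemma dC_cac a b f (f' : R -> R[i]) : (forall t, dC f t (f' t)) -> ccont f' -> cac a b f.
Proof.
move=> df [c1 c2]; split.
  by apply: (@C1_real_ac R a b _ (fun t => complex.Re (f' t))) => // t; have [] := df t.
by apply: (@C1_real_ac R a b _ (fun t => complex.Im (f' t))) => // t; have [] := df t.
Qed.

Lemma dC_derivableC f t d : dC f t d -> derivableC f t.
Proof. by move=> [[d1 _] [d2 _]]. Qed.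

Lemma dC_derivC f t d : dC f t d -> derivC f t = d.
Proof. by move=> [[_ d1] [_ d2]]; apply: complexP => /=; rewrite derive1E. Qed.

Lemma derivableC_dC f t : derivableC f t -> dC f t (derivC f t).
Proof. by move=> [d1 d2]; split; [apply: (DeriveDef d1)|apply: (DeriveDef d2)]; rewrite /= derive1E. Qed.

Lemma derivC_zero f lo hi t : (forall s, lo < s < hi -> f s = 0) -> lo < t < hi -> derivC f t = 0.
Proof.
move=> f0 tlh; apply: dC_derivC.
have tI : t \in `]lo, hi[ by rewrite in_itv.
by split; apply: (@near_eq_is_derive _ _ _ (fun=> 0));
  apply: filterS (near_in_itvoo tI) => s; rewrite in_itv /= => /f0 ->.
Qed.

Lemma cac_dC a b f : a < b -> cac a b f -> {ae mu, forall t, a < t < b -> dC f t (derivC f t)}.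
Proof.
move=> ab [ac1 ac2]; have [h1 [_ _ H1]] := ac_derive1 ab ac1.
have [h2 [_ _ H2]] := ac_derive1 ab ac2.
by apply: filterS2 H1 H2 => t d1 d2 tab; apply: derivableC_dC; split;
  [have [] := d1 tab|have [] := d2 tab].
Qed.

Lemma cac_integral_eq0 a b (G w : R -> R[i]) : a < b -> cac a b G -> G a = 0 -> G b = 0 ->
  mu.-integrable `[a, b] (fun t => (complex.Re (w t))%:E) ->
  mu.-integrable `[a, b] (fun t => (complex.Im (w t))%:E) ->
  {ae mu, forall t, a < t < b -> dC G t (w t)} ->
  \int[mu]_(t in `[a, b]) complex.Re (w t) = 0 /\ \int[mu]_(t in `[a, b]) complex.Im (w t) = 0.
Proof.
move=> ab [ac1 ac2] Ga Gb i1 i2 dG.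
have bab : a <= b <= b by rewrite ltW //=.
split.
  rewrite -(real_ac_ftc ab ac1 i1 _ bab) ?Ga ?Gb ?subrr //.
  by apply: filterS dG => t H /H[].
rewrite -(real_ac_ftc ab ac2 i2 _ bab) ?Ga ?Gb ?subrr //.
by apply: filterS dG => t H /H[].
Qed.

Variable p : R -> R.

Lemma Dl_dC (y : R -> R[i]) : Dl y -> forall t, 0 < t -> dC y t (derivC y t).
Proof. by move=> [d _ _] t t0; apply: derivableC_dC; exact: d. Qed.

Lemma Dl_cac (y : R -> R[i]) a b : Dl y -> 0 < a -> a <= b -> cac a b y /\ cac a b (derivC y).
Proof. by move=> [_ a1 a2] a0 ab; split; apply/abs_continuous_cac; [exact: a1|exact: a2]. Qed.

Lemma csol_ccont z y y' : continuous p -> csol p z y y' ->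
  [/\ ccont y, ccont y' & ccont (fun t => ((p t)%:C - z) * y t)].
Proof.
move=> cp h; have d1 t : dC y t (y' t) by case: (h t).
have d2 t : dC y' t (((p t)%:C - z) * y t) by case: (h t).
have [c1 c2] := dC_ccont d1; split; [by []|exact: dC_ccont d2|].
have cpz : continuous (fun t => p t - complex.Re z).
  by move=> t; apply: cvgB; [exact: cp|exact: cst_continuous].
split.
  rewrite (_ : (fun t => _) = fun t => (p t - complex.Re z) * complex.Re (y t) + complex.Im z * complex.Im (y t)).
    by move=> t; apply: cvgD; apply: cvgM; [exact: cpz|exact: c1|exact: cst_continuous|exact: c2].
  by apply/funext => t; rewrite !ReIm /=; ring.
rewrite (_ : (fun t => _) = fun t => (p t - complex.Re z) * complex.Im (y t) - complex.Im z * complex.Re (y t)).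
  by move=> t; apply: cvgB; apply: cvgM; [exact: cpz|exact: c2|exact: cst_continuous|exact: c1].
by apply/funext => t; rewrite !ReIm /=; ring.
Qed.

Lemma csol_cac z y y' a b : continuous p -> csol p z y y' -> cac a b y /\ cac a b y'.
Proof.
move=> cp h; have [c1 c2 c3] := csol_ccont cp h; split.
  by apply: (@dC_cac a b y y') => // t; case: (h t).
by apply: (@dC_cac a b y' (fun t => ((p t)%:C - z) * y t)) => // t; case: (h t).
Qed.

Lemma csol_derivC z y y' : csol p z y y' -> derivC y = y'.
Proof. by move=> h; apply/funext => t; apply: dC_derivC; case: (h t). Qed.

Lemma csol_Dl z y y' : continuous p -> csol p z y y' -> Dl y.
Proof.
move=> cp h; split.
- by move=> t _; apply: (@dC_derivableC _ _ (y' t)); case: (h t).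
- by move=> a b _ _; apply/abs_continuous_cac; case: (csol_cac a b cp h).
- by rewrite (csol_derivC h) => a b _ _; apply/abs_continuous_cac; case: (csol_cac a b cp h).
Qed.

Lemma csol_sturm_liouville z y y' t : csol p z y y' -> sturm_liouville p y t = z * y t.
Proof.
move=> h; rewrite /sturm_liouville (csol_derivC h).
by rewrite (dC_derivC (h t).2); ring.
Qed.

Let conjcE (x : R[i]) : Num.conj x = conjc x. Proof. by []. Qed.

Let wronskian_identity (u u' u'' y y' y'' : R[i]) (P : R) :
  u' * conjc y' + u * conjc y'' - (u'' * conjc y + u' * conjc y') =
  (- u'' + P%:C * u) * conjc y - u * conjc (- y'' + P%:C * y).
Proof. by apply: complexP; rewrite !ReIm /=; ring. Qed.

(** The derivative of u \bar y' - u' \bar y is l[u] \bar y - u \bar{l[y]}, and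
    this Wronskian vanishes outside the support of u.  As u and y are only twice
    differentiable almost everywhere, this is where the fundamental theorem for
    absolutely continuous functions is needed. *)
Lemma green_compact z u v g (y : R -> R[i]) : Dl u -> compactly_supported u ->
  L2 v -> L2 g -> eqL2 v u -> eqL2 g (sturm_liouville p u) ->
  Dl y -> L2 y -> eqL2 (sturm_liouville p y) (fun t => z * y t) ->
  innerL2 g y = innerL2 v (z \*o y).
Proof.
move=> Du [a [b [a0 ab u0]]] Lv Lg vu gu Dy Ly ly.
have Lzy : L2 (z \*o y) by exact: L2Z.
(* [A, B] is larger than the support, so that u and its derivative vanish at its ends *)
pose A := a / 2; pose B := b + 1.
have A0 : 0 < A by rewrite /A; lra.
have AB : A < B by rewrite /A /B; lra.
pose w t := g t * (y t)^* - v t * (z * y t)^*.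
pose G t := u t * (derivC y t)^* - derivC u t * (y t)^*.
have [cu cu'] := Dl_cac Du A0 (ltW AB); have [cy cy'] := Dl_cac Dy A0 (ltW AB).
have cG : cac A B G by apply: cac_sub; apply: cac_mul => //; exact: cac_conj.
have zu t : 0 < t < a -> u t = 0 by move=> /andP[t0 ta]; apply: u0 => //; left.
have zu2 t : b < t -> u t = 0 by move=> bt; apply: u0; [lra|right].
have zu' t : 0 < t < a -> derivC u t = 0 by exact: derivC_zero.
have zu2' t : b < t -> derivC u t = 0.
  by move=> bt; apply: (@derivC_zero _ b (t + 1)); [move=> s /andP[bs _]; exact: zu2|lra].
have GA : G A = 0 by rewrite /G zu ?zu' ?mul0r ?subrr // /A; lra.
have GB : G B = 0 by rewrite /G zu2 ?zu2' ?mul0r ?subrr // /B; lra.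
have [r1 i1] := inner_integrable Lg Ly; have [r2 i2] := inner_integrable Lv Lzy.
have ir : mu.-integrable D (fun t => (complex.Re (w t))%:E).
  rewrite (_ : (fun t => _) = (fun t => (complex.Re (g t * (y t)^*))%:E - (complex.Re (v t * (z * y t)^*))%:E)%E).
    exact: (integrableB (@measurable_half_line R) r1 r2).
  by apply/funext => t; rewrite ReD ReN EFinB.
have ii : mu.-integrable D (fun t => (complex.Im (w t))%:E).
  rewrite (_ : (fun t => _) = (fun t => (complex.Im (g t * (y t)^*))%:E - (complex.Im (v t * (z * y t)^*))%:E)%E).
    exact: (integrableB (@measurable_half_line R) i1 i2).
  by apply/funext => t; rewrite ImD ImN EFinB.
have ABD : `[A, B]%classic `<=` D.
  by move=> t; rewrite /half_line /= !in_itv /= andbT => /andP[At _]; exact: lt_le_trans At.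
have dG : {ae mu, forall t, A < t < B -> dC G t (w t)}.
  have h1 := cac_dC AB cu'; have h2 := cac_dC AB cy'.
  have h12 : {ae mu, forall t, A < t < B -> dC (derivC u) t (derivC (derivC u) t) /\ dC (derivC y) t (derivC (derivC y) t)}.
    by apply: filterS2 h1 h2 => t d1 d2 tAB; split; [exact: d1|exact: d2].
  have h3 : {ae mu, forall t, D t -> [/\ v t = u t, g t = sturm_liouville p u t & sturm_liouville p y t = z * y t]}.
    have h4 : {ae mu, forall t, D t -> v t = u t /\ g t = sturm_liouville p u t}.
      by apply: filterS2 vu gu => t e1 e2 Dt; split; [exact: e1|exact: e2].
    by apply: filterS2 h4 ly => t e1 e2 Dt; have [-> ->] := e1 Dt; split => //; exact: e2.
  apply: filterS2 h12 h3 => t d12 e tAB; have [d1 d2] := d12 tAB.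
  have t0 : 0 < t by case/andP: tAB => At _; exact: lt_trans At.
  have [ev eg ey] : [/\ v t = u t, g t = sturm_liouville p u t & sturm_liouville p y t = z * y t].
    by apply: e; rewrite /half_line /= in_itv /= t0.
  have e1 := Dl_dC Du t0; have e2 := Dl_dC Dy t0.
  apply: dC_eq (dC_sub (dC_mul e1 (dC_conj d2)) (dC_mul d1 (dC_conj e2))) _.
  rewrite /w ev eg -ey /sturm_liouville !conjcE; exact: wronskian_identity.
have rest : {ae mu, forall t, (D `\` `[A, B]) t -> w t = 0}.
  apply: filterS2 vu gu => t ev eg [Dt /= nAB].
  have t0 : 0 < t by move: Dt; rewrite /half_line /= in_itv /= andbT.
  have [ta|bt] : t < a \/ b < t.
    have [ta|at_] := ltP t a; first by left.
    right; rewrite ltNge; apply/negP => tb; apply: nAB.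
    by rewrite in_itv /= /A /B; lra.
  - have u0t : u t = 0 by apply: zu; rewrite t0.
    rewrite /w (ev Dt) (eg Dt) /sturm_liouville u0t mul0r subr0 mulr0 addr0.
    by rewrite (@derivC_zero _ 0 a) ?oppr0 ?mul0r // t0.
  have u0t : u t = 0 by exact: zu2.
  rewrite /w (ev Dt) (eg Dt) /sturm_liouville u0t mul0r subr0 mulr0 addr0.
  rewrite (@derivC_zero _ b (t + 1)) ?oppr0 ?mul0r //; last by rewrite bt; lra.
  by move=> s /andP[bs _]; exact: zu2'.
have mAB : measurable (`[A, B]%classic : set (measurableTypeR R)) by exact: measurable_itv.
have mDAB : measurable (D `\` `[A, B] : set (measurableTypeR R)).
  by apply: measurableD => //; exact: measurable_half_line.
have split_int (op : R[i] -> R) : op 0 = 0 ->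
    mu.-integrable D (fun t => (op (w t))%:E) ->
    \int[mu]_(t in D) op (w t) = \int[mu]_(t in `[A, B]) op (w t).
  move=> op0 iop; rewrite -{1}(setDUK ABD) Rintegral_setU //=.
  - rewrite [X in _ + X](_ : _ = 0) ?addr0 //.
    transitivity (\int[mu]_(t in D `\` `[A, B]) (0 : R)); last first.
      by rewrite Rintegral_cst ?mul0r.
    congr fine; apply: ae_eq_integral => //.
    + by apply: (measurable_int mu); apply: integrableS iop => //; exact: measurable_half_line.
    + by apply: filterS rest => t H /H ->; rewrite op0.
  - by rewrite setDUK.
  - by apply/disj_setPS; rewrite setDIK.
have [R0 I0] := cac_integral_eq0 AB cG GA GB (integrableS (@measurable_half_line R) mAB ABD ir)
  (integrableS (@measurable_half_line R) mAB ABD ii) dG.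
have e1 : \int[mu]_(t in D) complex.Re (w t) = 0 by rewrite split_int.
have e2 : \int[mu]_(t in D) complex.Im (w t) = 0 by rewrite split_int.
apply: complexP => /=; apply/eqP; rewrite -subr_eq0; apply/eqP.
  rewrite -(RintegralB (@measurable_half_line R) r1 r2) -e1.
  by apply: eq_Rintegral => t _; rewrite /w ReD ReN.
rewrite -(RintegralB (@measurable_half_line R) i1 i2) -e2.
by apply: eq_Rintegral => t _; rewrite /w ImD ImN.
Qed.

End GreenIdentity.

(** * Weak solutions *)
Section WeakSolutions.
Variable R : realType.
Notation mu := (@lebesgue_measure R).
Notation D := (half_line R).
Implicit Types (a b t : R) (f g w : R -> R[i]).

Let ae_filter_mu : Filter (almost_everywhere mu).
Proof. exact: ae_filter_ringOfSetsType. Qed.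
Existing Instance ae_filter_mu.

Definition cut a b f : R -> R[i] := fun t => (\1_(`[a, b]%classic) t)%:C * f t.

Lemma cut_in a b f t : a <= t <= b -> cut a b f t = f t.
Proof. by move=> tab; rewrite /cut indicE mem_set /= ?in_itv // mul1r. Qed.

Lemma cut_out a b f t : ~~ (a <= t <= b) -> cut a b f t = 0.
Proof. by move=> tab; rewrite /cut indicE memNset /= ?in_itv ?mul0r //; exact/negP. Qed.

Lemma complex_measurable_cut a b f : complex_measurable f -> complex_measurable (cut a b f).
Proof.
move=> mf; apply: complex_measurableM => //; split => /=; last exact: measurable_cst.
by apply: measurable_indic; exact: measurable_itv.
Qed.

Lemma L2_cut a b w : L2 w -> L2 (cut a b w).
Proof.
move=> Lw; apply: integrable_L2; first by apply: complex_measurable_cut; case: Lw.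
apply: (integrable_le _ (L2_integrable Lw)).
  have [m1 m2] : complex_measurable (cut a b w) by apply: complex_measurable_cut; case: Lw.
  by under eq_fun do rewrite normc2; apply: measurable_funD; exact: measurable_funX.
move=> t; rewrite ger0_norm ?normc2_ge0 //; have [tab|tab] := boolP (a <= t <= b).
  by rewrite cut_in.
by rewrite cut_out // normc2 /= expr0n /= addr0 normc2_ge0.
Qed.

Lemma ccont_measurable f : ccont f -> complex_measurable f.
Proof. by move=> [c1 c2]; split; apply: measurable_funTS; exact: continuous_measurable_fun. Qed.

Lemma L2_cut_ccont a b f : ccont f -> L2 (cut a b f).
Proof.
move=> cf; have [c1 c2] := cf.
have [K1 [K10 H1]] := continuous_bounded a b c1; have [K2 [K20 H2]] := continuous_bounded a b c2.
have mc : complex_measurable (cut a b f) by apply/complex_measurable_cut/ccont_measurable.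
apply: integrable_L2 => //.
have i1 : mu.-integrable D (EFin \o (fun t => (K1 ^+ 2 + K2 ^+ 2) * \1_(`[a, b]%classic) t)).
  have i0 : mu.-integrable D (EFin \o (\1_(`[a, b]%classic) : R -> R)); last first.
    exact: (integrableZl (@measurable_half_line R) (K1 ^+ 2 + K2 ^+ 2) i0).
  apply: (@integrableS _ _ _ _ setT) => //; first exact: measurable_half_line.
  exact: integrable_indic_itv.
apply: (integrable_le _ i1).
  have [m1 m2] := mc.
  by under eq_fun do rewrite normc2; apply: measurable_funD; exact: measurable_funX.
move=> t; rewrite ger0_norm ?normc2_ge0 //; have [tab|tab] := boolP (a <= t <= b).
  rewrite cut_in // indicE mem_set /= ?in_itv // mulr1 normc2.
  have sq (x K : R) : 0 <= K -> `|x| <= K -> x ^+ 2 <= K ^+ 2.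
    by move=> K0 xK; rewrite -(real_normK (num_real x)) ler_sqr ?nnegrE.
  by apply: lerD; apply: sq => //; [exact: H1|exact: H2].
by rewrite cut_out // normc2 /= expr0n /= addr0 mulr_ge0 // addr_ge0 // sqr_ge0.
Qed.

Lemma innerL2_linr c f g1 g2 : L2 f -> L2 g1 -> L2 g2 ->
  innerL2 f (fun t => c * g1 t + g2 t) = conjc c * innerL2 f g1 + innerL2 f g2.
Proof.
move=> Lf L1 L2'; rewrite (innerL2_conj (L2_lin c L1 L2') Lf) innerL2_lin //.
by rewrite (innerL2_conj L1 Lf) (innerL2_conj L2' Lf); apply: complexP; rewrite !ReIm /=; ring.
Qed.

Lemma projection1 w e : L2 w -> L2 e -> exists c, innerL2 (fun t => - c * e t + w t) e = 0.
Proof.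
move=> Lw Le; have [n0|n0] := eqVneq (normL2 e) 0.
  exists 0; rewrite innerL2_lin // oppr0 mul0r add0r.
  have := cauchy_schwarz Lw Le; rewrite n0 mulr0 => h.
  have : normc (innerL2 w e) ^+ 2 = 0.
    have -> : normc (innerL2 w e) = 0 by apply/eqP; rewrite eq_le h normc_ge0.
    by rewrite expr0n.
  rewrite normc2 => /eqP; rewrite paddr_eq0 ?sqr_ge0 // !sqrf_eq0 => /andP[/eqP h1 /eqP h2].
  exact: complexP.
exists (innerL2 w e / (normL2 e ^+ 2)%:C); rewrite innerL2_lin // innerL2_self mulNr divfK ?addNr //.
by apply/eqP => /(congr1 (@complex.Re R)) /= /eqP; rewrite (negbTE (expf_neq0 2 n0)).
Qed.

(** Gram--Schmidt for two vectors that may be linearly dependent. *)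
Lemma projection2 w e1 e2 : L2 w -> L2 e1 -> L2 e2 -> exists c1 c2,
  let r t := w t - c1 * e1 t - c2 * e2 t in innerL2 r e1 = 0 /\ innerL2 r e2 = 0.
Proof.
move=> Lw L1 L2'; have [k hk] := projection1 L2' L1.
pose e t := - k * e1 t + e2 t; have Le : L2 e by exact: L2_lin.
have [d1 h1] := projection1 Lw L1; pose w1 t := - d1 * e1 t + w t.
have Lw1 : L2 w1 by exact: L2_lin.
have [d2 h2] := projection1 Lw1 Le.
exists (d1 - d2 * k), d2.
have -> : (fun t => w t - (d1 - d2 * k) * e1 t - d2 * e2 t) = (fun t => - d2 * e t + w1 t).
  by apply/funext => t; rewrite /e /w1; ring.
have o1 : innerL2 (fun t => - d2 * e t + w1 t) e1 = 0.
  by rewrite innerL2_lin // hk h1 mulr0 addr0.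
split => //.
have -> : e2 = fun t => k * e1 t + e t by apply/funext => t; rewrite /e; ring.
by rewrite innerL2_linr // ?o1 ?h2 ?mulr0 ?addr0 //; exact: L2_lin.
Qed.

End WeakSolutions.

Section WeakToStrong.
Variable R : realType.
Notation mu := (@lebesgue_measure R).
Notation D := (half_line R).
Implicit Types (a b t : R) (f g w : R -> R[i]).

Let ae_filter_mu : Filter (almost_everywhere mu).
Proof. exact: ae_filter_ringOfSetsType. Qed.
Existing Instance ae_filter_mu.

Lemma integrable_half_line_setT (k : R -> R) : mu.-integrable D (EFin \o k) ->
  (forall t, ~ D t -> k t = 0) -> mu.-integrable setT (EFin \o k).
Proof.
move=> ik k0; have -> : EFin \o k = (EFin \o k) \_ D.
  apply/funext => t; rewrite patchE; case: ifPn => //; rewrite notin_setE => /k0 /= -> //.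
by rewrite -integrable_mkcond //; exact: measurable_half_line.
Qed.

Lemma Rintegral_supp (A B : set R) (k : R -> R) : A `<=` B ->
  (forall t, B t -> ~ A t -> k t = 0) -> \int[mu]_(t in B) k t = \int[mu]_(t in A) k t.
Proof.
move=> AB k0; rewrite Rintegral_mkcond [RHS]Rintegral_mkcond; congr Rintegral.
apply/funext => t; rewrite !patchE; case: ifPn => tB; case: ifPn => // tA.
  by rewrite k0 //; [exact: set_mem|move: tA; rewrite notin_setE].
by move: tB; rewrite notin_setE; apply: contra_notP => _; apply: AB; exact: set_mem.
Qed.

(** A density with compact support and mean 0 has an antiderivative with the
    same support. *)
Lemma complex_indefinite_integral a b (k : R -> R[i]) : 0 < a ->
  mu.-integrable D (fun t => (complex.Re (k t))%:E) ->
  mu.-integrable D (fun t => (complex.Im (k t))%:E) ->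
  (forall t, ~~ (a <= t <= b) -> k t = 0) -> integralC k = 0 ->
  exists F : R -> R[i], [/\ forall x y, cac x y F, forall t, ~~ (a <= t <= b) -> F t = 0 &
    {ae mu, forall t, 0 < t -> dC F t (k t)}].
Proof.
move=> a0 i1 i2 k0 kI.
have kD t : ~ D t -> k t = 0.
  rewrite /half_line /= in_itv /= andbT => /negP; rewrite -leNgt => t0; apply: k0.
  by rewrite negb_and -ltNge (le_lt_trans t0 a0).
have I1 : mu.-integrable setT (EFin \o (fun t => complex.Re (k t))).
  by apply: integrable_half_line_setT => // t /kD ->.
have I2 : mu.-integrable setT (EFin \o (fun t => complex.Im (k t))).
  by apply: integrable_half_line_setT => // t /kD ->.
exists (fun t => (\int[mu]_(s in `[0, t]) complex.Re (k s)) +i* (\int[mu]_(s in `[0, t]) complex.Im (k s))).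
split=> [x y|t tab|].
- have aux (h : R -> R) : mu.-integrable setT (EFin \o h) -> (forall t, t < 0 -> h t = 0) ->
      real_ac x y (fun t => \int[mu]_(s in `[0, t]) h s).
    move=> ih h0; pose M := Num.min 0 x.
    have -> : (fun t => \int[mu]_(s in `[0, t]) h s) = (fun t => \int[mu]_(s in `[M, t]) h s).
      apply/funext => t; apply/esym; apply: Rintegral_supp => s; rewrite /= !in_itv /=.
        by move=> /andP[s0 ->]; rewrite andbT (le_trans _ s0) // /M ge_min lexx.
      by move=> /andP[_ ->]; rewrite andbT => /negP; rewrite -ltNge; exact: h0.
    by apply: (@real_acW _ M y); [rewrite /M ge_min lexx orbT|exact: lexx|exact: (@integral_real_ac R M y h ih)].
  have k00 t : t < 0 -> k t = 0 by move=> t0; apply: kD; rewrite /half_line /= in_itv /= andbT; lra.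
  split; first by apply: (aux (fun t => complex.Re (k t)) I1) => t /k00 ->.
  by apply: (aux (fun t => complex.Im (k t)) I2) => t /k00 ->.
- have aux (op : R[i] -> R) : op 0 = 0 -> \int[mu]_(s in D) op (k s) = 0 ->
      \int[mu]_(s in `[0, t]) op (k s) = 0.
    move=> op0 opI; have [ta|at_] := ltP t a.
      rewrite (@Rintegral_supp set0) ?Rintegral_set0 // => s /=; rewrite in_itv /= => /andP[_ st] _.
      by rewrite k0 ?op0 // negb_and -ltNge (le_lt_trans st ta).
    have bt : b < t by move: tab; rewrite at_ /= -ltNge.
    transitivity (\int[mu]_(s in `]0, t]) op (k s)).
      apply: Rintegral_supp => [s /=|s /=]; rewrite !in_itv /=; first by move=> /andP[/ltW -> ->].
      move=> /andP[s0 st] /negP; rewrite st andbT -leNgt => s0'.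
      by rewrite k0 ?op0 // negb_and -ltNge (le_lt_trans s0' a0).
    apply: etrans opI; apply/esym; apply: Rintegral_supp => s; rewrite /half_line /= !in_itv /= ?andbT.
      by case/andP.
    move=> s0 /negP; rewrite s0 /= -ltNge => ts.
    by rewrite k0 ?op0 // negb_and orbC -ltNge (lt_trans bt ts).
  by apply: complexP => /=; apply: aux => //; [have /(congr1 (@complex.Re R)) := kI|have /(congr1 (@complex.Im R)) := kI].
- have loc (h : R -> R) : mu.-integrable setT (EFin \o h) -> {ae mu, forall t, 0 < t ->
      is_derive t 1 (fun t => \int[mu]_(s in `[0, t]) h s) (h t)}.
    move=> ih; have lh : locally_integrable setT h.
      have := @integrable_locally R h setT measurableT ih; rewrite patch_setT //.
    have ih0 : forall y, mu.-integrable [set` Interval (BLeft (0 : R)) (BRight y)] (EFin \o h).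
      by move=> y; apply: integrableS ih.
    have := FTC1 ih0 lh.
    apply: filterS => t H t0; have [|d e] := H; first by rewrite /= lte_fin.
    by apply: (DeriveDef d); rewrite -derive1E.
  by apply: filterS2 (loc _ I1) (loc _ I2) => t d1 d2 t0; split; [exact: d1|exact: d2].
Qed.

Variable p : R -> R.
Hypothesis cp : continuous p.
Variables (z : R[i]) (s1 s1' s2 s2' : R -> R[i]).
Hypothesis fund : fundamental p z s1 s1' s2 s2'.

Let dconj z0 s s' t : csol p z0 s s' ->
  dC (fun t => conjc (s t)) t (conjc (s' t)) /\
  dC (fun t => conjc (s' t)) t (conjc (((p t)%:C - z0) * s t)).
Proof. by move=> h; have [d1 d2] := h t; split; exact: dC_conj. Qed.

Let variation_identity (P a1 a1' a2 a2' F1 F2 ph : R[i]) :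
  a1 * a2' - a1' * a2 = 1 ->
  P * a1 * F2 + a1' * (ph * a2) - (P * a2 * F1 + a2' * (ph * a1)) =
  P * (a1 * F2 - a2 * F1) - ph.
Proof.
by move=> W; rewrite -[in RHS](mulr1 ph) -W; ring.
Qed.

(** An L_2 function orthogonal to (l - \bar z) u for every compactly supported
    u solves l[y] = z y on each compact interval: the part phi of w orthogonal
    to the solution space is itself of the form (l - \bar z) u, by variation of
    constants, hence orthogonal to w. *)
Lemma weak_solution_local w a b : 0 < a -> a < b -> L2 w ->
  (forall u g, sl_restriction p (@Dl R `&` @compactly_supported R) (u, g) ->
     innerL2 g w = innerL2 u (z \*o w)) ->
  exists c1 c2, {ae mu, forall t, a <= t <= b -> w t = c1 * s1 t + c2 * s2 t}.
Proof.
have [h1 h2 W1] := fund => a0 ab Lw orth.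
have cc1 : ccont s1 by apply: (@dC_ccont _ s1 s1') => t; case: (h1 t).
have cc2 : ccont s2 by apply: (@dC_ccont _ s2 s2') => t; case: (h2 t).
have Lc1 := L2_cut_ccont a b cc1; have Lc2 := L2_cut_ccont a b cc2.
have LW := L2_cut a b Lw.
have [c1 [c2 [orth1 orth2]]] := projection2 LW Lc1 Lc2.
pose phi t := cut a b w t - c1 * cut a b s1 t - c2 * cut a b s2 t.
rewrite -/phi in orth1 orth2.
exists c1, c2.
have Lphi : L2 phi.
  rewrite (_ : phi = fun t => - c2 * cut a b s2 t + (- c1 * cut a b s1 t + cut a b w t)).
    by apply: L2_lin => //; exact: L2_lin.
  by apply/funext => t; rewrite /phi; ring.
have phi_in t : a <= t <= b -> phi t = w t - c1 * s1 t - c2 * s2 t.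
  by move=> tab; rewrite /phi !cut_in.
have phi_out t : ~~ (a <= t <= b) -> phi t = 0.
  by move=> tab; rewrite /phi !cut_out // !mulr0 !subr0.
pose k s t := phi t * conjc (s t).
have kE s t : k s t = phi t * conjc (cut a b s t).
  rewrite /k; have [tab|tab] := boolP (a <= t <= b); first by rewrite cut_in.
  by rewrite phi_out // !mul0r.
have k_out s t : ~~ (a <= t <= b) -> k s t = 0 by move=> tab; rewrite /k phi_out // mul0r.
have F_ s : L2 (cut a b s) -> innerL2 phi (cut a b s) = 0 ->
    exists F : R -> R[i], [/\ forall x y, cac x y F, forall t, ~~ (a <= t <= b) -> F t = 0 &
      {ae mu, forall t, 0 < t -> dC F t (k s t)}].
  move=> Ls os; have [r i] := inner_integrable Lphi Ls.
  have kE' : k s = fun t => phi t * conjc (cut a b s t) by apply/funext => t; exact: kE.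
  apply: (@complex_indefinite_integral a b (k s) a0);
    [rewrite kE'; exact: r|rewrite kE'; exact: i|exact: k_out|rewrite kE'; exact: os].
have [F1 [ac1 z1 d1]] := F_ s1 Lc1 orth1; have [F2 [ac2 z2 d2]] := F_ s2 Lc2 orth2.
(* variation of constants for the conjugate system, whose Wronskian is again 1 *)
pose u t := conjc (s1 t) * F2 t - conjc (s2 t) * F1 t.
pose u1 t := conjc (s1' t) * F2 t - conjc (s2' t) * F1 t.
have ds1 t := dconj t h1; have ds2 t := dconj t h2.
have ac1' x y : cac x y s1 /\ cac x y s1' by exact: csol_cac cp h1.
have ac2' x y : cac x y s2 /\ cac x y s2' by exact: csol_cac cp h2.
have acu x y : cac x y u.
  by apply: cac_sub; apply: cac_mul => //; apply: cac_conj; [case: (ac1' x y)|case: (ac2' x y)].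
have acu1 x y : cac x y u1.
  by apply: cac_sub; apply: cac_mul => //; apply: cac_conj; [case: (ac1' x y)|case: (ac2' x y)].
have W t : conjc (s1 t) * conjc (s2' t) - conjc (s1' t) * conjc (s2 t) = 1.
  by rewrite -!rmorphM -rmorphB /= W1; apply: complexP => //=; rewrite oppr0.
have dF : {ae mu, forall t, 0 < t -> dC F1 t (k s1 t) /\ dC F2 t (k s2 t)}.
  by apply: filterS2 d1 d2 => t e1 e2 t0; split; [exact: e1|exact: e2].
have du_ae : {ae mu, forall t, 0 < t -> dC u t (u1 t)}.
  apply: filterS dF => t H t0; have [e1 e2] := H t0.
  apply: dC_eq (dC_sub (dC_mul (ds1 t).1 e2) (dC_mul (ds2 t).1 e1)) _.
  by rewrite /u1 /k; ring.
have du1_ae : {ae mu, forall t, 0 < t -> dC u1 t (((p t)%:C - conjc z) * u t - phi t)}.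
  apply: filterS dF => t H t0; have [e1 e2] := H t0.
  apply: dC_eq (dC_sub (dC_mul (ds1 t).2 e2) (dC_mul (ds2 t).2 e1)) _.
  have cj (s : R[i]) : conjc (((p t)%:C - z) * s) = ((p t)%:C - conjc z) * conjc s.
    by apply: complexP; rewrite !ReIm /=; ring.
  by rewrite !cj /k /u; exact: variation_identity.
have du t : 0 < t -> dC u t (u1 t).
  move=> t0; split.
    apply: (@real_ac_C1 R 0 _ (fun t => complex.Re (u1 t))) => //.
    - by move=> x y; case: (acu x y).
    - by apply: real_ac_continuous => x y; case: (acu1 x y).
    - by apply: filterS du_ae => s H s0; case: (H s0).
  apply: (@real_ac_C1 R 0 _ (fun t => complex.Im (u1 t))) => //.
  - by move=> x y; case: (acu x y).
  - by apply: real_ac_continuous => x y; case: (acu1 x y).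
  - by apply: filterS du_ae => s H s0; case: (H s0).
have deu t : 0 < t -> derivC u t = u1 t by move=> /du; exact: dC_derivC.
have u_out t : ~~ (a <= t <= b) -> u t = 0.
  by move=> tab; rewrite /u z1 // z2 // !mulr0 subr0.
have Dlu : Dl u.
  split.
  - by move=> t /du; exact: dC_derivableC.
  - by move=> x y _ _; apply/abs_continuous_cac.
  - move=> x y x0 xy; apply/abs_continuous_cac; have [c1' c2'] := acu1 x y.
    by split; [apply: real_ac_ext c1'|apply: real_ac_ext c2'] => t /andP[xt _]; rewrite deu // (lt_le_trans x0).
have csu : compactly_supported u.
  exists a, b; split => //; first exact: ltW.
  by move=> t t0 tab; apply: u_out; rewrite negb_and -!ltNge; apply/orP.
have ccu : ccont u by split; apply: real_ac_continuous => x y; case: (acu x y).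
have cutu : cut a b u = u.
  by apply/funext => t; have [tab|tab] := boolP (a <= t <= b); [rewrite cut_in|rewrite cut_out // u_out].
have Lu : L2 u by rewrite -cutu; exact: L2_cut_ccont.
pose g t := conjc z * u t + phi t.
have Lg : L2 g by exact: L2_lin.
have lu : eqL2 g (sturm_liouville p u).
  apply: filterS du1_ae => t H; rewrite /half_line /= in_itv /= andbT => t0.
  (* u1 agrees with the derivative of u on the half-line only *)
  have d2u : dC (derivC u) t (((p t)%:C - conjc z) * u t - phi t).
    have tI : t \in `]0, (t + 1)[ by rewrite in_itv /= t0; lra.
    have [e1 e2] := H t0.
    split; [apply: near_eq_is_derive e1|apply: near_eq_is_derive e2];
      by apply: filterS (near_in_itvoo tI) => s; rewrite in_itv /= => /andP[s0 _]; rewrite -(deu _ s0).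
  by rewrite /sturm_liouville (dC_derivC d2u) /g; ring.
have zLw : L2 (z \*o w) by exact: L2Z.
have := orth u g; rewrite /sl_restriction /= => /(_ _)/wrap[].
  by split => //; exists u; split => //; exact: eqL2_refl.
rewrite innerL2_lin //.
have -> : innerL2 u (z \*o w) = conjc z * innerL2 u w.
  rewrite (_ : z \*o w = fun t => z * w t + 0); last by apply/funext => t; rewrite addr0.
  rewrite innerL2_linr //; last exact: L20.
  by rewrite (innerL2_conj (L20 R) Lu) innerL20l rmorph0 addr0.
move=> /eqP; rewrite -subr_eq0 addrAC subrr add0r => /eqP phiw.
have phiW : innerL2 phi (cut a b w) = 0.
  rewrite -phiw; have E : (fun t => phi t * conjc (cut a b w t)) = (fun t => phi t * conjc (w t)).
    apply/funext => t; have [tab|tab] := boolP (a <= t <= b); first by rewrite cut_in.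
    by rewrite phi_out // !mul0r.
  by rewrite /innerL2; congr integralC.
have phi2 : innerL2 phi phi = 0.
  have -> : innerL2 phi phi = innerL2 phi (fun t => - c2 * cut a b s2 t + (- c1 * cut a b s1 t + cut a b w t)).
    by congr innerL2; apply/funext => t; rewrite /phi; ring.
  rewrite innerL2_linr //; last exact: L2_lin.
  by rewrite innerL2_linr // orth1 orth2 phiW !mulr0 !addr0.
have := normL2_eq0 Lphi; move: phi2; rewrite innerL2_self => /(congr1 (@complex.Re R)) /= /eqP.
rewrite sqrf_eq0 => /eqP n0 /(_ n0); apply: filterS => t H tab.
have /H : D t by rewrite /half_line /= in_itv /= andbT; case/andP: tab => + _; exact: lt_le_trans.
by rewrite phi_in // => /eqP; rewrite subr_eq0 subr_eq => /eqP ->; rewrite addrC.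
Qed.
End WeakToStrong.

(** * The kernel of the adjoint *)
Section AdjointKernel.
Variable R : realType.
Notation mu := (@lebesgue_measure R).
Notation D := (half_line R).
Implicit Types (a b t : R) (f g w y : R -> R[i]).

Let ae_filter_mu : Filter (almost_everywhere mu).
Proof. exact: ae_filter_ringOfSetsType. Qed.
Existing Instance ae_filter_mu.

Lemma continuous_ae_eq0 a b (f : R -> R) : continuous f ->
  {ae mu, forall t, a < t < b -> f t = 0} -> forall t, a < t < b -> f t = 0.
Proof.
move=> cf [A [mA A0 bad]] t tab; apply/eqP; apply: contraPT isT => ft0.
have ft : 0 < `|f t| by rewrite normr_gt0.
have tI : t \in `]a, b[ by rewrite in_itv.
have [r /= r0 br] : \forall s \near t, a < s < b /\ f s != 0.
  have := cf t => /cvgrPdist_lt /(_ _ ft) H.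
  near=> s; split; first by have : s \in `]a, b[ by near: s; exact: near_in_itvoo.
  apply/eqP => fs; have : `|f t - f s| < `|f t| by near: s.
  by rewrite fs subr0 ltxx.
have sub : ball t r `<=` A.
  by move=> s /br [sab fs]; apply: bad => /= H; move/eqP: fs; apply; exact: H.
have : (mu (ball t r) <= 0)%E.
  by rewrite -A0; apply: le_measure; rewrite ?inE //; exact: measurable_ball.
rewrite lebesgue_measure_ball; last exact: ltW.
by move=> h; have : r *+ 2 <= 0 by []; rewrite leNgt mulrn_wgt0.
Unshelve. all: by end_near. Qed.

Variable p : R -> R.
Hypothesis cp : continuous p.

Section Solutions.
Variables (z : R[i]) (s1 s1' s2 s2' : R -> R[i]).
Hypothesis fund : fundamental p z s1 s1' s2 s2'.

(** The coefficients are the Wronskians with the fundamental system. *)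
Lemma csol_rep y y' : csol p z y y' -> exists c1 c2,
  (forall t, y t = c1 * s1 t + c2 * s2 t) /\ (forall t, y' t = c1 * s1' t + c2 * s2' t).
Proof.
have [h1 h2 W] := fund => h.
exists (y 0 * s2' 0 - y' 0 * s2 0), (- (y 0 * s1' 0 - y' 0 * s1 0)).
have e1 := wronskian_cst h h2; have e2 := wronskian_cst h h1.
split=> t; rewrite -(e1 t) -(e2 t).
  by rewrite -[LHS]mulr1 -(W t); ring.
by rewrite -[LHS]mulr1 -(W t); ring.
Qed.

Lemma csol_ae_eq0 a b y y' : a < b -> csol p z y y' ->
  {ae mu, forall t, a < t < b -> y t = 0} -> forall t, y t = 0.
Proof.
move=> ab h y0; have [c1 [c2 [e1 e2]]] := csol_rep h; have [_ _ W] := fund.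
have [[cR cI] _ _] := csol_ccont cp h.
have yab t : a < t < b -> y t = 0.
  move=> tab; apply: complexP.
    by apply: (continuous_ae_eq0 cR _ tab); apply: filterS y0 => s H /H ->.
  by apply: (continuous_ae_eq0 cI _ tab); apply: filterS y0 => s H /H ->.
have y'ab t : a < t < b -> y' t = 0.
  by move=> tab; rewrite -(csol_derivC h); exact: derivC_zero tab.
pose m := (a + b) / 2; have mab : a < m < b by rewrite /m; lra.
have ym := yab m mab; have y'm := y'ab m mab.
have c10 : c1 = 0.
  have -> : c1 = y m * s2' m - y' m * s2 m by rewrite e1 e2 -[LHS]mulr1 -(W m); ring.
  by rewrite ym y'm; ring.
have c20 : c2 = 0.
  have -> : c2 = y' m * s1 m - y m * s1' m by rewrite e1 e2 -[LHS]mulr1 -(W m); ring.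
  by rewrite ym y'm; ring.
by move=> t; rewrite e1 c10 c20; ring.
Qed.

Lemma comb_ae_eq0 a b c1 c2 : a < b ->
  {ae mu, forall t, a < t < b -> c1 * s1 t + c2 * s2 t = 0} -> c1 = 0 /\ c2 = 0.
Proof.
have [h1 h2 W] := fund => ab H; have h := csol_lin c1 c2 h1 h2.
have y0 := csol_ae_eq0 ab h H.
have y'0 t : c1 * s1' t + c2 * s2' t = 0.
  by rewrite -(congr1 (fun f => f t) (csol_derivC h)); apply: (@derivC_zero _ _ (t - 1) (t + 1)) => //; lra.
split.
  have -> : c1 = (c1 * s1 0 + c2 * s2 0) * s2' 0 - (c1 * s1' 0 + c2 * s2' 0) * s2 0.
    by rewrite -[LHS]mulr1 -(W 0); ring.
  by rewrite y0 y'0; ring.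
have -> : c2 = (c1 * s1' 0 + c2 * s2' 0) * s1 0 - (c1 * s1 0 + c2 * s2 0) * s1' 0.
  by rewrite -[LHS]mulr1 -(W 0); ring.
by rewrite y0 y'0; ring.
Qed.

(** The local representations on [1 / (n + 1), n + 2] share [1, 2], where the
    coefficients are determined. *)
Lemma weak_solution w : L2 w ->
  (forall u g, sl_restriction p (@Dl R `&` @compactly_supported R) (u, g) ->
     innerL2 g w = innerL2 u (z \*o w)) ->
  exists c1 c2, eqL2 w (fun t => c1 * s1 t + c2 * s2 t).
Proof.
move=> Lw orth.
have loc (n : nat) : exists c : R[i] * R[i],
    {ae mu, forall t, (n.+1%:R)^-1 <= t <= n.+2%:R -> w t = c.1 * s1 t + c.2 * s2 t}.
  have n0 : 0 < (n.+1%:R : R)^-1 by rewrite invr_gt0 ltr0n.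
  have n1 : (n.+1%:R : R)^-1 <= 1 by rewrite invf_le1 ?ler1n ?ltr0n.
  have [|c1 [c2 H]] := weak_solution_local cp fund n0 _ Lw orth (b := n.+2%:R); last by exists (c1, c2).
  by apply: le_lt_trans n1 _; rewrite ltr1n.
have [c Hc] := choice loc.
have same n : c n = c 0%N.
  have : (c n).1 - (c 0%N).1 = 0 /\ (c n).2 - (c 0%N).2 = 0.
    apply: (@comb_ae_eq0 1 2); first by lra.
    apply: filterS2 (Hc n) (Hc 0%N) => t e1 e2 /andP[t1 t2].
    have n1 : (n.+1%:R : R)^-1 <= 1 by rewrite invf_le1 ?ler1n ?ltr0n.
    have n2 : 2 <= n.+2%:R :> R by rewrite ler_nat.
    have := e1 _; have := e2 _; rewrite invr1 (ltW t1) (ltW t2) => /(_ isT) -> /(_ _)/wrap[].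
      by rewrite (le_trans n1 (ltW t1)) (le_trans (ltW t2) n2).
    by move=> E; apply/eqP; rewrite -(subr_eq0 _ 0) subr0 mulrBl mulrBl addrACA -opprD -E subrr.
  by case: (c n) (c 0%N) => [x1 x2] [y1 y2] /= [/eqP + /eqP]; rewrite !subr_eq0 => /eqP -> /eqP ->.
exists (c 0%N).1, (c 0%N).2.
have : {ae mu, forall t, forall n : nat, (n.+1%:R)^-1 <= t <= n.+2%:R -> w t = (c 0%N).1 * s1 t + (c 0%N).2 * s2 t}.
  by apply/ae_foralln => n; apply: filterS (Hc n) => t; rewrite same.
apply: filterS => t H; rewrite /half_line /= in_itv /= andbT => t0.
pose n := Num.bound (t + t^-1); have nb : t + t^-1 < n%:R by apply: archi_boundP; rewrite addr_ge0 // ?invr_ge0 ltW.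
have ti : 0 < t^-1 by rewrite invr_gt0.
apply: (H n); apply/andP; split.
  rewrite -[leRHS]invrK lef_pV2 ?posrE ?ltr0n //.
  by rewrite -natr1; lra.
have : (n%:R : R) <= n.+2%:R by rewrite ler_nat leqW.
by lra.
Qed.

End Solutions.

Lemma restriction_minimal u g : sl_restriction p (@Dl R `&` @compactly_supported R) (u, g) ->
  minimal_operator p (u, g).
Proof.
move=> h; have [Lu Lg _] := h; split => // e e0; exists u, g.
have z0 f : normL2 (f \- f) = 0.
  have -> : f \- f = fun=> 0 by apply/funext => t; rewrite /= subrr.
  have := innerL2_self (fun _ : R => 0 : R[i]); rewrite innerL20l => /(congr1 (@complex.Re R)) /= /esym/eqP.
  by rewrite sqrf_eq0 => /eqP.
by split => //=; rewrite z0.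
Qed.

(** Green's identity on compactly supported functions extends to the closure by
    the Cauchy--Schwarz inequality. *)
Lemma solution_adjoint z y : L2 y -> Dl y -> eqL2 (sturm_liouville p y) (fun t => z * y t) ->
  ker_op (adjoint_op (minimal_operator p)) z y.
Proof.
move=> Ly Dy ly; have Lzy : L2 (z \*o y) by exact: L2Z.
split => //= u f [/= Lu Lf cl].
apply/eqP; rewrite -subr_eq0; apply/eqP; set d := _ - _.
have dle e : 0 < e -> normc d <= e * (normL2 y + normL2 (z \*o y)).
  move=> e0; have [v [g [rst nv ng]]] := cl e e0.
  have [Lv Lg [u0 [[Du cu] vu gu]]] := rst.
  have G := green_compact Du cu Lv Lg vu gu Dy Ly ly.
  have B (k1 k2 k3 : R -> R[i]) : L2 k1 -> L2 k2 -> L2 k3 -> innerL2 (k1 \- k2) k3 = innerL2 k1 k3 - innerL2 k2 k3.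
    move=> l1 l2 l3; rewrite (_ : k1 \- k2 = fun t => -1 * k2 t + k1 t); last by apply/funext => t; rewrite /= mulN1r addrC.
    by rewrite innerL2_lin // mulN1r addrC.
  have -> : d = innerL2 (f \- g) y - innerL2 (u \- v) (z \*o y).
    by rewrite /d !B // G; ring.
  have n1 := cauchy_schwarz (L2B Lf Lg) Ly; have n2 := cauchy_schwarz (L2B Lu Lv) Lzy.
  apply: (@le_trans _ _ (normc (innerL2 (f \- g) y) + normc (innerL2 (u \- v) (z \*o y)))).
    by rewrite -[X in _ <= _ + X]normcN; exact: le_normcD.
  rewrite mulrDr; apply: lerD.
    by apply: le_trans n1 _; rewrite ler_wpM2r ?normL2_ge0 // ltW.
  by apply: le_trans n2 _; rewrite ler_wpM2r ?normL2_ge0 // ltW.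
set K := normL2 y + normL2 (z \*o y) in dle.
have K0 : 0 <= K by rewrite addr_ge0 // normL2_ge0.
have d0 : normc d = 0.
  apply/eqP; rewrite eq_le normc_ge0 andbT leNgt; apply/negP => dp.
  have K1 : 0 < K + 1 by lra.
  have := dle (normc d / (2 * (K + 1))); rewrite divr_gt0 ?mulr_gt0 // => /(_ isT).
  have -> : normc d / (2 * (K + 1)) * K = normc d * (K / (2 * (K + 1))) by ring.
  have : K / (2 * (K + 1)) < 1 by rewrite ltr_pdivrMr ?mulr_gt0 //; lra.
  by nra.
exact: eq0_normc.
Qed.

End AdjointKernel.

(** * A limit point criterion *)
Section LimitPoint.
Variable R : realType.
Notation mu := (@lebesgue_measure R).
Notation D := (half_line R).
Implicit Types (a b t : R) (f g w y : R -> R[i]).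

Let ae_filter_mu : Filter (almost_everywhere mu).
Proof. exact: ae_filter_ringOfSetsType. Qed.
Existing Instance ae_filter_mu.

Definition nsq f t : R := complex.Re (f t) ^+ 2 + complex.Im (f t) ^+ 2.

Lemma nsqE f t : normc (f t) ^+ 2 = nsq f t. Proof. exact: normc2. Qed.

Lemma nsq_ge0 f t : 0 <= nsq f t. Proof. by rewrite addr_ge0 // sqr_ge0. Qed.

Lemma continuous_nsq f : ccont f -> continuous (nsq f).
Proof. by move=> [c1 c2] t; apply: cvgD; apply: cvgM; by [exact: c1|exact: c2]. Qed.

Lemma prim_nsq_le f a b : ccont f -> a <= b -> prim (nsq f) a <= prim (nsq f) b.
Proof.
move=> cf ab; have := @ler_increment R a b (fun=> 0) (prim (nsq f)) (fun=> 0) (nsq f) ab.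
rewrite subrr subr_ge0; apply=> t _; [exact/is_derive_prim/continuous_nsq|exact: nsq_ge0].
Qed.

Lemma integral_half_line_prim f t : ccont f -> 0 <= t ->
  (\int[mu]_(s in `]0%R, t]) (nsq f s)%:E = (prim (nsq f) t)%:E)%E.
Proof.
move=> cf t0; have cn := continuous_nsq cf.
have := primE cn t0; rewrite prim0 subr0 => ->; rewrite /Rintegral fineK; last first.
  by apply: integrable_fin_num => //; exact: continuous_integrable.
rewrite integral_itv_obnd_cbnd //.
by apply/measurable_EFinP; apply: measurable_funTS; exact: continuous_measurable_fun.
Qed.

Lemma normL2_sqr f : normL2 f ^+ 2 = fine (\int[mu]_(t in D) (normc (f t) ^+ 2)%:E)%E.
Proof. by rewrite /normL2 sqr_sqrtr //; apply: Rintegral_ge0 => t _; exact: normc2_ge0. Qed.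

Lemma prim_le_normL2 f t : ccont f -> L2 f -> 0 <= t -> prim (nsq f) t <= normL2 f ^+ 2.
Proof.
move=> cf Lf t0; have fin := integrable_fin_num (@measurable_half_line R) (L2_integrable Lf).
rewrite normL2_sqr -lee_fin fineK // -integral_half_line_prim //.
under eq_integral do rewrite -nsqE.
apply: ge0_subset_integral => //.
- exact: measurable_half_line.
- by have /integrableP[] := L2_integrable Lf.
- by move=> s _; rewrite lee_fin normc2_ge0.
- by move=> s; rewrite /half_line /= !in_itv /= andbT => /andP[].
Qed.

Lemma L2_prim_bounded f : ccont f -> L2 f -> exists B, forall t, 0 <= t -> prim (nsq f) t <= B.
Proof. by move=> cf Lf; exists (normL2 f ^+ 2) => t; exact: prim_le_normL2. Qed.

Lemma prim_bounded_integral f B : ccont f -> (forall n : nat, prim (nsq f) n%:R <= B) ->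
  (\int[mu]_(t in D) (normc (f t) ^+ 2)%:E <= B%:E)%E.
Proof.
move=> cf HB.
under eq_integral do rewrite nsqE.
rewrite /half_line itv_bndy_bigcup_BRight.
pose F (i : nat) : set (measurableTypeR R) := `]0, (0 + i%:R)]%classic.
have mn : measurable_fun setT (EFin \o nsq f).
  by apply/measurable_EFinP; apply: continuous_measurable_fun; exact: continuous_nsq.
have cvg : (\int[mu]_(x in F i) (nsq f x)%:E)%E @[i --> \oo] --> (\int[mu]_(x in \bigcup_i F i) (nsq f x)%:E)%E.
  apply: ge0_nondecreasing_set_cvg_integral => //.
  - by move=> i j ij; rewrite subsetEset; apply: subset_itvl; rewrite bnd_simp !add0r ler_nat.
  - by move=> i; exact: measurable_itv.
  - by move=> i; exact: measurable_funTS mn.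
  - by move=> i x _; rewrite lee_fin nsq_ge0.
have icvg := cvgP _ cvg; move/cvg_lim : cvg => /= <- //; apply: lime_le; first exact: icvg.
by apply: nearW => n; rewrite /F add0r integral_half_line_prim // lee_fin.
Qed.

Lemma prim_bounded_L2 f B : ccont f -> (forall n : nat, prim (nsq f) n%:R <= B) -> L2 f.
Proof.
move=> cf HB; split; first exact: ccont_measurable.
exact: le_lt_trans (prim_bounded_integral cf HB) (ltry B).
Qed.

Lemma prim_bounded_normL2 f B : ccont f -> (forall n : nat, prim (nsq f) n%:R <= B) ->
  normL2 f ^+ 2 <= B.
Proof.
move=> cf HB; have Lf := prim_bounded_L2 cf HB.
have fin := integrable_fin_num (@measurable_half_line R) (L2_integrable Lf).
by rewrite normL2_sqr -lee_fin fineK // prim_bounded_integral.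
Qed.

Lemma L2_ae_ccont f g : ccont g -> L2 f -> eqL2 f g -> L2 g.
Proof.
move=> cg [[m1 m2] fin] e; split; first exact: ccont_measurable.
rewrite (_ : (\int[mu]_(t in D) (normc (g t) ^+ 2)%:E)%E = (\int[mu]_(t in D) (normc (f t) ^+ 2)%:E)%E) //.
have [n1 n2] := ccont_measurable cg.
apply: ae_eq_integral => //.
- exact: measurable_half_line.
- by apply/measurable_EFinP; under eq_fun do rewrite normc2; apply: measurable_funD; exact: measurable_funX.
- by apply/measurable_EFinP; under eq_fun do rewrite normc2; apply: measurable_funD; exact: measurable_funX.
- by apply: filterS e => t H Dt; rewrite H.
Qed.

Variable p : R -> R.
Hypothesis cp : continuous p.

(** Weyl's limit point case at infinity, for all spectral parameters at once. *)
Definition limit_point := forall z s1 s1' s2 s2', fundamental p z s1 s1' s2 s2' ->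
  ~ (L2 s1 /\ L2 s2).

Definition bounded_below_often (C l : R) := 0 < l /\
  forall N : nat, exists x, N%:R <= x /\ forall t, x <= t <= x + l -> C <= p t.

(** The mass on [0, t] is nondecreasing and bounded in t, so that its increments are
    small far out. *)
Lemma prim_tail f B e l : ccont f -> (forall t, 0 <= t -> prim (nsq f) t <= B) -> 0 < e ->
  0 <= l -> exists N : nat, forall x, N%:R <= x -> prim (nsq f) (x + l) - prim (nsq f) x < e.
Proof.
move=> cf HB e0 l0; pose S := [set prim (nsq f) t | t in [set t : R | 0 <= t]].
have hS : has_sup S.
  by split; [exists (prim (nsq f) 0), 0 => //=|exists B => _ [t /= t0 <-]; exact: HB].
have [_ [t /= t0 <-] ht] := sup_adherent e0 hS.
exists (Num.bound t) => x Nx; have tx : t <= x by apply: le_trans Nx; apply/ltW/archi_boundP.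
have h1 := prim_nsq_le cf tx.
have : prim (nsq f) (x + l) <= sup S.
  by apply: ub_le_sup; [case: hS|exists (x + l) => //=; rewrite addr_ge0 // (le_trans t0)].
lra.
Qed.

Let dnsq z s s' t : csol p z s s' ->
  is_derive t 1 (nsq s) (2 * (complex.Re (s t) * complex.Re (s' t) + complex.Im (s t) * complex.Im (s' t))) /\
  is_derive t 1 (fun t => 2 * (complex.Re (s t) * complex.Re (s' t) + complex.Im (s t) * complex.Im (s' t)))
    (2 * nsq s' t + 2 * (p t - complex.Re z) * nsq s t).
Proof.
move=> h; have [[d1 d2] [d3 d4]] := h t; split.
  apply: is_derive_eq' (dAdd (dMul d1 d1) (dMul d2 d2)) _; ring.
apply: is_derive_eq' (dScale 2 (dAdd (dMul d1 d3) (dMul d2 d4))) _.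
by rewrite !ReIm /nsq /=; ring.
Qed.

Let poly_weight l x t : is_derive t 1 (fun t : R => ((t - x) * (x + l - t)) ^+ 2)
    (2 * ((t - x) * (x + l - t)) * (x + l - t - (t - x))) /\
  is_derive t 1 (fun t : R => 2 * ((t - x) * (x + l - t)) * (x + l - t - (t - x)))
    (2 * (x + l - t - (t - x)) ^+ 2 - 4 * ((t - x) * (x + l - t))).
Proof.
have d1 : is_derive t 1 (fun t : R => t - x) 1.
  by apply: is_derive_eq' (dSub (dId t) (dCst x t)) _; rewrite subr0.
have d2 : is_derive t 1 (fun t : R => x + l - t) (-1).
  by apply: is_derive_eq' (dSub (dCst (x + l) t) (dId t)) _; rewrite sub0r.
have d3 := dMul d1 d2; split.
  by apply: is_derive_eq' (dMul d3 d3) _; ring.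
by apply: is_derive_eq' (dMul (dScale 2 d3) (dSub d2 d1)) _; ring.
Qed.

(** Wronskian 1 forces |s1|^2 + |s2|^2 + |s1'|^2 + |s2'|^2 >= 2 at every point.
    On a window J where p >= C, the masses of the derivatives are controlled by
    those of the functions: h = |s|^2 satisfies h'' = 2 |s'|^2 + 2 (p - Re z) h,
    and integration against chi = ((t - x) (x + l - t))^2, which vanishes to
    second order at the ends of J, moves the derivatives to chi.  So |s1|^2 +
    |s2|^2 has mass bounded below on infinitely many windows, and s1, s2 cannot
    both be in L_2. *)
Lemma limit_point_bounded_below C l : bounded_below_often C l -> limit_point.
Proof.
move=> [l0 often] z s1 s1' s2 s2' [h1 h2 W] [L1 L2'].
have [c1 c1' _] := csol_ccont cp h1; have [c2 c2' _] := csol_ccont cp h2.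
have [B1 HB1] := L2_prim_bounded c1 L1; have [B2 HB2] := L2_prim_bounded c2 L2'.
pose K := 3 / 2 * l ^+ 2 + l ^+ 4 * `|complex.Re z - C|.
pose Q := l ^+ 4 / 2 + K / 2.
have Q0 : 0 < Q.
  by rewrite /Q /K; have := exprn_gt0 4 l0; have := exprn_gt0 2 l0 => q1 q2;
   have := mulr_ge0 (ltW q2) (normr_ge0 (complex.Re z - C)); lra.
pose e := l ^+ 5 / 30 / (2 * Q).
have e0 : 0 < e by rewrite !divr_gt0 ?exprn_gt0 ?mulr_gt0.
have [N1 T1] := prim_tail c1 HB1 e0 (ltW l0); have [N2 T2] := prim_tail c2 HB2 e0 (ltW l0).
have [x [Nx px]] := often (maxn N1 N2).
have {}T1 := T1 x (le_trans _ Nx); have {}T2 := T2 x (le_trans _ Nx).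
have {}T1 : prim (nsq s1) (x + l) - prim (nsq s1) x < e by apply: T1; rewrite ler_nat leq_maxl.
have {}T2 : prim (nsq s2) (x + l) - prim (nsq s2) x < e by apply: T2; rewrite ler_nat leq_maxr.
pose chi t := ((t - x) * (x + l - t)) ^+ 2.
pose chi' t := 2 * ((t - x) * (x + l - t)) * (x + l - t - (t - x)).
pose chi'' t := 2 * (x + l - t - (t - x)) ^+ 2 - 4 * ((t - x) * (x + l - t)).
pose hd (s s' : R -> R[i]) t := 2 * (complex.Re (s t) * complex.Re (s' t) + complex.Im (s t) * complex.Im (s' t)).
pose G s s' t := chi t * hd s s' t - chi' t * nsq s t.
have dG s s' : csol p z s s' -> forall t, is_derive t 1 (G s s')
    (chi t * (2 * nsq s' t + 2 * (p t - complex.Re z) * nsq s t) - chi'' t * nsq s t).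
  move=> h t; have [e1 e2] := dnsq t h; have [w1 w2] := poly_weight l x t.
  by apply: is_derive_eq' (dSub (dMul w1 e2) (dMul w2 e1)) _; rewrite /chi /chi' /chi''; ring.
(* the antiderivative of chi; its increment over the window is l^5 / 30 *)
pose X t := l ^+ 2 / 3 * (t - x) ^+ 3 - l / 2 * (t - x) ^+ 4 + (t - x) ^+ 5 / 5.
have dX t : is_derive t 1 X (chi t).
  have d1 : is_derive t 1 (fun t : R => t - x) 1.
    by apply: is_derive_eq' (dSub (dId t) (dCst x t)) _; rewrite subr0.
  have d2 := dMul d1 d1; have d3 := dMul d2 d1; have d4 := dMul d2 d2; have d5 := dMul d3 d2.
  rewrite (_ : X = fun t => l ^+ 2 / 3 * ((t - x) * (t - x) * (t - x)) - l / 2 * ((t - x) * (t - x) * ((t - x) * (t - x)))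
     + 5^-1 * ((t - x) * (t - x) * (t - x) * ((t - x) * (t - x)))); last by apply/funext => s; rewrite /X; ring.
  apply: is_derive_eq' (dAdd (dSub (dScale _ d3) (dScale _ d4)) (dScale _ d5)) _.
  by rewrite /chi; field.
pose Y t := Q * (prim (nsq s1) t + prim (nsq s2) t) + 4^-1 * (G s1 s1' t + G s2 s2' t).
have dY t : is_derive t 1 Y (Q * (nsq s1 t + nsq s2 t) + 4^-1 *
   ((chi t * (2 * nsq s1' t + 2 * (p t - complex.Re z) * nsq s1 t) - chi'' t * nsq s1 t) +
    (chi t * (2 * nsq s2' t + 2 * (p t - complex.Re z) * nsq s2 t) - chi'' t * nsq s2 t))).
  by apply: dAdd; apply: dScale; apply: dAdd; [exact/is_derive_prim/continuous_nsq|exact/is_derive_prim/continuous_nsq|exact: dG|exact: dG].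
have xl : x <= x + l by lra.
have := ler_increment xl (fun t _ => dX t) (fun t _ => dY t).
have G0 s s' : G s s' x = 0 /\ G s s' (x + l) = 0.
  by rewrite /G /chi /chi'; split; ring.
have -> : Y (x + l) - Y x = Q * ((prim (nsq s1) (x + l) - prim (nsq s1) x) + (prim (nsq s2) (x + l) - prim (nsq s2) x)).
  by rewrite /Y (G0 s1 s1').1 (G0 s1 s1').2 (G0 s2 s2').1 (G0 s2 s2').2; ring.
have -> : X (x + l) - X x = l ^+ 5 / 30 by rewrite /X; field.
have eQ : e * (2 * Q) = l ^+ 5 / 30 by rewrite /e divfK // gt_eqF // mulr_gt0.
move=> key; have : l ^+ 5 / 30 <= Q * ((prim (nsq s1) (x + l) - prim (nsq s1) x) + (prim (nsq s2) (x + l) - prim (nsq s2) x)).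
  apply: key => t txl; rewrite -/(chi t).
  have [a0 b0] : 0 <= t - x /\ 0 <= x + l - t by move: txl; lra.
  set n1 := nsq s1 t; set n2 := nsq s2 t; set m1 := nsq s1' t; set m2 := nsq s2' t.
  have n10 : 0 <= n1 by exact: nsq_ge0. have n20 : 0 <= n2 by exact: nsq_ge0.
  have ab : 0 <= (t - x) * (x + l - t) <= l ^+ 2 by apply/andP; split; [rewrite mulr_ge0|nra].
  have chi0 : 0 <= chi t by exact: sqr_ge0.
  have chi4 : chi t <= l ^+ 4.
    rewrite /chi (_ : l ^+ 4 = (l ^+ 2) ^+ 2); last by ring.
    by case/andP: ab => ab0 ab2; rewrite ler_sqr ?nnegrE // exprn_ge0 // ltW.
  have chi''2 : chi'' t <= 2 * l ^+ 2.
    by rewrite /chi''; case/andP: ab => ab0 _; nra.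
    (* 1 = s1 s2' - s1' s2, with the products split by 2 a b <= a^2 + b^2 *)
have one : 1 <= (n1 + n2 + m1 + m2) / 2.
    have := congr1 (@complex.Re R) (W t); rewrite !ReIm /= => e1; rewrite -[X in X <= _]e1 {e1}.
    rewrite /n1 /n2 /m1 /m2 /nsq.
    move: (complex.Re (s1 t)) (complex.Im (s1 t)) (complex.Re (s2 t)) (complex.Im (s2 t)) (complex.Re (s1' t)) (complex.Im (s1' t)) (complex.Re (s2' t)) (complex.Im (s2' t)) => a b c d a' b' c' d'.
    have := sqr_ge0 (a - c'); have := sqr_ge0 (b + d'); have := sqr_ge0 (a' + c); have := sqr_ge0 (b' - d).
    by lra.
  have pz : - `|complex.Re z - C| <= p t - complex.Re z.
    by have := px t txl; have := ler_norm (complex.Re z - C); lra.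
  have low : chi t / 2 <= Q + chi t * (p t - complex.Re z) / 2 - chi'' t / 4.
    have A0 := normr_ge0 (complex.Re z - C).
    have k1 : - (chi t * `|complex.Re z - C|) <= chi t * (p t - complex.Re z).
      by rewrite -mulrN ler_wpM2l.
    have k2 : chi t * `|complex.Re z - C| <= l ^+ 4 * `|complex.Re z - C| by rewrite ler_wpM2r.
    by rewrite /Q /K; have := sqr_ge0 l; lra.
  have st1 : chi t <= chi t * ((n1 + n2 + m1 + m2) / 2) by rewrite ler_peMr.
  have st2 := ler_wpM2r (addr_ge0 n10 n20) low.
  by lra.
have lt2 : (prim (nsq s1) (x + l) - prim (nsq s1) x) + (prim (nsq s2) (x + l) - prim (nsq s2) x) < e * 2.
  by lra.
have := ltr_pM2l Q0 ((prim (nsq s1) (x + l) - prim (nsq s1) x) + (prim (nsq s2) (x + l) - prim (nsq s2) x)) (e * 2).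
by rewrite lt2 => h1' h2'; lra.
Qed.

End LimitPoint.

(** * Square-integrable solutions *)
Section WeylSolutions.
Variable R : realType.
Notation mu := (@lebesgue_measure R).
Notation D := (half_line R).
Implicit Types (a b t : R) (f g w y : R -> R[i]).

Let ae_filter_mu : Filter (almost_everywhere mu).
Proof. exact: ae_filter_ringOfSetsType. Qed.
Existing Instance ae_filter_mu.

Variable p : R -> R.
Hypothesis cp : continuous p.

Lemma fundamental_scale z y1 y1' y2 y2' k : k != 0 -> csol p z y1 y1' -> csol p z y2 y2' ->
  (forall t, y1 t * y2' t - y1' t * y2 t = k) ->
  fundamental p z y1 y1' (fun t => k^-1 * y2 t) (fun t => k^-1 * y2' t).
Proof.
move=> k0 h1 h2 W; split => //.
  by have := csol_lin 0 k^-1 h1 h2; congr (csol _ _ _ _); apply/funext => t; rewrite mul0r add0r.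
by move=> t; rewrite -(mulVf k0) -(W t); ring.
Qed.

(** Two linearly independent L_2 solutions would, after scaling, form a
    fundamental system excluded by the limit point case. *)
Lemma has_dim_solution_line z s1 s1' s2 s2' y y' (E : set (R -> R[i])) :
  limit_point p -> fundamental p z s1 s1' s2 s2' ->
  csol p z y y' -> L2 y -> (exists t, y t != 0) -> E y ->
  (forall w, E w -> L2 w /\ exists c1 c2, eqL2 w (fun t => c1 * s1 t + c2 * s2 t)) ->
  has_dim E 1.
Proof.
move=> lp fund hy Ly [t0 yt0] Ey Esol; have [h1 h2 W] := fund.
exists (fun=> y); split => //.
- move=> c; rewrite /lin_comb => H i; rewrite (ord1 i); apply/eqP; apply: contraT => c0.
  have y0 : {ae mu, forall t, (0:R) < t < 1 -> y t = 0}.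
    apply: filterS H => t Ht /andP[t_gt0 _]; have := Ht _; rewrite big_ord1 => /(_ _)/wrap[].
      by rewrite /half_line /= in_itv /= t_gt0.
    by move/eqP; rewrite mulf_eq0 (negbTE c0) => /eqP.
  by move: yt0; rewrite (csol_ae_eq0 cp fund ltr01 hy y0) eqxx.
move=> w /Esol[Lw [c1 [c2 wE]]].
pose s t := c1 * s1 t + c2 * s2 t; pose s' t := c1 * s1' t + c2 * s2' t.
have hs : csol p z s s' by exact: csol_lin.
have Ls : L2 s by apply: L2_ae_ccont wE => //; have [] := csol_ccont cp hs.
have Wc := wronskian_cst hy hs; set k := y 0 * s' 0 - _ in Wc.
have [k0|kn0] := eqVneq k 0; last first.
  exfalso; apply: (lp _ _ _ _ _ (fundamental_scale kn0 hy hs Wc)); split => //.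
  exact: (@L2Z R k^-1 s Ls).
have [a1 [a2 [e1 e2]]] := csol_rep fund hy.
have det : a1 * c2 = a2 * c1.
  apply/eqP; rewrite -subr_eq0; apply/eqP; rewrite -k0 -(Wc 0) e1 e2 /s /s' -[LHS]mulr1 -(W 0); ring.
have [a10|a1n0] := eqVneq a1 0.
  have a2n0 : a2 != 0.
    by apply: contraNneq yt0 => a20; rewrite e1 a10 a20 !mul0r addr0.
  have c10 : c1 = 0 by apply/eqP; move/esym/eqP: det; rewrite a10 mul0r mulf_eq0 (negbTE a2n0).
  exists (fun=> c2 / a2); apply: eqL2_trans wE _; apply: aeW => t _ /=.
  by rewrite /lin_comb big_ord1 e1 a10 c10 !mul0r !add0r mulrA divfK.
exists (fun=> c1 / a1); apply: eqL2_trans wE _; apply: aeW => t _ /=.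
rewrite /lin_comb big_ord1 e1 mulrDr !mulrA divfK //; congr (_ + _ * _).
by rewrite mulrAC -[c1 * a2]mulrC -det mulrC mulKf.
Qed.

Lemma prim_unique (F f : R -> R) : continuous f -> (forall t : R, is_derive t 1 F (f t)) ->
  F 0 = 0 -> forall t, prim f t = F t.
Proof.
move=> cf dF F0 t; have := @dC_eq_cst R (fun t => (prim f t - F t)%:C).
move=> /(_ _ t)/wrap[].
  by move=> s; apply: dC_eq (dC_real (dSub (is_derive_prim s cf) (dF s))) _; rewrite subrr.
by rewrite prim0 F0 subrr => /(congr1 (@complex.Re R)) /= /eqP; rewrite subr_eq0 => /eqP.
Qed.

Let nsq_comb (c1 c2 : R[i]) f g t : nsq (fun t => c1 * f t + c2 * g t) t =
  normc c1 ^+ 2 * nsq f t + normc c2 ^+ 2 * nsq g t +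
  2 * (complex.Re (c1 * conjc c2) * complex.Re (f t * conjc (g t)) - complex.Im (c1 * conjc c2) * complex.Im (f t * conjc (g t))).
Proof. by rewrite /nsq !normc2 !ReIm; ring. Qed.

Let prim_nsq_comb (c1 c2 : R[i]) f g t : ccont f -> ccont g ->
  prim (nsq (fun t => c1 * f t + c2 * g t)) t =
  normc c1 ^+ 2 * prim (nsq f) t + normc c2 ^+ 2 * prim (nsq g) t +
  2 * (complex.Re (c1 * conjc c2) * prim (fun t => complex.Re (f t * conjc (g t))) t -
       complex.Im (c1 * conjc c2) * prim (fun t => complex.Im (f t * conjc (g t))) t).
Proof.
move=> cf cg; have nf := continuous_nsq cf; have ng := continuous_nsq cg.
have [f1 f2] := cf; have [g1 g2] := cg.
have kR : continuous (fun t => complex.Re (f t * conjc (g t))).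
  under eq_fun do rewrite !ReIm mulrN opprK.
  by move=> s; apply: cvgD; apply: cvgM; [exact: f1|exact: g1|exact: f2|exact: g2].
have kI : continuous (fun t => complex.Im (f t * conjc (g t))).
  under eq_fun do rewrite !ReIm mulrN addrC.
  by move=> s; apply: cvgB; apply: cvgM; [exact: f2|exact: g1|exact: f1|exact: g2].
apply: (prim_unique (F := fun t => normc c1 ^+ 2 * prim (nsq f) t + normc c2 ^+ 2 * prim (nsq g) t +
  2 * (complex.Re (c1 * conjc c2) * prim (fun t => complex.Re (f t * conjc (g t))) t -
       complex.Im (c1 * conjc c2) * prim (fun t => complex.Im (f t * conjc (g t))) t))).
- have E := funext (nsq_comb c1 c2 f g); rewrite E => s.
  have cc (c : R) : (fun=> c) @ s --> c by exact: cvg_cst.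
  apply: cvgD; first by apply: cvgD; apply: cvgM => //; [exact: nf|exact: ng].
  by apply: cvgM => //; apply: cvgB; apply: cvgM => //; [exact: kR|exact: kI].
- move=> s; rewrite nsq_comb; apply: dAdd; first by apply: dAdd; apply: dScale; exact: is_derive_prim.
  by apply: dScale; apply: dSub; apply: dScale; exact: is_derive_prim.
- by rewrite !prim0; ring.
Qed.

(** The unit sphere of coefficients is compact: a cluster point of the
    normalized coefficients for N = 0, 1, 2... gives a solution with mass at most
    B on every [0, N], since the mass grows with N and is continuous in the
    coefficients.  The coefficients are taken in R^4, and q M v is the mass on
    [0, M] as a quadratic form. *)
Lemma exists_L2_csol z s1 s1' s2 s2' (B : R) : fundamental p z s1 s1' s2 s2' ->
  (forall N : nat, exists c1 c2, normc c1 ^+ 2 + normc c2 ^+ 2 = 1 /\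
     prim (nsq (fun t => c1 * s1 t + c2 * s2 t)) N%:R <= B) ->
  exists y y', [/\ csol p z y y', L2 y & exists t, y t != 0].
Proof.
move=> fund H; have [h1 h2 W] := fund.
have [cc1 cc1' _] := csol_ccont cp h1; have [cc2 cc2' _] := csol_ccont cp h2.
pose comb (v : 'rV[R]_4) t : R[i] := (v 0 (inord 0) +i* v 0 (inord 1)) * s1 t + (v 0 (inord 2) +i* v 0 (inord 3)) * s2 t.
pose x (i : nat) (v : 'rV[R]_4) : R := v 0 (inord i).
pose q M (v : 'rV[R]_4) := (x 0%N v ^+ 2 + x 1%N v ^+ 2) * prim (nsq s1) M + (x 2%N v ^+ 2 + x 3%N v ^+ 2) * prim (nsq s2) M +
  2 * ((x 0%N v * x 2%N v + x 1%N v * x 3%N v) * prim (fun t => complex.Re (s1 t * conjc (s2 t))) M -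
       (x 1%N v * x 2%N v - x 0%N v * x 3%N v) * prim (fun t => complex.Im (s1 t * conjc (s2 t))) M).
pose n2 v := x 0%N v ^+ 2 + x 1%N v ^+ 2 + (x 2%N v ^+ 2 + x 3%N v ^+ 2).
have qE M v : prim (nsq (comb v)) M = q M v.
  by rewrite prim_nsq_comb // /q !normc2 !ReIm /= /x; ring.
have cx i : continuous (x i) by move=> v; exact: coord_continuous.
have cc (c : R) : continuous (fun _ : 'rV[R]_4 => c) by exact: cst_continuous.
have cM (f g : 'rV[R]_4 -> R) : continuous f -> continuous g -> continuous (fun v => f v * g v).
  by move=> cf cg v; exact: (cvgM (cf v) (cg v)).
have cD (f g : 'rV[R]_4 -> R) : continuous f -> continuous g -> continuous (fun v => f v + g v).
  by move=> cf cg v; exact: (cvgD (cf v) (cg v)).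
have cB (f g : 'rV[R]_4 -> R) : continuous f -> continuous g -> continuous (fun v => f v - g v).
  by move=> cf cg v; exact: (cvgB (cf v) (cg v)).
have cq M : continuous (q M).
  apply: (cD _ _ (cD _ _ (cM _ _ (cD _ _ _ _) _) (cM _ _ (cD _ _ _ _) _)) (cM _ _ _ (cB _ _ (cM _ _ (cD _ _ _ _) _) (cM _ _ (cB _ _ _ _) _))));
    by [exact: (cM _ _ (cx _) (cx _))|exact: cc].
have cn2 : continuous n2.
  exact: (cD _ _ (cD _ _ (cM _ _ (cx _) (cx _)) (cM _ _ (cx _) (cx _))) (cD _ _ (cM _ _ (cx _) (cx _)) (cM _ _ (cx _) (cx _)))).
have [v Hv] : exists v : nat -> 'rV[R]_4, forall N, n2 (v N) = 1 /\ q N%:R (v N) <= B.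
  have H' N : exists v, n2 v = 1 /\ q N%:R v <= B.
    have [c1 [c2 [nc Hc]]] := H N.
    pose w : 'rV[R]_4 := \row_i nth 0 [:: complex.Re c1; complex.Im c1; complex.Re c2; complex.Im c2] i.
    exists w; have E : comb w = fun t => c1 * s1 t + c2 * s2 t.
      by apply/funext => t; rewrite /comb /w !mxE !inordK //=; congr (_ * _ + _ * _); exact: complexP.
    rewrite -qE E; split => //.
    by rewrite -nc !normc2 /n2 /x /w !mxE !inordK.
  by have [v Hv] := choice H'; exists v.
have K : compact [set v : 'rV[R]_4 | forall i, `[(-1 : R), 1]%classic (v ord0 i)].
  exact: (@rV_compact R 4 (fun=> `[(-1 : R), 1]%classic) (fun=> @segment_compact R (-1) 1)).
have inK N : forall i, `[(-1 : R), 1]%classic (v N ord0 i).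
  have [nv _] := Hv N; have le1 (i : nat) : x i (v N) ^+ 2 <= 1 -> -1 <= x i (v N) <= 1.
    by move=> h; rewrite -ler_norml -ler_sqr ?nnegrE // real_normK ?num_real // expr1n.
  have sq i := sqr_ge0 (x i (v N)).
  move=> i /=; rewrite in_itv /=; have -> : v N ord0 i = x i (v N) by rewrite /x inord_val.
  apply: le1; rewrite -nv /n2; have := sq 0%N; have := sq 1%N; have := sq 2%N; have := sq 3%N.
  by case: i => -[|[|[|[|i]]]] //= _; lra.
have [u [_ clu]] : [set v : 'rV[R]_4 | forall i, `[(-1 : R), 1]%classic (v ord0 i)] `&` cluster (v @ \oo) !=set0.
  by apply: K; exists 0%N => // N _; exact: inK.
have clC (C : set 'rV[R]_4) N : closed C -> (forall n, (N <= n)%N -> C (v n)) -> C u.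
  move=> cC Cn; rewrite (closure_id C).1 // => A nA; apply: clu => //.
  by exists N => // n /= /Cn.
have nu : n2 u = 1.
  apply: (clC [set v | n2 v = 1] 0%N) => [|n _]; last by case: (Hv n).
  by apply: (closed_comp (f := n2) (D := [set 1 : R])) => // ? _; exact: cn2.
have qu (M : nat) : q M%:R u <= B.
  apply: (clC [set v | q M%:R v <= B] M) => [|n Mn].
    by apply: (closed_comp (f := q M%:R) (D := [set r | r <= B])) => // ? _; exact: cq.
  have [_] := Hv n; apply: le_trans; rewrite -!qE; apply: prim_nsq_le; last by rewrite ler_nat.
  by have [] := csol_ccont cp (csol_lin (v n 0 (inord 0) +i* v n 0 (inord 1)) (v n 0 (inord 2) +i* v n 0 (inord 3)) h1 h2).
have hc := csol_lin (u 0 (inord 0) +i* u 0 (inord 1)) (u 0 (inord 2) +i* u 0 (inord 3)) h1 h2.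
exists (comb u); eexists; split; [exact: hc| |].
  have [cu _ _] := csol_ccont cp hc.
  by apply: (@prim_bounded_L2 _ (comb u) B cu) => n; rewrite qE.
apply: contrapT => /forallNP z0; have [|c10 c20] := @comb_ae_eq0 R p cp z s1 s1' s2 s2' fund 0 1
  (u 0 (inord 0) +i* u 0 (inord 1)) (u 0 (inord 2) +i* u 0 (inord 3)) ltr01.
  by apply: aeW => t _; apply: contrapT => /eqP; exact: z0.
move: nu; rewrite /n2 /x; case: c10 c20 => -> -> [-> ->].
by rewrite !expr0n /= !addr0 => /esym/eqP; rewrite oner_eq0.
Qed.

(** Im (y' \bar y) has derivative - Im z |y|^2. *)
Lemma csol_mass_identity z y y' T : csol p z y y' ->
  let F t := complex.Im (y' t) * complex.Re (y t) - complex.Re (y' t) * complex.Im (y t) in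
  - complex.Im z * prim (nsq y) T = F T - F 0.
Proof.
move=> hy F; have cy : ccont y by have [] := csol_ccont cp hy.
have dF t : is_derive t 1 F (- complex.Im z * nsq y t).
  have [[d1 d2] [d3 d4]] := hy t.
  apply: is_derive_eq' (dSub (dMul d4 d1) (dMul d3 d2)) _.
  by rewrite !ReIm /nsq /=; ring.
have cn : continuous (fun t => - complex.Im z * nsq y t).
  by move=> s; apply: cvgM; [exact: cvg_cst|exact: continuous_nsq].
have dF0 t : is_derive t 1 (fun t => F t - F 0) (- complex.Im z * nsq y t).
  by apply: is_derive_eq' (dSub (dF t) (dCst (F 0) t)) _; rewrite subr0.
rewrite -(prim_unique cn dF0 (subrr _)); apply/esym; apply: (@prim_unique (fun t => - complex.Im z * prim (nsq y) t)).
- exact: cn.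
- by move=> s; apply: dScale; apply: is_derive_prim; exact: continuous_nsq.
- by rewrite prim0 mulr0.
Qed.

(** Weyl's argument: the mass on [0, N] of the solution that vanishes at N is
    Im (y' \bar y) (0) / Im z, which is bounded in terms of the initial data. *)
Lemma exists_L2_csol_nonreal z : complex.Im z != 0 ->
  exists y y', [/\ csol p z y y', L2 y & exists t, y t != 0].
Proof.
move=> z0; have [s1 [s1' [h1 a1 b1]]] := exists_csol cp z 1 0.
have [s2 [s2' [h2 a2 b2]]] := exists_csol cp z 0 1.
have fund : fundamental p z s1 s1' s2 s2'.
  by split => // t; rewrite (wronskian_cst h1 h2) a1 b1 a2 b2; ring.
have [_ _ W] := fund.
apply: (exists_L2_csol (B := `|complex.Im z|^-1) fund) => N; set T : R := N%:R.
have T0 : 0 <= T by rewrite /T ler0n.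
pose m := normc (s1 T) ^+ 2 + normc (s2 T) ^+ 2.
have m0 : 0 < m.
  rewrite lt_neqAle addr_ge0 ?normc2_ge0 // andbT eq_sym; apply/eqP => /eqP.
  rewrite /m paddr_eq0 ?normc2_ge0 // !normc2 !paddr_eq0 ?sqr_ge0 // !sqrf_eq0.
  move=> /andP[/andP[/eqP r1 /eqP i1] /andP[/eqP r2 /eqP i2]].
  have := congr1 (@complex.Re R) (W T); rewrite !ReIm r1 i1 r2 i2 /= => /esym/eqP.
  by rewrite !mul0r !mulr0 !subr0 oner_eq0.
pose k := (Num.sqrt m)^-1; have k0 : 0 < k by rewrite invr_gt0 sqrtr_gt0.
have km : k ^+ 2 * m = 1 by rewrite /k exprVn sqr_sqrtr ?mulVf ?gt_eqF // ltW.
exists (k%:C * s2 T), (- k%:C * s1 T).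
have nm : normc (k%:C * s2 T) ^+ 2 + normc (- k%:C * s1 T) ^+ 2 = 1.
  by rewrite -km /m !normc2 !ReIm /=; ring.
split => //; set c1 := k%:C * _ in nm *; set c2 := - k%:C * _ in nm *.
pose y t := c1 * s1 t + c2 * s2 t; pose y' t := c1 * s1' t + c2 * s2' t.
have hy : csol p z y y' by exact: csol_lin.
have yT : y T = 0 by rewrite /y /c1 /c2; ring.
have cy : ccont y by have [] := csol_ccont cp hy.
pose F t := complex.Im (y' t) * complex.Re (y t) - complex.Re (y' t) * complex.Im (y t).
have E : - complex.Im z * prim (nsq y) T = F T - F 0 by exact: csol_mass_identity.
have FT : F T = 0 by rewrite /F yT /= !mulr0 subrr.
have F0 : `|F 0| <= 1.
  rewrite /F /y /y' a1 a2 b1 b2 !mulr0 !mulr1 add0r addr0 ler_norml; move: nm; rewrite !normc2.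
  move: (complex.Re c1) (complex.Im c1) (complex.Re c2) (complex.Im c2) => r1 i1 r2 i2 nm.
  have := sqr_ge0 (i2 - r1); have := sqr_ge0 (i2 + r1); have := sqr_ge0 (r2 - i1); have := sqr_ge0 (r2 + i1).
  lra.
have P0 : 0 <= prim (nsq y) T by have := prim_nsq_le cy T0; rewrite prim0.
rewrite -[leRHS]mul1r ler_pdivlMr ?normr_gt0 //.
by rewrite -(ger0_norm P0) -normrM mulrC -normrN -mulNr E FT sub0r normrN.
Qed.

End WeylSolutions.

(** * Points of the spectrum near an approximate eigenvalue *)
Section SpectralPerturbation.
Variable R : realType.
Notation D := (half_line R).
Implicit Types (u v f g h : R -> R[i]) (A : graph R).

Lemma normL2_lin_le c f g : L2 f -> L2 g ->
  normL2 (fun t => c * f t + g t) <= normc c * normL2 f + normL2 g.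
Proof.
move=> Lf Lg; rewrite -(normL2Z c Lf); apply: normL2_triangle => //; exact: L2Z.
Qed.

Lemma self_adjoint_symmetric A u f v g : self_adjoint A -> A (u, f) -> A (v, g) ->
  innerL2 f v = innerL2 u g.
Proof. by move=> [_ _ AE] Auf; rewrite {1}AE => -[_ _]; exact. Qed.

Definition shift (e : R) u f : R -> R[i] := f \- (e%:C \*o u).

Lemma L2_shift e u f : L2 u -> L2 f -> L2 (shift e u f).
Proof. by move=> Lu Lf; apply: L2B => //; exact: L2Z. Qed.

Lemma normc_real (x : R) : normc x%:C = `|x|.
Proof. by rewrite /= expr0n /= addr0 sqrtr_sqr. Qed.

(** With i = 1 / a these are the two pointwise identities behind the
    factorization B^2 - a^2 = (B - a) (B + a) for B = (A - e)^-1, read on the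
    graph of A: v1 = B (g1 - e v1), v2 = B v1, and a v1 + v2 is what B + a makes
    of v1. *)
Lemma shift_sum (a i e v1 g1 v2 g2 : R[i]) : i * a = 1 -> g2 - e * v2 = v1 ->
  a * g1 + g2 - (e + i) * (a * v1 + v2) = - i * (- a ^+ 2 * (g1 - e * v1) + v2).
Proof.
move=> ia s2; have -> : g2 = v1 + e * v2 by rewrite -s2; ring.
have -> : a * g1 + (v1 + e * v2) - (e + i) * (a * v1 + v2) =
  a * (g1 - e * v1) + v1 - i * a * v1 - i * v2 by ring.
have -> : - i * (- a ^+ 2 * (g1 - e * v1) + v2) = i * a * a * (g1 - e * v1) - i * v2 by ring.
by rewrite ia; ring.
Qed.

Lemma shift_diff (a i e v1 g1 v2 g2 : R[i]) : i * a = 1 -> g2 - e * v2 = v1 ->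
  a * (g1 - (e - i) * v1) = i * (a * v1 + v2) + (a * g1 + g2 - (e + i) * (a * v1 + v2)).
Proof.
move=> ia s2; have -> : g2 = v1 + e * v2 by rewrite -s2; ring.
have -> : a * (g1 - (e - i) * v1) = a * (g1 - e * v1) + i * a * v1 by ring.
by rewrite ia; ring.
Qed.

(** A bounded symmetric operator B has one of M, - M in its spectrum, M being its
    norm, because |B f| close to M |f| forces (B^2 - M^2) f to be small.  Applied
    to B = (A - e)^-1, whose norm is at least 1 / r, this gives a point of the
    spectrum of A at distance 1 / M of e.  All is expressed by pairs of the graph
    of A: M is the supremum of |v| over the pairs (v, g) with |g - e v| <= 1, and
    if e + 1 / M and e - 1 / M were both in the resolvent set, a pair with |v|
    close to M would be estimated by the small vector (B^2 - M^2) f. *)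
Lemma spectrum_near_approximate_eigenvalue A u f (e r : R) : self_adjoint A -> A (u, f) ->
  0 < normL2 u -> normL2 (shift e u f) <= r * normL2 u ->
  exists w : R, `|w - e| <= r /\ spectrum A w%:C.
Proof.
move=> sA Auf u0 ufr; apply: contrapT => /forallNP noS.
have [[AL _ A0 Alin _] _ _] := sA.
have r0 : 0 <= r by have := le_trans (normL2_ge0 _) ufr; rewrite pmulr_lge0.
have res w : `|w - e| <= r -> resolvent_set A w%:C.
  by move=> h; have := noS w => /not_andP[//|]; exact: contrapT.
have [_ surj [M0 HM0]] : resolvent_set A e%:C by apply: res; rewrite subrr normr0.
have AZ c v g : A (v, g) -> A (c \*o v, c \*o g).
  move=> Avg; have := Alin c v g (fun=> 0) (fun=> 0) Avg A0.
  by congr (A (_, _)); apply/funext => t /=; rewrite addr0.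
pose S := [set x | exists v g, [/\ A (v, g), normL2 (shift e v g) <= 1 & x = normL2 v]].
have S0 : S !=set0.
  exists (normL2 (fun _ : R => 0 : R[i])), (fun=> 0), (fun=> 0); split => //.
  have -> : shift e (fun=> 0) (fun=> 0) = fun=> 0 by apply/funext => t; rewrite /shift /= mulr0 subr0.
  have : innerL2 (fun=> 0 : R[i]) (fun _ : R => 0) = 0 by exact: innerL20l.
  by rewrite innerL2_self => /(congr1 (@complex.Re R)) /= /eqP; rewrite sqrf_eq0 => /eqP ->.
have ubS : has_ubound S.
  exists `|M0| => _ [v [g [Avg n1 ->]]]; apply: le_trans (HM0 v g Avg) _.
  apply: (@le_trans _ _ (`|M0| * normL2 (shift e v g))).
    by rewrite ler_wpM2r ?normL2_ge0 // ler_norm.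
  by rewrite -[leRHS]mulr1 ler_wpM2l.
pose M := sup S.
have MB v g : A (v, g) -> normL2 v <= M * normL2 (shift e v g).
  move=> Avg; have [Lv Lg] := AL _ _ Avg; have [n0|n0] := eqVneq (normL2 (shift e v g)) 0.
    by have := HM0 v g Avg; rewrite -/(shift e v g) n0 !mulr0.
  have np : 0 < normL2 (shift e v g) by rewrite lt_neqAle eq_sym n0 normL2_ge0.
  set n := normL2 (shift e v g) in n0 np *.
  have Ls := L2_shift e Lv Lg.
  have : S (normL2 (n^-1%:C \*o v)).
    exists (n^-1%:C \*o v), (n^-1%:C \*o g); split => //; first exact: AZ.
    have -> : shift e (n^-1%:C \*o v) (n^-1%:C \*o g) = n^-1%:C \*o shift e v g.
      by apply/funext => t; rewrite /shift /=; ring.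
    by rewrite normL2Z // normc_real gtr0_norm ?invr_gt0 // mulVf.
  move=> /(ub_le_sup ubS); rewrite -/M normL2Z // normc_real gtr0_norm ?invr_gt0 //.
  by rewrite mulrC ler_pdivrMr.
have M_ge0 : 0 <= M.
  have [x Sx] := S0; have [v [g [_ _ xE]]] := Sx.
  by apply: le_trans (ub_le_sup ubS Sx); rewrite xE normL2_ge0.
have Mr : 1 <= M * r.
  have h : normL2 u <= M * (r * normL2 u).
    by apply: le_trans (MB u f Auf) _; apply: ler_wpM2l.
  by rewrite -(ler_pM2r u0) mul1r -mulrA.
have Mp : 0 < M by rewrite ltNge; apply/negP => M0'; have := mulr_ge0_le0 r0 M0'; rewrite mulrC; lra.
have [_ _ [Cp HCp]] : resolvent_set A (e + M^-1)%:C.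
  by apply: res; rewrite addrAC subrr add0r gtr0_norm ?invr_gt0 // -(ler_pM2l Mp) mulfV ?gt_eqF.
have [_ _ [Cm HCm]] : resolvent_set A (e - M^-1)%:C.
  by apply: res; rewrite addrAC subrr add0r normrN gtr0_norm ?invr_gt0 // -(ler_pM2l Mp) mulfV ?gt_eqF.
pose C1 := 1 + `|Cp| + `|Cm|.
have C11 : 1 <= C1 by rewrite /C1 -addrA lerDl addr_ge0.
(* x is the norm of (B^2 - M^2) f for a pair (v1, g1) with |v1| > M - eta and
   f = g1 - e v1; the last inequality composes the bounds of the two resolvents *)
have key eta : 0 < eta -> exists x, 0 <= x /\ x ^+ 2 <= 2 * M ^+ 3 * eta /\
    M - eta <= C1 / M * (x / M + C1 * (x / M) / M).
  move=> eta0; have [_ [v1 [g1 [A1 n1 ->]]] v1M] := sup_adherent eta0 (conj S0 ubS).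
  have [L1 Lg1] := AL _ _ A1; pose f1 := shift e v1 g1; have Lf1 : L2 f1 := L2_shift e L1 Lg1.
  have [v2 [g2 [A2 e2]]] := surj v1 L1; have [L2' Lg2] := AL _ _ A2.
  have v1leM : normL2 v1 <= M by apply: ub_le_sup => //; exists v1, g1.
  have Ls2 := L2_shift e L2' Lg2.
  have nv2 : normL2 v2 <= M * normL2 v1.
    by rewrite -(eqL2_norm Ls2 L1 e2); exact: MB.
  have ip : innerL2 f1 v2 = (normL2 v1 ^+ 2)%:C.
    rewrite -innerL2_self.
    have -> : f1 = fun t => - e%:C * v1 t + g1 t by apply/funext => t; rewrite /f1 /shift /=; ring.
    rewrite innerL2_lin // (self_adjoint_symmetric sA A1 A2).
    rewrite -(eqL2_inner L1 L1 Ls2 L1 (eqL2_refl _) e2).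
    have -> : shift e v2 g2 = fun t => - e%:C * v2 t + g2 t by apply/funext => t; rewrite /shift /=; ring.
    rewrite innerL2_linr //; congr (_ * _ + _); apply: complexP; rewrite !ReIm /=; ring.
  pose X := fun t => (- M ^+ 2)%:C * f1 t + v2 t; have LX : L2 X by exact: L2_lin.
  exists (normL2 X); split; first exact: normL2_ge0.
  split.
    rewrite normL2_sqr_lin // ip !normc2 /=.
    have := sqr_ge0 M; have n1' : normL2 f1 ^+ 2 <= 1 by rewrite expr_le1 // normL2_ge0.
    have h1 := ler_wpM2l (exprn_ge0 4 (ltW Mp)) n1'.
    have h2 : normL2 v2 ^+ 2 <= M ^+ 2 * normL2 v1 ^+ 2.
      by rewrite -exprMn ler_sqr ?nnegrE ?normL2_ge0 // mulr_ge0 ?normL2_ge0 // ltW.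
    have h3 : M ^+ 2 * (M ^+ 2 - normL2 v1 ^+ 2) <= M ^+ 2 * (2 * M * eta).
      rewrite ler_wpM2l ?sqr_ge0 //; have := normL2_ge0 v1; move: v1M v1leM; rewrite -/M; nra.
    by move=> _; lra.
  pose w := (M%:C \*o v1) \+ v2; pose gw := (M%:C \*o g1) \+ g2.
  have Aw : A (w, gw) by exact: Alin.
  have [Lw Lgw] := AL _ _ Aw.
  have MC0 : M%:C != 0 :> R[i] by apply/eqP => /(congr1 (@complex.Re R)) /=; lra.
  have invM : (M^-1)%:C * M%:C = 1 :> R[i] by rewrite -rmorphM /= mulVf ?gt_eqF.
  have s1 : normL2 (shift (e + M^-1) w gw) = normL2 X / M.
    have Ly : L2 ((- M^-1)%:C \*o X) by exact: L2Z.
    have -> : normL2 X / M = normL2 ((- M^-1)%:C \*o X).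
      by rewrite normL2Z // normc_real normrN gtr0_norm ?invr_gt0 // mulrC.
    apply: eqL2_norm => //; first exact: L2_shift.
    apply: filterS e2 => t e2t Dt; rewrite /w /gw /f1 /shift /X /= !raddfN /= !rmorphD /= rmorphXn /=.
    by apply: shift_sum => //; exact: e2t.
  have nw : normL2 w <= C1 * (normL2 X / M).
    apply: le_trans (HCp _ _ Aw) _; rewrite -/(shift _ _ _) s1 ler_wpM2r //.
      by rewrite divr_ge0 ?normL2_ge0 // ltW.
    by rewrite /C1; have := ler_norm Cp; have := normr_ge0 Cm; lra.
  have s2 : M * normL2 (shift (e - M^-1) v1 g1) <= normL2 X / M + C1 * (normL2 X / M) / M.
    have Lq := L2_shift (e - M^-1) L1 Lg1; have Lp := L2_shift (e + M^-1) Lw Lgw.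
    have -> : M * normL2 (shift (e - M^-1) v1 g1) = normL2 (M%:C \*o shift (e - M^-1) v1 g1).
      by rewrite normL2Z // normc_real gtr0_norm.
    have -> : normL2 (M%:C \*o shift (e - M^-1) v1 g1) =
        normL2 (fun t => (M^-1)%:C * w t + shift (e + M^-1) w gw t).
      apply: eqL2_norm; [exact: L2Z|exact: L2_lin|].
      apply: filterS e2 => t e2t Dt; rewrite /w /gw /f1 /shift /= rmorphB rmorphD /=.
      by apply: shift_diff => //; exact: e2t.
    apply: le_trans (normL2_lin_le _ Lw Lp) _; rewrite normc_real gtr0_norm ?invr_gt0 // s1 addrC.
    by rewrite lerD2l mulrC ler_wpM2r // invr_ge0 ltW.
  have s3 : normL2 v1 <= C1 * normL2 (shift (e - M^-1) v1 g1).
    apply: le_trans (HCm _ _ A1) _; rewrite ler_wpM2r ?normL2_ge0 //.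
    by rewrite /C1; have := ler_norm Cm; have := normr_ge0 Cp; lra.
  apply: le_trans (ltW v1M) _; apply: le_trans s3 _.
  rewrite -mulrA ler_wpM2l //; first by lra.
  by rewrite -(ler_pM2l Mp) mulrA mulfV ?gt_eqF // mul1r.
(* K x is the last bound of key; this eta makes K x smaller than M / 2 *)
pose K := C1 / M * (M^-1 + C1 / M / M).
have K0 : 0 <= K by rewrite /K mulr_ge0 ?addr_ge0 ?divr_ge0 ?invr_ge0 //; lra.
have dp : 0 < 2 + 16 * K ^+ 2 * M ^+ 2 by have := sqr_ge0 (K * M); rewrite exprMn; lra.
have [] := key (M / (2 + 16 * K ^+ 2 * M ^+ 2)); first exact: divr_gt0.
set eta := M / _ => x [x0 [x2 xM]].
have etaE : eta * (2 + 16 * K ^+ 2 * M ^+ 2) = M by rewrite /eta divfK ?gt_eqF.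
have eta0 : 0 < eta by exact: divr_gt0.
have {}xM : M - eta <= K * x by apply: le_trans xM _; apply: le_of_eq; rewrite /K; ring.
have KM := sqr_ge0 (K * M); rewrite exprMn in KM.
have etaM : 2 * eta <= M by nra.
have h1 : M / 2 <= K * x by lra.
have h2 : (M / 2) ^+ 2 <= (K * x) ^+ 2 by apply: lerXn2r h1; rewrite nnegrE; [lra|exact: mulr_ge0].
have h3 : K ^+ 2 * x ^+ 2 <= K ^+ 2 * (2 * M ^+ 3 * eta) by rewrite ler_wpM2l ?sqr_ge0.
have h4 : 8 * K ^+ 2 * M ^+ 2 * eta < M by nra.
have h5 : 8 * K ^+ 2 * M ^+ 2 * eta * M ^+ 2 < M * M ^+ 2 by rewrite ltr_pM2r ?exprn_gt0.
move: h2 h3 h4 h5; rewrite exprMn; nra.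
Qed.

Lemma accumulation_essential A (e : R) : spectrum A e%:C ->
  (forall eta : R, 0 < eta -> exists w : R, [/\ w != e, `|w - e| < eta & spectrum A w%:C]) ->
  essential_spectrum A e%:C.
Proof.
move=> sp acc; split => // -[[_ [eta [eta0 iso]]] _ _].
have [w [we wn sw]] := acc eta eta0.
have := iso _ sw; rewrite -rmorphB normc_real => /(_ wn) /(congr1 (@complex.Re R)) /= wE.
by rewrite wE eqxx in we.
Qed.

(** The quasi-mode at e only gives a point of the spectrum within r of e; since
    r < |e - l| that point is not l, so l is a limit of other points of the
    spectrum, hence is not isolated. *)
Lemma essential_spectrum_quasimodes A (l : R) : self_adjoint A ->
  (forall eta : R, 0 < eta -> exists u f (e r : R), [/\ A (u, f), 0 < normL2 u,
     normL2 (shift e u f) <= r * normL2 u, r < `|e - l| & `|e - l| + r < eta]) ->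
  essential_spectrum A l%:C.
Proof.
move=> sA qm; have [[AL _ _ _ _] _ _] := sA; apply: accumulation_essential.
  move=> [_ _ [M HM]]; have M1 : 0 < `|M| + 1 by have := normr_ge0 M; lra.
  have [] := qm (`|M| + 1)^-1; first by rewrite invr_gt0.
  move=> u [f [e [r [Auf u0 ufr rel re]]]]; have [Lu Lf] := AL _ _ Auf.
  have h1 := HM _ _ Auf; rewrite -/(shift _ _ _) in h1.
  have h2 : normL2 (shift l u f) <= `|e - l| * normL2 u + normL2 (shift e u f).
    rewrite -normc_real; apply: le_trans (_ : _ <= normL2 (fun t => (e - l)%:C * u t + shift e u f t)) _.
      apply: le_of_eq; congr normL2; apply/funext => t; rewrite /shift /= rmorphB /=; ring.
    by apply: normL2_lin_le => //; exact: L2_shift.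
  have h3 : normL2 u <= `|M| * normL2 (shift l u f).
    by apply: le_trans h1 _; rewrite ler_wpM2r ?normL2_ge0 ?ler_norm.
  have h4 : (`|M| + 1) * (`|e - l| + r) < 1 by rewrite mulrC -ltr_pdivlMr // div1r.
  have h5 := ler_wpM2l (normr_ge0 M) (le_trans h2 (lerD (lexx _) ufr)).
  have h6 : (`|M| + 1) * (`|e - l| + r) * normL2 u < 1 * normL2 u by rewrite ltr_pM2r.
  have h7 : 0 <= `|e - l| + r.
    have := le_trans (normL2_ge0 _) ufr; rewrite pmulr_lge0 // => r0.
    by have := normr_ge0 (e - l); lra.
  have := mulr_ge0 h7 (ltW u0); lra.
move=> eta eta0; have [u [f [e [r [Auf u0 ufr rel re]]]]] := qm eta eta0.
have [w [wr sw]] := spectrum_near_approximate_eigenvalue sA Auf u0 ufr.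
exists w; split => //.
  by apply/eqP => wl; move: wr; rewrite wl distrC leNgt rel.
by have := ler_distD e w l; lra.
Qed.

End SpectralPerturbation.

(** * Real functions with compact support *)
Section RealTestFunctions.
Variables (R : realType) (p : R -> R).
Hypothesis cp : continuous p.

Lemma nsq_real (u : R -> R) : nsq (fun t => (u t)%:C) = fun t => u t ^+ 2.
Proof. by apply/funext => t; rewrite /nsq /= expr0n addr0. Qed.

Lemma ccont_real (u : R -> R) : continuous u -> ccont (fun t => (u t)%:C).
Proof. by move=> cu; split => //= t; exact: cvg_cst. Qed.

Lemma L2_real_support (f : R -> R) a b : continuous f -> (forall t, t < a \/ b < t -> f t = 0) ->
  L2 (fun t => (f t)%:C).
Proof.
move=> cf out; rewrite (_ : (fun t => _) = cut a b (fun t => (f t)%:C)).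
  exact/L2_cut_ccont/ccont_real.
apply/funext => t; have [tab|tab] := boolP (a <= t <= b); first by rewrite cut_in.
rewrite cut_out //; move: tab; rewrite negb_and -!ltNge => /orP h.
by rewrite out.
Qed.

Lemma real_test_function (u u1 u2 : R -> R) a b : (forall t : R, is_derive t 1 u (u1 t)) ->
  (forall t : R, is_derive t 1 u1 (u2 t)) -> continuous u2 -> 0 < a -> a <= b ->
  (forall t, t < a \/ b < t -> u t = 0 /\ u2 t = 0) ->
  minimal_operator p (fun t => (u t)%:C, fun t => (- u2 t + p t * u t)%:C).
Proof.
move=> du du1 cu2 a0 ab out; apply: restriction_minimal.
have cu : continuous u by move=> t; exact: is_derive_continuous (du t).
have dcu t : dC (fun t => (u t)%:C) t (u1 t)%:C by exact: dC_real.
have dcu1 t : dC (fun t => (u1 t)%:C) t (u2 t)%:C by exact: dC_real.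
have Du : derivC (fun t => (u t)%:C) = fun t => (u1 t)%:C.
  by apply/funext => t; exact: dC_derivC.
have cu1 : continuous u1 by move=> t; exact: is_derive_continuous (du1 t).
split => /=.
- by apply: (@L2_real_support u a b) => // t /out[].
- apply: (@L2_real_support (fun t => - u2 t + p t * u t) a b).
    move=> t; apply: cvgD; first by apply: cvgN; exact: cu2.
    by apply: cvgM; [exact: cp|exact: cu].
  by move=> t /out[-> ->]; rewrite mulr0 oppr0 addr0.
- exists (fun t => (u t)%:C); split; [split; [split|]|exact: eqL2_refl|].
  + by move=> t _; exact: dC_derivableC (dcu t).
  + move=> x y _ _; apply/abs_continuous_cac; apply: (@dC_cac R x y _ (fun t => (u1 t)%:C)) => //.
    exact: ccont_real.
  + rewrite Du => x y _ _; apply/abs_continuous_cac; apply: (@dC_cac R x y _ (fun t => (u2 t)%:C)) => //.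
    exact: ccont_real.
  + by exists a, b; split => // t _ /out[-> _].
  + rewrite (_ : sturm_liouville p _ = fun t => (- u2 t + p t * u t)%:C); first exact: eqL2_refl.
    apply/funext => t; rewrite /sturm_liouville Du (dC_derivC (dcu1 t)).
    by rewrite rmorphD rmorphN rmorphM.
Qed.

Lemma normL2_real_le (f : R -> R) a b G : continuous f -> 0 <= a -> a <= b ->
  (forall t, t <= a \/ b <= t -> f t = 0) -> (forall t, `|f t| <= G) ->
  normL2 (fun t => (f t)%:C) ^+ 2 <= G ^+ 2 * (b - a).
Proof.
move=> cf a0 ab out fG; have cc := ccont_real cf; apply: (prim_bounded_normL2 cc) => n.
have c2 := continuous_nsq cc; rewrite nsq_real in c2 *; set q := fun t => f t ^+ 2 in c2 *.
have dq (t : R) : is_derive t 1 (prim q) (q t) by exact: is_derive_prim.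
have flat x y : x <= y -> (forall t, x <= t <= y -> f t = 0) -> prim q y - prim q x <= 0.
  move=> xy f0; rewrite -(subrr (0 : R)).
  apply: (@ler_increment R x y (prim q) (fun=> 0) q (fun=> 0)) => // t h.
  by rewrite /q f0 // expr0n.
have h1 : prim q a <= 0.
  have := flat 0 a a0; rewrite prim0 subr0; apply => t /andP[_ ta]; by rewrite out //; left.
have h2 : prim q b - prim q a <= G ^+ 2 * b - G ^+ 2 * a.
  apply: (@ler_increment R a b (prim q) (fun t => G ^+ 2 * t) q (fun=> G ^+ 2)) => //.
    by move=> t _; apply: is_derive_eq' (dScale _ (dId t)) _; rewrite mulr1.
  move=> t _; rewrite /q -[f t ^+ 2]real_normK ?num_real // lerXn2r ?nnegrE //.
  exact: le_trans (fG t).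
set m := Num.max n%:R b.
have h3 : prim q m - prim q b <= 0.
  by apply: flat => [|t /andP[bt _]]; [rewrite /m le_max lexx orbT|rewrite out //; right].
have h4 : prim q n%:R <= prim q m.
  rewrite -subr_ge0 -(subrr (0 : R)).
  apply: (@ler_increment R n%:R m (fun=> 0) (prim q) (fun=> 0) q) => //.
    by rewrite /m le_max lexx.
  by move=> t _; exact: sqr_ge0.
by rewrite mulrBr; lra.
Qed.

Lemma normL2_real_ge (f : R -> R) a b : continuous f -> L2 (fun t => (f t)%:C) -> 0 <= a -> a <= b ->
  (forall t, a <= t <= b -> f t = 1) -> b - a <= normL2 (fun t => (f t)%:C) ^+ 2.
Proof.
move=> cf Lf a0 ab f1; have cc := ccont_real cf.
apply: le_trans (prim_le_normL2 cc Lf (le_trans a0 ab)).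
have c2 := continuous_nsq cc; rewrite nsq_real in c2 *; set q := fun t => f t ^+ 2 in c2 *.
have dq (t : R) : is_derive t 1 (prim q) (q t) by exact: is_derive_prim.
have h1 : 0 <= prim q a.
  have := @ler_increment R 0 a (fun=> 0) (prim q) (fun=> 0) q a0.
  by rewrite prim0 subrr subr0; apply => t _ //; exact: sqr_ge0.
have h2 : b - a <= prim q b - prim q a.
  apply: (@ler_increment R a b (fun t => t) (prim q) (fun=> 1) q) => // t h.
  by rewrite /q f1 // expr1n.
by lra.
Qed.

End RealTestFunctions.

(** * Decay through a trough *)
Section Cell.
Variable R : realType.
Implicit Types (v w rho E : R -> R).

Lemma exists_max_abs (f : R -> R) (a b : R) : a <= b -> continuous f ->
  exists m, a <= m <= b /\ forall t, a <= t <= b -> `|f t| <= `|f m|.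
Proof.
move=> ab cf; have cn : {within `[a, b], continuous (fun t => `|f t|)}.
  by apply: continuous_subspaceT => t; apply: (cvg_norm (cf t)).
by have [m] := EVT_max ab cn; rewrite in_itv /=; exists m.
Qed.

(** From the right end b of a cell, where v = 1 and the flux w is at most eta,
    back to the middle c of the well.  The weight decreases on [c, b], so that its
    integral over [t, b] is at most rho(t) l and the division by rho in v' is
    harmless: v stays near 1, and the flux collected at c is at least
    |Ek| l / 16, with the sign s of Ek. *)
Lemma descent_normalized v w rho E (P1 P2 : R -> R) (c b l D Ek delta eta s : R) :
  (forall t : R, is_derive t 1 v (w t / rho t)) ->
  (forall t : R, is_derive t 1 w (- E t * rho t * v t)) ->
  (forall t : R, is_derive t 1 P1 (rho t)) ->
  (forall t : R, is_derive t 1 P2 (rho t)^-1) ->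
  (forall t, 0 < rho t) ->
  (forall t t', c <= t -> t <= t' -> t' <= b -> rho t' <= rho t) ->
  (forall t, c <= t <= b -> `|E t| <= D) ->
  (forall t, c <= t <= b -> E t = Ek) ->
  c <= b -> 0 < l -> b - c <= l ->
  s ^+ 2 = 1 -> 0 < delta -> delta <= s * Ek ->
  D * l ^+ 2 <= 1 / 400 -> eta * (P2 b - P2 c) <= 1 / 8 ->
  l / 8 <= P1 b - P1 c -> 0 <= eta -> eta <= delta * l / 64 ->
  v b = 1 -> `|w b| <= eta ->
  (forall t, c <= t <= b -> 3 / 4 <= v t <= 5 / 4) /\ s * Ek * l / 16 <= s * w c.
Proof.
move=> dv dw dP1 dP2 rho0 rdn ED EEk cb l0 bc s2 del0 delE Dl etaP lP1 eta0 etal vb wb.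
have cv : continuous v by move=> t; exact: is_derive_continuous (dv t).
have D0 : 0 <= D by apply: le_trans (ED b _) => //; rewrite cb lexx.
have s1 : `|s| = 1 by apply/eqP; rewrite -(@pexpr_eq1 _ _ 2) // -normrX s2 normr1.
have P2mono x y : x <= y -> P2 x <= P2 y.
  move=> xy; have := @ler_increment R x y (fun=> 0) P2 (fun=> 0) (fun t => (rho t)^-1) xy.
  by rewrite subrr subr_ge0; apply => // t _; rewrite invr_ge0 ltW.
have [tM [tMb vM]] := exists_max_abs cb cv; set M := `|v tM| in vM.
have M0 : 0 <= M by exact: normr_ge0.
have P1r t : c <= t <= b -> P1 b - P1 t <= rho t * l.
  move=> /andP[ct tb]; apply: (@le_trans _ _ (rho t * b - rho t * t)).
    apply: (@ler_increment R t b P1 (fun x => rho t * x) rho (fun=> rho t)) => //.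
      by move=> x _; apply: is_derive_eq' (dScale _ (dId x)) _; rewrite mulr1.
    by move=> x /andP[tx xb]; exact: rdn.
  by rewrite -mulrBr ler_wpM2l ?(ltW (rho0 t)) //; lra.
have wM t : c <= t <= b -> `|w t| <= eta + D * M * l * rho t.
  move=> /andP[ct tb]; have := @ler_norm_increment R t b w (fun x => D * M * P1 x)
    (fun t => - E t * rho t * v t) (fun x => D * M * rho x) tb.
  move=> /(_ (fun x _ => dw x) (fun x _ => dScale (D * M) (dP1 x))) h.
  have {}h : `|w b - w t| <= D * M * P1 b - D * M * P1 t.
    apply: h => x /andP[tx xb]; rewrite !normrM normrN (gtr0_norm (rho0 x)) mulrAC.
    have cxb : c <= x <= b by rewrite (le_trans ct tx).
    by apply: ler_pM; rewrite ?mulr_ge0 ?(ltW (rho0 x)) //; apply: ler_pM; rewrite ?ED ?vM.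
  have := ler_wpM2l (mulr_ge0 D0 M0) (P1r t _); rewrite ct tb => /(_ isT).
  have := ler_distD (w b) (w t) 0; rewrite !subr0 distrC; clear -h wb; lra.
have v1 t : c <= t <= b -> `|1 - v t| <= 1 / 8 + M / 400.
  move=> /andP[ct tb]; have -> : 1 - v t = v b - v t by rewrite vb.
  have := @ler_norm_increment R t b v (fun x => eta * P2 x + D * M * l * x)
    (fun t => w t / rho t) (fun x => eta * (rho x)^-1 + D * M * l * 1) tb.
  move=> /(_ (fun x _ => dv x)) h; apply: le_trans (h _ _) _ => {h}.
  - move=> x /andP[tx xb]; rewrite normrM normfV (gtr0_norm (rho0 x)) ler_pdivrMr //.
    by rewrite mulrDl mulr1 divfK ?gt_eqF //; apply: wM; rewrite (le_trans ct tx).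
  - have h1 := ler_wpM2l eta0 (P2mono c t ct).
    have h2 : M * (D * l ^+ 2) <= M * (1 / 400) by rewrite ler_wpM2l.
    have h3 : D * M * l * (b - t) <= D * M * l * l.
      by rewrite ler_wpM2l ?mulr_ge0 ?(ltW l0) // (le_trans _ bc) // lerB.
    by clear -h1 h2 h3 etaP; lra.
have M2 : M <= 8 / 7.
  have := v1 tM tMb; have := ler_distD 1 (v tM) 0; rewrite !subr0 normr1 (distrC (v tM)) -/M; clear; lra.
have v34 t : c <= t <= b -> 3 / 4 <= v t <= 5 / 4.
  by move=> /v1; rewrite ler_norml => /andP[h1 h2]; apply/andP; clear -h1 h2 M2; split; lra.
have sEk0 : 0 <= s * Ek by lra.
split => //.
  have h : s * w b - s * w c <= - (3 / 4 * (s * Ek)) * P1 b - - (3 / 4 * (s * Ek)) * P1 c.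
    apply: (@ler_increment R c b (fun x => s * w x) (fun x => - (3 / 4 * (s * Ek)) * P1 x)
      (fun t => s * (- E t * rho t * v t)) (fun x => - (3 / 4 * (s * Ek)) * rho x)) => //.
    move=> x /andP[cx xb]; rewrite EEk ?cx //.
      have /andP[h1 _] : 3 / 4 <= v x <= 5 / 4 by rewrite v34 // cx.
      have h2 : 0 <= s * Ek * rho x by exact: mulr_ge0 (ltW (rho0 x)).
      by have := ler_wpM2l h2 h1; clear; lra.
  have h1 : - eta <= s * w b.
    have : `|s * w b| <= eta by rewrite normrM s1 mul1r.
    by rewrite ler_norml => /andP[].
  have h2 : 3 / 4 * (s * Ek) * (l / 8) <= 3 / 4 * (s * Ek) * (P1 b - P1 c).
    by rewrite ler_wpM2l // mulr_ge0 // divr_ge0.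
  have h3 : delta * l <= s * Ek * l by rewrite ler_pM2r.
  by have h4 := mulr_ge0 sEk0 (ltW l0); clear -h h1 h2 h3 h4 etal; lra.
Qed.

(** From the middle c of the well back to the left end a of the trough.  The
    flux w keeps its sign and its size, up to constant factors, since the weight
    is tiny where E may differ from Ek and since rho(t) times the integral of
    1 / rho over [t, c] is at most l.  In the trough this flux, divided by r, makes
    v grow to a multiple of w (P2 c - P2 a), which is large because P2 c - P2 a is
    of order l / r; in particular w is small compared with v at a, which is the
    hypothesis at the right end of the previous cell. *)
Lemma cell_decay_normalized v w rho E (P1 P2 : R -> R) (a m c b l D Ek delta eta r s : R) :
  (forall t : R, is_derive t 1 v (w t / rho t)) ->
  (forall t : R, is_derive t 1 w (- E t * rho t * v t)) ->
  (forall t : R, is_derive t 1 P1 (rho t)) ->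
  (forall t : R, is_derive t 1 P2 (rho t)^-1) ->
  (forall t, 0 < rho t <= 1) ->
  (forall t t', a <= t -> t <= t' -> t' <= c -> rho t <= rho t') ->
  (forall t t', c <= t -> t <= t' -> t' <= b -> rho t' <= rho t) ->
  (forall t, a <= t <= b -> `|E t| <= D) ->
  (forall t, m <= t <= b -> E t = Ek) ->
  (forall t, a <= t <= m -> rho t = r) ->
  a <= m -> m <= c -> c <= b -> 0 < l -> b - a = l ->
  s ^+ 2 = 1 -> 0 < delta -> delta <= s * Ek ->
  D * l ^+ 2 <= 1 / 400 -> eta * (P2 b - P2 c) <= 1 / 8 ->
  l / 8 <= P1 b - P1 c -> 0 <= eta -> eta <= delta * l / 64 ->
  D * r <= delta / 160 -> l / 2 <= r * (P2 c - P2 a) -> r <= delta * l ^+ 2 / 512 ->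
  v b = 1 -> `|w b| <= eta ->
  [/\ 2 <= `|v a|, `|w a| <= 336 * r / l * `|v a| &
      forall t, a <= t <= b -> `|v t| <= 169 * `|v a|].
Proof.
move=> dv dw dP1 dP2 rho01 rup rdn ED EEk rhor am mc cb l0 ba s2 del0 delE Dl etaP lP1 eta0
  etal Dr lP2 rl vb wb.
have cv : continuous v by move=> t; exact: is_derive_continuous (dv t).
have cw : continuous w by move=> t; exact: is_derive_continuous (dw t).
have rho0 t : 0 < rho t by have /andP[] := rho01 t.
have rho1 t : rho t <= 1 by have /andP[] := rho01 t.
have D0 : 0 <= D by apply: le_trans (ED b _); rewrite // lexx; lra.
have s1 : `|s| = 1 by apply/eqP; rewrite -(@pexpr_eq1 _ _ 2) // -normrX s2 normr1.
have P2mono x y : x <= y -> P2 x <= P2 y.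
  move=> xy; have := @ler_increment R x y (fun=> 0) P2 (fun=> 0) (fun t => (rho t)^-1) xy.
  rewrite subrr subr_ge0; apply => // t _; by rewrite invr_ge0 ltW.
pose om := s * w c.
have sEk0 : 0 <= s * Ek by lra.
have EkE : `|Ek| = s * Ek.
  by have := normrM s Ek; rewrite s1 mul1r => <-; rewrite ger0_norm //; lra.
have rhoc t : c <= t <= b -> c <= t <= b /\ m <= t <= b.
  by move=> /andP[ct tb]; rewrite ct tb (le_trans mc ct).
have [v34 omE] := @descent_normalized v w rho E P1 P2 c b l D Ek delta eta s dv dw dP1 dP2 rho0
  rdn (fun t h => ED t (ltac:(by case/andP: h => ct ->; rewrite (le_trans (le_trans am mc) ct))))
  (fun t h => EEk t (proj2 (rhoc t h))) cb l0 (ltac:(lra)) s2 del0 delE Dl etaP lP1 eta0 etal vb wb.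
rewrite -/om in omE.
clear dP1 P1 lP1 rdn wb eta0 etaP rhoc.
have om0 : 0 < om by apply: lt_le_trans omE; rewrite divr_gt0 // mulr_gt0 //; lra.
have wcom : `|w c| = om.
  by have := normrM s (w c); rewrite s1 mul1r => <-; rewrite gtr0_norm.
have ac : a <= c by lra.
have [tW [tWb wW]] := exists_max_abs ac cw; set W := `|w tW| in wW.
have W0 : 0 <= W by exact: normr_ge0.
have vW t : a <= t <= c -> `|v c - v t| <= W * (P2 c - P2 t).
  move=> /andP[at' tc]; rewrite mulrBr.
  apply: (@ler_norm_increment R t c v (fun x => W * P2 x) (fun t => w t / rho t)
    (fun x => W * (rho x)^-1)) => //.
  move=> x /andP[tx xc]; rewrite normrM normfV (gtr0_norm (rho0 x)) ler_wpM2r ?invr_ge0 ?(ltW (rho0 x)) //.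
  by apply: wW; lra.
have rP2 t : a <= t <= c -> rho t * (P2 c - P2 t) <= l.
  move=> /andP[at' tc]; apply: (@le_trans _ _ (c - t)); last by lra.
  rewrite mulrBr; apply: (@ler_increment R t c (fun x => rho t * P2 x) (fun x => x)
    (fun x => rho t * (rho x)^-1) (fun=> 1)) => //.
  by move=> x /andP[tx xc]; rewrite ler_pdivrMr // mul1r; exact: rup.
have vc54 : `|v c| <= 5 / 4.
  by have /andP[h1 h2] := v34 c (introT andP (conj (lexx c) cb)); rewrite ger0_norm //; lra.
have vc0 : 0 <= v c by have /andP[h1 h2] := v34 c (introT andP (conj (lexx c) cb)); lra.
have rWl t : a <= t <= c -> rho t * `|v c - v t| <= W * l.
  move=> ht; apply: (@le_trans _ _ (W * (rho t * (P2 c - P2 t)))); last by rewrite ler_wpM2l ?rP2.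
  by rewrite mulrCA ler_wpM2l ?vW ?(ltW (rho0 t)).
have Erho t : a <= t <= c -> `|E t| * rho t <= 2 * (s * Ek).
  move=> /andP[at' tc]; have tb := le_trans tc cb; have [tm|mt] := leP t m.
    rewrite rhor ?at' //; apply: (@le_trans _ _ (D * r)); last by clear -Dr delE del0; lra.
    by rewrite ler_wpM2r ?ED -?(rhor t) ?at' ?(ltW (rho0 t)) // tb.
  rewrite EEk ?tb ?(ltW mt) //.
  by rewrite EkE; have := ler_wpM2l sEk0 (rho1 t); clear -sEk0; lra.
have cal : (c - a) <= l by lra.
have Wom : W <= 42 * om.
  have /andP[aW Wc] := tWb.
  have h : `|w c - w tW| <= (5 / 2 * (s * Ek) + D * (W * l)) * c - (5 / 2 * (s * Ek) + D * (W * l)) * tW.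
    apply: (@ler_norm_increment R tW c w (fun x => (5 / 2 * (s * Ek) + D * (W * l)) * x)
      (fun t => - E t * rho t * v t) (fun=> 5 / 2 * (s * Ek) + D * (W * l))) => //.
      by move=> x _; apply: is_derive_eq' (dScale _ (dId x)) _; rewrite mulr1.
    move=> x /andP[xW xc]; have ax := le_trans aW xW; have xac : a <= x <= c by rewrite ax.
    rewrite !normrM normrN (gtr0_norm (rho0 x)).
    have h1 : `|v x| <= `|v c| + `|v c - v x|.
      by have := ler_distD (v c) (v x) 0; rewrite !subr0 (distrC (v x)); clear; lra.
    have h2 := Erho x xac; have h3 := rWl x xac.
    have E0 : 0 <= `|E x| by [].
    have ED' : `|E x| <= D by rewrite ED // ax (le_trans xc cb).
    have h4 := ler_wpM2l (mulr_ge0 E0 (ltW (rho0 x))) h1.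
    have h5 : `|E x| * (rho x * `|v c - v x|) <= D * (W * l).
      by apply: ler_pM => //; rewrite mulr_ge0 // ltW.
    have h6 : `|E x| * rho x * `|v c| <= 2 * (s * Ek) * (5 / 4).
      by apply: ler_pM => //; rewrite mulr_ge0 // ltW.
    by clear -h4 h5 h6; lra.
  have DWl : 0 <= D * (W * l) by rewrite !mulr_ge0 // ltW.
  have K0 : 0 <= 5 / 2 * (s * Ek) + D * (W * l) by clear -DWl sEk0; lra.
  have cl : c - tW <= l by clear -cal aW; lra.
  have h1 := ler_wpM2l K0 cl.
  have h2 : W * (D * l ^+ 2) <= W * (1 / 400) by rewrite ler_wpM2l.
  have h3 := ler_distD (w c) (w tW) 0; rewrite !subr0 (distrC (w tW)) wcom -/W in h3.
  by clear -h h1 h2 h3 omE om0; lra.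
have wsgn t : a <= t <= c -> om / 2 <= s * w t.
  move=> /andP[at' tc].
  have h : s * w c - s * w t <= (5 / 4 * (D * r) + D * (W * l)) * c - (5 / 4 * (D * r) + D * (W * l)) * t.
    apply: (@ler_increment R t c (fun x => s * w x) (fun x => (5 / 4 * (D * r) + D * (W * l)) * x)
      (fun t => s * (- E t * rho t * v t)) (fun=> 5 / 4 * (D * r) + D * (W * l))) => //.
    - by move=> x _; apply: is_derive_eq' (dScale _ (dId x)) _; rewrite mulr1.
    move=> x /andP[xW xc]; have ax := le_trans at' xW; have xac : a <= x <= c by rewrite ax.
    have h3 := rWl x xac.
    have E0 : 0 <= `|E x| by [].
    have ED' : `|E x| <= D by rewrite ED // ax (le_trans xc cb).
    have h5 : `|E x| * (rho x * `|v c - v x|) <= D * (W * l).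
      by apply: ler_pM => //; rewrite mulr_ge0 // ltW.
    have h6 : s * E x * (rho x * (v c - v x)) <= D * (W * l).
      apply: le_trans (ler_norm _) _; rewrite !normrM s1 mul1r (gtr0_norm (rho0 x)).
      exact: h5.
    have h7 : - (s * E x) * rho x * v c <= 5 / 4 * (D * r).
      have [xm|mx] := leP x m.
        have rr : rho x = r by apply: rhor; rewrite ax.
        apply: le_trans (ler_norm _) _; rewrite !normrM normrN normrM s1 mul1r (gtr0_norm (rho0 x)) rr.
        rewrite [leRHS]mulrC; apply: ler_pM => //; rewrite ?mulr_ge0 -?rr ?(ltW (rho0 x)) //.
        by rewrite ler_wpM2r ?(ltW (rho0 x)).
      rewrite EEk ?(ltW mx) ?(le_trans xc cb) //.
      have r0 : 0 <= r by have := rho0 a; rewrite rhor ?lexx // => /ltW.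
      have h8 : 0 <= 5 / 4 * (D * r) by rewrite !mulr_ge0.
      have h9 : 0 <= s * Ek * rho x * v c by apply: mulr_ge0 => //; apply: mulr_ge0; [exact: sEk0|exact: ltW].
      by clear -h8 h9; lra.
    by clear -h6 h7; lra.
  have r0 : 0 <= r by have := rho0 a; rewrite rhor ?lexx // => /ltW.
  have K0 : 0 <= 5 / 4 * (D * r) + D * (W * l) by rewrite addr_ge0 ?mulr_ge0 // ltW.
  have cl : c - t <= l by clear -cal at'; lra.
  have h1 := ler_wpM2l K0 cl.
  have h2 : W * (D * l ^+ 2) <= W * (1 / 400) by rewrite ler_wpM2l.
  have h3 : delta * l <= s * Ek * l by rewrite ler_pM2r.
  have h4 : l * (D * r) <= l * (delta / 160) by rewrite ler_pM2l.
  rewrite -/om in h; clear -h h1 h2 h3 h4 Wom omE delE del0 om0 l0; lra.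
pose B := P2 c - P2 a.
have B0 : 0 <= B by rewrite subr_ge0 P2mono.
have hB : om / 2 * P2 c - om / 2 * P2 a <= s * v c - s * v a.
  apply: (@ler_increment R a c (fun x => om / 2 * P2 x) (fun x => s * v x)
      (fun x => om / 2 * (rho x)^-1) (fun t => s * (w t / rho t))) => //.
  by move=> x xac; rewrite mulrA ler_wpM2r ?invr_ge0 ?(ltW (rho0 x)) //; exact: wsgn.
have va : om / 2 * B - 5 / 4 <= `|v a|.
  have h1 : s * v c <= 5 / 4.
    by apply: le_trans (ler_norm _) _; rewrite normrM s1 mul1r.
  have h2 : - (s * v a) <= `|v a|.
    by apply: le_trans (ler_norm _) _; rewrite normrN normrM s1 mul1r.
  by rewrite /B; clear -h1 h2 hB; lra.
have r0 : 0 < r by have := rho0 a; rewrite rhor ?lexx.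
have omB : 16 <= om * B.
  rewrite -(ler_pM2r r0).
  have h3 : delta * l <= s * Ek * l by rewrite ler_pM2r.
  have h4 : om * (l / 2) <= om * (r * B) by rewrite ler_pM2l.
  have h5 : delta * l / 16 * (l / 2) <= om * (l / 2).
    by rewrite ler_wpM2r ?divr_ge0 ?(ltW l0) //; clear -h3 omE; lra.
  by clear -h3 h4 h5 rl lP2 del0 om0 l0; lra.
have va4 : om * B / 4 <= `|v a| by clear -omB va; lra.
(* |w| <= 42 om on the cell, om B <= 4 |v a| and l / 2 <= r B: this gives the
   constants 336 = 2 * 4 * 42 and 169 = 4 * 42 + 1 *)
split; first by clear -omB va4; lra.
  apply: (@le_trans _ _ (42 * om)); first by apply: le_trans Wom; apply: wW; rewrite lexx.
  apply: (@le_trans _ _ (336 * r / l * (om * B / 4))); last first.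
    by apply: ler_wpM2l; [exact: divr_ge0 (mulr_ge0 (ler0n _ 336) (ltW r0)) (ltW l0)|exact: va4].
  rewrite mulrAC ler_pdivlMr //.
  have h4 : om * (l / 2) <= om * (r * B) by rewrite ler_pM2l.
  by clear -h4 lP2 om0; have := ler_wpM2l (ltW om0) lP2; lra.
move=> t /andP[at' tb]; have [tc|ct] := leP t c.
  have tac : a <= t <= c by rewrite at'.
  have h1 := ler_distD (v c) (v t) 0; rewrite !subr0 (distrC (v t)) in h1.
  have h2 := vW t tac.
  have h3 : W * (P2 c - P2 t) <= 42 * om * B.
    by apply: ler_pM => //; rewrite ?subr_ge0 ?P2mono // /B lerB // P2mono.
  by clear -h1 h2 h3 vc54 va4 omB; lra.
have /andP[h1 h2] : 3 / 4 <= v t <= 5 / 4 by rewrite v34 // (ltW ct).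
by clear -h1 h2 va4 omB; rewrite ger0_norm; lra.
Qed.

End Cell.

(** * A potential with troughs *)
Section SmoothStep.
Variable R : realType.

Definition posp (x : R) : R := (x + `|x|) / 2.

Lemma posp_le0 x : x <= 0 -> posp x = 0.
Proof. by move=> x0; rewrite /posp ler0_norm // subrr mul0r. Qed.

Lemma posp_ge0E x : 0 <= x -> posp x = x.
Proof. by move=> x0; rewrite /posp ger0_norm //; lra. Qed.

Lemma continuous_posp : continuous posp.
Proof.
move=> x; apply: cvgM; last exact: cvg_cst.
by apply: cvgD; [exact: cvg_id|apply: cvg_norm; exact: cvg_id].
Qed.

(** A C^2 step, rising from 0 to 1 on [0, 1]: the normalized integral of the
    C^1 bump sq (x (1 - x)), where sq x = x^2 / 2 on the positive half-line. *)
Lemma exists_smooth_step : exists S S1 S2 : R -> R,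
  [/\ forall t : R, is_derive t 1 S (S1 t), forall t : R, is_derive t 1 S1 (S2 t),
      continuous S2 & forall x y, x <= y -> S x <= S y] /\
  (forall x, x <= 0 -> [/\ S x = 0, S1 x = 0 & S2 x = 0]) /\
  (forall x, 1 <= x -> [/\ S x = 1, S1 x = 0 & S2 x = 0]).
Proof.
pose sq := prim posp.
have dsq (t : R) : is_derive t 1 sq (posp t) by exact/is_derive_prim/continuous_posp.
have sq00 : sq 0 = 0 by exact: prim0.
have sq0 (x : R) : x <= 0 -> sq x = 0.
  move=> x0; have := @ler_norm_increment R x 0 sq (fun=> 0) posp (fun=> 0) x0 (fun t _ => dsq t).
  rewrite sq00 sub0r normrN subrr => h; apply/eqP; rewrite -normr_le0; apply: h => t /andP[_ t0].
  by rewrite posp_le0 // normr0.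
have sq_ge (x : R) : 0 <= x -> x ^+ 2 / 2 <= sq x.
  move=> x0; have := @ler_increment R 0 x (fun x => 1 / 2 * (x * x)) sq (fun x => x) posp x0.
  rewrite sq00 mulr0 mulr0 !subr0 => h; apply: le_trans (h _ _ _) => [|t _|t /andP[t0 _]].
  - by rewrite expr2; lra.
  - by apply: is_derive_eq' (dScale _ (dMul (dId t) (dId t))) _; lra.
  - by rewrite posp_ge0E.
have sq_ge0 (x : R) : 0 <= sq x.
  have [x0|/ltW x0] := leP 0 x; last by rewrite sq0.
  by apply: le_trans (sq_ge x x0); rewrite divr_ge0 ?sqr_ge0.
pose h (x : R) := sq (x * (1 - x)); pose h1 (x : R) := posp (x * (1 - x)) * (1 - 2 * x).
have dh (t : R) : is_derive t 1 h (h1 t).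
  apply: (@dComp R (fun x => x * (1 - x)) sq t (1 - 2 * t)) => //.
  by apply: is_derive_eq' (dMul (dId t) (dSub (dCst 1 t) (dId t))) _; ring.
have ch : continuous h by move=> t; exact: is_derive_continuous (dh t).
have out (x : R) : x <= 0 \/ 1 <= x -> x * (1 - x) <= 0.
  by move=> [x0|x1]; [rewrite mulr_le0_ge0 //; lra|rewrite mulr_ge0_le0 //; lra].
have h0 (x : R) : x <= 0 \/ 1 <= x -> h x = 0 /\ h1 x = 0.
  by move=> hx; rewrite /h /h1 sq0 ?posp_le0 ?mul0r //; exact: out.
have I0 : 0 < prim h 1.
  pose q (x : R) := 1 / 6 * x ^+ 3 - 1 / 4 * x ^+ 4 + 1 / 10 * x ^+ 5.
  have := @ler_increment R 0 1 q (prim h) (fun x => (x * (1 - x)) ^+ 2 / 2) h ler01.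
  rewrite prim0 subr0 => H; apply: lt_le_trans (H _ _ _) => {H}.
  - by rewrite /q !expr0n /= !expr1n; lra.
  - move=> x _; have dX : is_derive x (1 : R) (fun x : R => x) 1 by exact: dId.
    have d2 := dMul dX dX; have d3 := dMul d2 dX; have d4 := dMul d3 dX; have d5 := dMul d4 dX.
    rewrite (_ : q = fun x => 1 / 6 * (x * x * x) - 1 / 4 * (x * x * x * x) + 1 / 10 * (x * x * x * x * x)).
      by apply: is_derive_eq' (dAdd (dSub (dScale _ d3) (dScale _ d4)) (dScale _ d5)) _; field.
    by apply/funext => y; rewrite /q; ring.
  - by move=> x _; exact: is_derive_prim.
  - by move=> x /andP[x0 x1]; apply: sq_ge; rewrite mulr_ge0 // subr_ge0.
pose i := (prim h 1)^-1; have i0 : 0 < i by rewrite invr_gt0.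
exists (fun x => i * prim h x), (fun x => i * h x), (fun x => i * h1 x); split; [split|split].
- by move=> t; apply/dScale/is_derive_prim.
- by move=> t; exact: dScale.
- move=> t; apply: cvgM; first exact: cvg_cst.
  apply: cvgM; last first.
    by apply: cvgB; [exact: cvg_cst|apply: cvgM; [exact: cvg_cst|exact: cvg_id]].
  have cq := is_derive_continuous (dMul (dId t) (dSub (dCst 1 t) (dId t))).
  exact: (continuous_comp cq (@continuous_posp _)).
- move=> x y xy; rewrite ler_pM2l //; have := @ler_increment R x y (fun=> 0) (prim h) (fun=> 0) h xy.
  rewrite subrr subr_ge0; apply => t _; [exact: is_derive_prim|exact: sq_ge0].
- move=> x x0; have [-> ->] := h0 x (or_introl x0); rewrite mulr0; split => //.
  have := @ler_norm_increment R x 0 (prim h) (fun=> 0) h (fun=> 0) x0.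
  rewrite prim0 sub0r normrN subrr => H; have -> : prim h x = 0; last by rewrite mulr0.
  apply/eqP; rewrite -normr_le0; apply: H => t; [by move=> _; exact: is_derive_prim|].
  by move=> /andP[_ t0]; have [-> _] := h0 t (or_introl t0); rewrite normr0.
- move=> x x1; have [-> ->] := h0 x (or_intror x1); rewrite mulr0; split => //.
  have := @ler_norm_increment R 1 x (prim h) (fun=> 0) h (fun=> 0) x1.
  rewrite subrr => H; have -> : prim h x = prim h 1; last by rewrite mulVf ?gt_eqF.
  apply/eqP; rewrite -subr_eq0 -normr_le0; apply: H => t; [by move=> _; exact: is_derive_prim|].
  by move=> /andP[t1 _]; have [-> _] := h0 t (or_intror t1); rewrite normr0.
Qed.

End SmoothStep.

Section LocallyFiniteSum.
Variables (R : realType) (l : R) (l0 : 0 < l).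
Implicit Types g : nat -> R -> R.

(** The k-th term starts to act at k l, so that locally the series is a finite
    sum; by this shape all regularity passes from the terms to the sum. *)
Definition starts_late g := forall k t, t <= k%:R * l -> g k t = 0.

(** Any number of terms that reaches t gives the same value. *)
Definition locsum g t := \sum_(k < (Num.truncn (t / l)).+1) g k t.

Lemma starts_late_sum g N M t : starts_late g -> t <= N%:R * l -> (N <= M)%N ->
  \sum_(k < M) g k t = \sum_(k < N) g k t.
Proof.
move=> sg tN /subnKC <-; elim: (M - N)%N => [|d IHd]; first by rewrite addn0.
rewrite addnS big_ord_recr /= IHd sg ?addr0 //; apply: le_trans tN _.
by rewrite ler_pM2r // ler_nat leq_addr.
Qed.

Lemma locsumE g N t : starts_late g -> t <= N%:R * l -> locsum g t = \sum_(k < N) g k t.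
Proof.
move=> sg tN; rewrite /locsum; set M := (Num.truncn _).+1.
have tM : t <= M%:R * l by rewrite -ler_pdivrMr // ltW // truncnS_gt.
by have [NM|/ltnW MN] := leqP N M; rewrite ?(starts_late_sum sg tN NM) // (starts_late_sum sg tM MN).
Qed.

Lemma near_locsum g (t : R) : starts_late g ->
  \forall s \near t, locsum g s = \sum_(k < (Num.truncn (t / l)).+1) g k s.
Proof.
move=> sg; have tN : t < (Num.truncn (t / l)).+1%:R * l by rewrite -ltr_pdivrMr // truncnS_gt.
by apply: filterS (lt_nbhsl tN) => s /ltW sN; exact: locsumE.
Qed.

Lemma is_derive_locsum g (g' : nat -> R -> R) (t : R) : starts_late g ->
  (forall k (t : R), is_derive t 1 (g k) (g' k t)) ->
  is_derive t 1 (locsum g) (locsum g' t).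
Proof.
move=> sg dg; rewrite /locsum -/(locsum g); set N := (Num.truncn (t / l)).+1.
apply: (@near_eq_is_derive _ _ _ (fun s => \sum_(k < N) g k s)).
  by apply: filterS (near_locsum t sg) => s ->.
elim: N => [|N IHN].
  rewrite big_ord0 (_ : (fun=> _) = fun=> 0); first exact: dCst.
  by apply/funext => s; rewrite big_ord0.
rewrite big_ord_recr (_ : (fun=> _) = fun s => \sum_(k < N) g k s + g N s); first exact: dAdd.
by apply/funext => s; rewrite big_ord_recr.
Qed.

Lemma continuous_locsum g : starts_late g -> (forall k, continuous (g k)) -> continuous (locsum g).
Proof.
move=> sg cg t; set N := (Num.truncn (t / l)).+1.
have e : {near nbhs t, (fun s => \sum_(k < N) g k s) =1 locsum g}.
  by apply: filterS (near_locsum t sg) => s ->.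
apply: cvg_trans (near_eq_cvg e) _ => {e}.
rewrite /locsum -/N; elim: N => [|N IHN].
  rewrite big_ord0 (_ : (fun=> _) = fun=> 0); first exact: cvg_cst.
  by apply/funext => s; rewrite big_ord0.
rewrite big_ord_recr (_ : (fun=> _) = fun s => \sum_(k < N) g k s + g N s); first by apply: cvgD => //; exact: cg.
by apply/funext => s; rewrite big_ord_recr.
Qed.

(** The terms that have finished telescope. *)
Lemma locsum_cell g (a : nat -> R) k t : starts_late g ->
  (forall j s, j.+1%:R * l <= s -> g j s = a j.+1 - a j) ->
  k%:R * l <= t <= k.+1%:R * l -> a 0 + locsum g t = a k + g k t.
Proof.
move=> sg rg /andP[kt tk]; rewrite (locsumE sg tk) big_ord_recr /= addrA; congr (_ + _).
have : forall n, (n <= k)%N -> a 0 + \sum_(j < n) g j t = a n.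
  elim=> [_|n IHn nk]; first by rewrite big_ord0 addr0.
  have nt : n.+1%:R * l <= t by apply: le_trans kt; rewrite ler_pM2r // ler_nat.
  by rewrite big_ord_recr /= addrA (IHn (ltnW nk)) (rg n t nt) addrCA subrr addr0.
by move/(_ k (leqnn k)).
Qed.

End LocallyFiniteSum.

(** The cell [k l, (k + 1) l] has a trough of depth eps k on its left half and a
    well, where the profile is 1, on its right half; the passages between them
    have length th l.  The step st has derivatives st1 and st2. *)
Section Troughs.
Variables (R : realType) (l th : R) (st st1 st2 : R -> R) (eps lev : nat -> R).
Hypotheses (l0 : 0 < l) (th0 : 0 < th) (th1 : th <= 1 / (8 * 1000)).
Hypotheses (dS : forall t : R, is_derive t 1 st (st1 t)) (dS1 : forall t : R, is_derive t 1 st1 (st2 t)).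
Hypotheses (cS2 : continuous st2) (S_mono : forall x y, x <= y -> st x <= st y).
Hypothesis S_le0 : forall x : R, x <= 0 -> [/\ st x = 0, st1 x = 0 & st2 x = 0].
Hypothesis S_ge1 : forall x : R, 1 <= x -> [/\ st x = 1, st1 x = 0 & st2 x = 0].
Hypothesis eps01 : forall k, 0 < eps k <= 1.

Lemma natS (k : nat) : k.+1%:R = k%:R + 1 :> R. Proof. by rewrite natr1. Qed.

Lemma step_bounds x : 0 <= st x <= 1.
Proof.
have [x0|x0] := leP x 0; first by have [-> _ _] := S_le0 x0; rewrite lexx ler01.
have [x1|x1] := leP 1 x; first by have [-> _ _] := S_ge1 x1; rewrite lexx ler01.
have [h0 _ _] := S_le0 (lexx 0); have [h1 _ _] := S_ge1 (lexx 1).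
by rewrite -{1}h0 -h1 !S_mono // ltW.
Qed.

Definition arg (k : nat) (a t : R) : R := (t / l - k%:R - a) / th.

Lemma arg_le0 k a t : t <= (k%:R + a) * l -> arg k a t <= 0.
Proof.
move=> h; rewrite /arg pmulr_lle0 ?invr_gt0 //; have : t / l <= k%:R + a by rewrite ler_pdivrMr.
lra.
Qed.

Lemma arg_ge1 k a t : (k%:R + a + th) * l <= t -> 1 <= arg k a t.
Proof.
move=> h; rewrite /arg ler_pdivlMr // mul1r; have : k%:R + a + th <= t / l by rewrite ler_pdivlMr.
lra.
Qed.

Lemma arg_mono k a t t' : t <= t' -> arg k a t <= arg k a t'.
Proof. by move=> h; rewrite /arg ler_pM2r ?invr_gt0 // !lerD2r ler_pM2r // invr_gt0. Qed.

Lemma d_arg k a (t : R) : is_derive t 1 (arg k a) (l * th)^-1.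
Proof.
rewrite (_ : arg k a = fun t => (l * th)^-1 * t - (k%:R + a) / th).
  by apply: is_derive_eq' (dSub (dScale _ (dId t)) (dCst _ t)) _; rewrite subr0 mulr1.
by apply/funext => s; rewrite /arg; field; rewrite !gt_eqF.
Qed.

(** The increment of the profile in the k-th cell is [ramp st k]: up from the
    trough, then down into the next one.  It is linear in the step, so that its
    derivatives are multiples of the ramps of st1 and st2. *)
Definition ramp (F : R -> R) (k : nat) (t : R) : R :=
  (1 - eps k) * F (arg k (1 / 2) t) - (1 - eps k.+1) * F (arg k (1 - th) t).

Definition ramp1 k t := (l * th)^-1 * ramp st1 k t.
Definition ramp2 k t := (l * th)^-1 * ((l * th)^-1 * ramp st2 k t).

Lemma d_ramp (F F1 : R -> R) k (t : R) : (forall t : R, is_derive t 1 F (F1 t)) ->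
  is_derive t 1 (ramp F k) ((l * th)^-1 * ramp F1 k t).
Proof.
move=> dF; apply: is_derive_eq' (dSub (dScale (1 - eps k) (dComp (d_arg k (1 / 2) t) (dF _)))
  (dScale (1 - eps k.+1) (dComp (d_arg k (1 - th) t) (dF _)))) _.
by rewrite /ramp; ring.
Qed.

Lemma ramp_late (F : R -> R) : (forall x : R, x <= 0 -> F x = 0) -> starts_late l (ramp F).
Proof.
move=> F0 k t tk; rewrite /ramp !F0 ?mulr0 ?subrr //; apply: arg_le0; apply: le_trans tk _;
  rewrite ler_pM2r //; move: th0 th1; lra.
Qed.

Lemma ramp_end (F : R -> R) k (t c : R) : (forall x : R, 1 <= x -> F x = c) -> k.+1%:R * l <= t ->
  ramp F k t = (eps k.+1 - eps k) * c.
Proof.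
move=> F1 kt; rewrite /ramp !F1; first by ring.
all: apply: arg_ge1; apply: le_trans kt; rewrite ler_pM2r // (natS k); move: th0 th1; lra.
Qed.

Definition profile t := eps 0 + locsum l (ramp st) t.
Definition profile1 t := 0 + locsum l ramp1 t.
Definition profile2 t := 0 + locsum l ramp2 t.

Lemma late_S : starts_late l (ramp st).
Proof. by apply: ramp_late => x /S_le0[]. Qed.
Lemma late_S1 : starts_late l ramp1.
Proof. by move=> k t kt; rewrite /ramp1 (@ramp_late st1) ?mulr0 // => x /S_le0[]. Qed.
Lemma late_S2 : starts_late l ramp2.
Proof. by move=> k t kt; rewrite /ramp2 (@ramp_late st2) ?mulr0 // => x /S_le0[]. Qed.

Lemma d_profile (t : R) : is_derive t 1 profile (profile1 t).
Proof.
apply: (dAdd (dCst (eps 0) t)); apply: is_derive_locsum => //; first exact: late_S.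
by move=> k s; exact: d_ramp.
Qed.

Lemma d_profile1 (t : R) : is_derive t 1 profile1 (profile2 t).
Proof.
apply: (dAdd (dCst 0 t)); apply: is_derive_locsum => //; first exact: late_S1.
by move=> k s; apply: dScale; exact: d_ramp.
Qed.

Lemma continuous_profile2 : continuous profile2.
Proof.
move=> t; apply: cvgD; first exact: cvg_cst.
apply: continuous_locsum => //; first exact: late_S2.
move=> k s; do 2 (apply: cvgM; first exact: cvg_cst).
have c0 (a : R) : {for s, continuous (fun t => st2 (arg k a t))}.
  exact: (continuous_comp (is_derive_continuous (d_arg k a s)) (@cS2 (arg k a s))).
by apply: cvgB; apply: cvgM; by [exact: cvg_cst|exact: c0].
Qed.

Lemma profile_cell k t : k%:R * l <= t <= k.+1%:R * l -> [/\ profile t = eps k + ramp st k t,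
  profile1 t = ramp1 k t & profile2 t = ramp2 k t].
Proof.
move=> h; split.
- apply: locsum_cell => //; first exact: late_S.
  by move=> j s js; rewrite (@ramp_end st _ _ 1) ?mulr1 // => x /S_ge1[].
- rewrite -[RHS]add0r; apply: (@locsum_cell R l l0 ramp1 (fun=> 0)) => //; first exact: late_S1.
  by move=> j s js; rewrite /ramp1 (@ramp_end st1 _ _ 0) ?mulr0 ?subrr // => x /S_ge1[].
- rewrite -[RHS]add0r; apply: (@locsum_cell R l l0 ramp2 (fun=> 0)) => //; first exact: late_S2.
  by move=> j s js; rewrite /ramp2 (@ramp_end st2 _ _ 0) ?mulr0 ?subrr // => x /S_ge1[].
Qed.

Lemma profile_neg t : t <= 0 -> [/\ profile t = eps 0, profile1 t = 0 & profile2 t = 0].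
Proof.
move=> t0; have t0' : t <= 0%:R * l by rewrite mul0r.
split; rewrite /profile /profile1 /profile2 (locsumE l0 _ t0') ?big_ord0 ?addr0 //.
- exact: late_S.
- exact: late_S1.
- exact: late_S2.
Qed.

Lemma exists_cell t : 0 <= t -> exists k, k%:R * l <= t <= k.+1%:R * l.
Proof.
move=> t0; exists (Num.truncn (t / l)); have /andP[h1 h2] := truncn_itv (divr_ge0 t0 (ltW l0)).
by rewrite -ler_pdivlMr // h1 -ler_pdivrMr // ltW.
Qed.

Lemma profile_trough k t : k%:R * l <= t <= (k%:R + 1 / 2) * l ->
  [/\ profile t = eps k, profile1 t = 0 & profile2 t = 0].
Proof.
move=> /andP[kt tk]; have hc : k%:R * l <= t <= k.+1%:R * l.
  by rewrite kt (le_trans tk) // ler_pM2r // (natS k); move: th0 th1; lra.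
have [-> -> ->] := profile_cell hc; have [a0 a1 a2] := S_le0 (arg_le0 tk).
have [b0 b1 b2] : [/\ st (arg k (1 - th) t) = 0, st1 (arg k (1 - th) t) = 0 & st2 (arg k (1 - th) t) = 0].
  by apply/S_le0/arg_le0/(le_trans tk); rewrite ler_pM2r //; move: th0 th1; lra.
by rewrite /ramp1 /ramp2 /ramp a0 a1 a2 b0 b1 b2 !(mulr0, subrr, addr0).
Qed.

Lemma profile_up k t : k%:R * l <= t <= (k%:R + 3 / 4) * l ->
  profile t = eps k + (1 - eps k) * st (arg k (1 / 2) t).
Proof.
move=> /andP[kt tk]; have hc : k%:R * l <= t <= k.+1%:R * l.
  by rewrite kt (le_trans tk) // ler_pM2r // (natS k); move: th0 th1; lra.
have [-> _ _] := profile_cell hc.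
have [b0 _ _] : [/\ st (arg k (1 - th) t) = 0, st1 (arg k (1 - th) t) = 0 & st2 (arg k (1 - th) t) = 0].
  by apply/S_le0/arg_le0/(le_trans tk); rewrite ler_pM2r //; move: th0 th1; lra.
by rewrite /ramp b0 mulr0 subr0.
Qed.

Lemma profile_down k t : (k%:R + 3 / 4) * l <= t <= k.+1%:R * l ->
  profile t = 1 - (1 - eps k.+1) * st (arg k (1 - th) t).
Proof.
move=> /andP[kt tk]; have hc : k%:R * l <= t <= k.+1%:R * l.
  by rewrite tk andbT (le_trans _ kt) // ler_pM2r //; lra.
have [-> _ _] := profile_cell hc.
have [b0 _ _] : [/\ st (arg k (1 / 2) t) = 1, st1 (arg k (1 / 2) t) = 0 & st2 (arg k (1 / 2) t) = 0].
  by apply/S_ge1/arg_ge1; apply: le_trans kt; rewrite ler_pM2r //; move: th0 th1; lra.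
by rewrite /ramp b0; ring.
Qed.

Lemma profile_well k t : (k%:R + 1 / 2 + th) * l <= t <= (k%:R + (1 - th)) * l ->
  profile t = 1 /\ profile2 t = 0.
Proof.
move=> /andP[kt tk]; have hc : k%:R * l <= t <= k.+1%:R * l.
  rewrite (le_trans _ kt) ?(le_trans tk) // ler_pM2r // ?(natS k); move: th0 th1; lra.
have [-> _ ->] := profile_cell hc; have [a0 _ a2] := S_le0 (arg_le0 tk).
have [b0 _ b2] := S_ge1 (arg_ge1 kt).
by rewrite /ramp2 /ramp a0 a2 b0 b2; split; ring.
Qed.

Lemma profile_bounds t : 0 < profile t <= 1.
Proof.
have [t0|/ltW t0] := leP 0 t; last by have [-> _ _] := profile_neg t0.
have [k /andP[kt tk]] := exists_cell t0; have /andP[e0 e1] := eps01 k; have /andP[f0 f1] := eps01 k.+1.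
have [h|/ltW h] := leP t ((k%:R + 3 / 4) * l).
  rewrite (@profile_up k) ?kt //; have /andP[s0 s1] := step_bounds (arg k (1 / 2) t).
  have : 0 <= (1 - eps k) * st (arg k (1 / 2) t) by rewrite mulr_ge0 // subr_ge0.
  have : 0 <= (1 - eps k) * (1 - st (arg k (1 / 2) t)) by rewrite mulr_ge0 // subr_ge0.
  by move=> h1 h2; apply/andP; split; lra.
rewrite (@profile_down k) ?h ?tk //; have /andP[s0 s1] := step_bounds (arg k (1 - th) t).
have : 0 <= (1 - eps k.+1) * st (arg k (1 - th) t) by rewrite mulr_ge0 // subr_ge0.
have : 0 <= (1 - eps k.+1) * (1 - st (arg k (1 - th) t)) by rewrite mulr_ge0 // subr_ge0.
by move=> h1 h2; apply/andP; split; lra.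
Qed.

Lemma profile_gt0 t : 0 < profile t. Proof. by have /andP[] := profile_bounds t. Qed.

Lemma profile_increasing k t t' : k%:R * l <= t -> t <= t' -> t' <= (k%:R + 3 / 4) * l ->
  profile t <= profile t'.
Proof.
move=> kt tt' tk; rewrite !(@profile_up k) ?kt ?(le_trans kt tt') ?(le_trans tt' tk) // lerD2l.
have /andP[e0 e1] := eps01 k.
by rewrite ler_wpM2l ?subr_ge0 // S_mono // arg_mono.
Qed.

Lemma profile_decreasing k t t' : (k%:R + 3 / 4) * l <= t -> t <= t' -> t' <= k.+1%:R * l ->
  profile t' <= profile t.
Proof.
move=> kt tt' tk; rewrite !(@profile_down k) ?kt ?(le_trans kt tt') ?(le_trans tt' tk) //.
have /andP[e0 e1] := eps01 k.+1.
by rewrite lerD2l lerN2 ler_wpM2l ?subr_ge0 // S_mono // arg_mono.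
Qed.

Lemma profile_down_ge k t : (k%:R + 3 / 4) * l <= t <= k.+1%:R * l -> eps k.+1 <= profile t.
Proof.
move=> h; rewrite (@profile_down k) //; have /andP[s0 s1] := step_bounds (arg k (1 - th) t).
have /andP[e0 e1] := eps01 k.+1.
have : 0 <= (1 - eps k.+1) * (1 - st (arg k (1 - th) t)) by rewrite mulr_ge0 // subr_ge0.
by lra.
Qed.

(** The level is switched between the fractions 1 / 6 and 1 / 3 of the cell,
    where the profile is constant. *)
Definition switch (x : R) : R := 6 * (posp (x - 1 / 6) - posp (x - 1 / 3)).

Lemma switch_le x : x <= 1 / 6 -> switch x = 0.
Proof. by move=> h; rewrite /switch !posp_le0; lra. Qed.

Lemma switch_ge x : 1 / 3 <= x -> switch x = 1.
Proof. by move=> h; rewrite /switch !posp_ge0E; lra. Qed.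

Lemma switch_bounds x : 0 <= switch x <= 1.
Proof.
have [h|h] := leP x (1 / 6); first by rewrite switch_le // lexx ler01.
have [h'|h'] := leP (1 / 3) x; first by rewrite switch_ge // lexx ler01.
by rewrite /switch posp_ge0E ?posp_le0; lra.
Qed.

(** As 0.-1 = 0, nothing is switched in the first cell. *)
Definition level_jump (k : nat) (t : R) : R := (lev k - lev k.-1) * switch (t / l - k%:R).

Definition level t := lev 0 + locsum l level_jump t.

Lemma late_jump : starts_late l level_jump.
Proof.
move=> k t tk; rewrite /level_jump switch_le ?mulr0 //.
by have : t / l <= k%:R by [rewrite ler_pdivrMr]; lra.
Qed.

Lemma level_cell k t : k%:R * l <= t <= k.+1%:R * l ->
  level t = lev k.-1 + (lev k - lev k.-1) * switch (t / l - k%:R).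
Proof.
apply: (@locsum_cell R l l0 level_jump (fun k => lev k.-1)); first exact: late_jump.
move=> j s js; rewrite /level_jump switch_ge ?mulr1 //.
by have : j.+1%:R <= s / l by [rewrite ler_pdivlMr]; rewrite (natS j); lra.
Qed.

Lemma level_own k t : (k%:R + 1 / 3) * l <= t <= k.+1%:R * l -> level t = lev k.
Proof.
move=> /andP[kt tk]; rewrite (@level_cell k).
  rewrite switch_ge ?mulr1 ?subrKC //; have : k%:R + 1 / 3 <= t / l by rewrite ler_pdivlMr.
  by lra.
by rewrite tk andbT (le_trans _ kt) // ler_pM2r //; lra.
Qed.

Lemma level_previous k t : k.+1%:R * l <= t <= (k.+1%:R + 1 / 6) * l -> level t = lev k.
Proof.
move=> /andP[kt tk]; rewrite (@level_cell k.+1) /=.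
  rewrite switch_le ?mulr0 ?addr0 //; have : t / l <= k.+1%:R + 1 / 6 by rewrite ler_pdivrMr.
  by lra.
by rewrite kt (le_trans tk) // ler_pM2r // (natS k.+1); lra.
Qed.

Lemma level_between A B t : (forall k, A <= lev k <= B) -> A <= level t <= B.
Proof.
move=> AB; have [t0|/ltW t0] := leP 0 t; last first.
  by rewrite /level (@locsumE R l l0 _ 0) ?big_ord0 ?addr0 ?mul0r //; exact: late_jump.
have [k kt] := exists_cell t0; rewrite (level_cell kt).
have /andP[s0 s1] := switch_bounds (t / l - k%:R); set s := switch _ in s0 s1 *.
have /andP[a1 b1] := AB k; have /andP[a2 b2] := AB k.-1.
have -> : lev k.-1 + (lev k - lev k.-1) * s = (1 - s) * lev k.-1 + s * lev k by ring.
have s1' : 0 <= 1 - s by rewrite subr_ge0.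
have h1 := ler_wpM2l s0 a1; have h2 := ler_wpM2l s0 b1.
have h3 := ler_wpM2l s1' a2; have h4 := ler_wpM2l s1' b2.
apply/andP; split; lra.
Qed.

Lemma continuous_level : continuous level.
Proof.
move=> t; apply: cvgD; first exact: cvg_cst.
apply: continuous_locsum => //; first exact: late_jump.
move=> k s; apply: cvgM; first exact: cvg_cst.
apply: cvgM; first exact: cvg_cst.
have c0 (a : R) : {for s, continuous (fun t : R => t / l - k%:R - a)}.
  by apply: cvgB; [apply: cvgB; [apply: cvgM; [exact: cvg_id|]|]|]; exact: cvg_cst.
by apply: cvgB; exact: (continuous_comp (c0 _) (@continuous_posp _ _)).
Qed.

(** The second term makes the profile a solution of l[y] = level y, wherever the
    level is constant. *)
Definition trough_potential t := level t + profile2 t / profile t.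

Lemma continuous_trough_potential : continuous trough_potential.
Proof.
move=> t; apply: cvgD; first exact: continuous_level.
apply: cvgM; first exact: continuous_profile2.
apply: cvgV; first by rewrite gt_eqF // profile_gt0.
exact: is_derive_continuous (d_profile t).
Qed.

(** Square-integrable solutions at a real spectral parameter: delta k is the
    distance that the parameter keeps from the k-th level, and the depths of the
    troughs are small compared with it. *)
Section Decay.
Variables (A B : R) (delta : nat -> R).
Hypothesis levAB : forall k, A <= lev k <= B.
Hypothesis ABl : (B - A) * l ^+ 2 <= 1 / 400.
Hypothesis delta0 : forall k, 0 < delta k.
Hypothesis eps_small : forall k, eps k ^+ 2 <= 1 / 2000.
Hypothesis eps_next : forall k, eps k.+1 ^+ 2 <= delta k * l ^+ 2 / (22 * 1000).
Hypothesis eps_level : forall k, (B - A) * eps k ^+ 2 <= delta k / 160.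
Hypothesis eps_own : forall k, eps k ^+ 2 <= delta k * l ^+ 2 / 512.

Notation Phi := profile.
Notation Phi1 := profile1.
Notation Phi2 := profile2.
Notation p := trough_potential.
Notation rho := (fun t => Phi t ^+ 2).

Let Phi0 t : 0 < Phi t. Proof. exact: profile_gt0. Qed.
Let dPhi (t : R) : is_derive t 1 Phi (Phi1 t). Proof. exact: d_profile. Qed.
Let dPhi1 (t : R) : is_derive t 1 Phi1 (Phi2 t). Proof. exact: d_profile1. Qed.

Let continuous_rho : continuous rho.
Proof. by move=> t; exact: (cvgM (is_derive_continuous (dPhi t)) (is_derive_continuous (dPhi t))). Qed.

Let rho_gt0 t : 0 < rho t. Proof. by rewrite exprn_gt0. Qed.

Let continuous_rhoV : continuous (fun t => (rho t)^-1).
Proof. by move=> t; apply: cvgV; [rewrite gt_eqF // rho_gt0|exact: continuous_rho]. Qed.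

Let dP1 (t : R) : is_derive t 1 (prim rho) (rho t). Proof. exact: is_derive_prim. Qed.
Let dP2 (t : R) : is_derive t 1 (prim (fun t => (rho t)^-1)) (rho t)^-1.
Proof. exact: is_derive_prim continuous_rhoV. Qed.

Lemma well_mass k : l / 8 <= prim rho (k.+1%:R * l) - prim rho ((k%:R + 3 / 4) * l).
Proof.
have h1 : (k%:R + (1 - th)) * l - (k%:R + 3 / 4) * l <=
    prim rho ((k%:R + (1 - th)) * l) - prim rho ((k%:R + 3 / 4) * l).
  apply: (@ler_increment R _ _ (fun x => x) (prim rho) (fun=> 1) rho) => //.
    by rewrite ler_pM2r //; move: th0 th1; lra.
  move=> t /andP[kt tk]; have [-> _] : Phi t = 1 /\ Phi2 t = 0; last by rewrite expr1n.
  apply: (@profile_well k) => //; rewrite tk andbT (le_trans _ kt) // ler_pM2r //.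
  by move: th0 th1; lra.
have h2 : prim rho ((k%:R + (1 - th)) * l) <= prim rho (k.+1%:R * l).
  rewrite -subr_ge0 -(subrr 0).
  apply: (@ler_increment R _ _ (fun=> 0) (prim rho) (fun=> 0) rho) => //.
    by rewrite ler_pM2r // (natS k); move: th0; lra.
  by move=> t _; apply: ltW; exact: rho_gt0.
have h3 : th * l <= 1 / (8 * 1000) * l by rewrite ler_pM2r.
by move: h1 h2 h3 l0; lra.
Qed.

(** The passage down to the next trough has length th l and weight at least
    eps (k + 1)^2, and the flux at the right end is of order eps (k + 1)^2: their
    quotient is of order th, which is where the small constant th is used. *)
Lemma well_barrier k : 336 * eps k.+1 ^+ 2 / l * (prim (fun t => (rho t)^-1) (k.+1%:R * l) -
  prim (fun t => (rho t)^-1) ((k%:R + 3 / 4) * l)) <= 1 / 8.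
Proof.
set P2 := prim (fun t => _); set r := eps k.+1 ^+ 2.
have r0 : 0 < r by rewrite exprn_gt0 //; have /andP[] := eps01 k.+1.
have h1 : P2 ((k%:R + (1 - th)) * l) - P2 ((k%:R + 3 / 4) * l) <=
  (k%:R + (1 - th)) * l - (k%:R + 3 / 4) * l.
  apply: (@ler_increment R _ _ P2 (fun x => x) (fun t => (rho t)^-1) (fun=> 1)) => //.
    by rewrite ler_pM2r //; move: th0 th1; lra.
  move=> t /andP[kt tk]; have [-> _] : Phi t = 1 /\ Phi2 t = 0; last by rewrite expr1n invr1.
  apply: (@profile_well k) => //; rewrite tk andbT (le_trans _ kt) // ler_pM2r //.
  by move: th0 th1; lra.
have h2 : P2 (k.+1%:R * l) - P2 ((k%:R + (1 - th)) * l) <=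
  r^-1 * (k.+1%:R * l) - r^-1 * ((k%:R + (1 - th)) * l).
  apply: (@ler_increment R _ _ P2 (fun x => r^-1 * x) (fun t => (rho t)^-1) (fun=> r^-1)) => //.
  - by rewrite ler_pM2r // (natS k); move: th0; lra.
  - by move=> t _; apply: is_derive_eq' (dScale _ (dId t)) _; rewrite mulr1.
  - move=> t /andP[kt tk]; rewrite lef_pV2 ?posrE ?rho_gt0 // /r.
    have /andP[e0 _] := eps01 k.+1; rewrite ler_sqr ?nnegrE ?(ltW e0) ?(ltW (Phi0 t)) //.
    apply: (@profile_down_ge k) => //; rewrite tk andbT (le_trans _ kt) // ler_pM2r //.
    by move: th0 th1; lra.
have h3 : P2 (k.+1%:R * l) - P2 ((k%:R + 3 / 4) * l) <= l / 4 + r^-1 * (th * l).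
  move: h1 h2; rewrite (natS k) => h1 h2.
  have h4 : 0 < th * l by rewrite mulr_gt0.
  by move: h1 h2 h4; lra.
have h5 : 0 <= 336 * r / l.
  apply: divr_ge0 (ltW l0); exact: mulr_ge0 (ler0n _ 336) (ltW r0).
apply: le_trans (ler_wpM2l h5 h3) _.
have -> : 336 * r / l * (l / 4 + r^-1 * (th * l)) = 84 * r + 336 * th.
  by field; rewrite !gt_eqF.
by have := eps_small k.+1; rewrite -/r; move: th1; lra.
Qed.

Lemma trough_barrier k : l / 2 <= eps k ^+ 2 * (prim (fun t => (rho t)^-1) ((k%:R + 3 / 4) * l) -
  prim (fun t => (rho t)^-1) (k%:R * l)).
Proof.
set P2 := prim (fun t => _); set r := eps k ^+ 2.
have r0 : 0 < r by rewrite exprn_gt0 //; have /andP[] := eps01 k.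
have h1 : r^-1 * ((k%:R + 1 / 2) * l) - r^-1 * (k%:R * l) <=
    P2 ((k%:R + 1 / 2) * l) - P2 (k%:R * l).
  apply: (@ler_increment R _ _ (fun x => r^-1 * x) P2 (fun=> r^-1) (fun t => (rho t)^-1)) => //.
  - by rewrite ler_pM2r //; lra.
  - by move=> t _; apply: is_derive_eq' (dScale _ (dId t)) _; rewrite mulr1.
  - by move=> t kt; have [-> _ _] := @profile_trough k t kt.
have h2 : P2 ((k%:R + 1 / 2) * l) <= P2 ((k%:R + 3 / 4) * l).
  rewrite -subr_ge0 -(subrr 0).
  apply: (@ler_increment R _ _ (fun=> 0) P2 (fun=> 0) (fun t => (rho t)^-1)) => //.
    by rewrite ler_pM2r //; lra.
  by move=> t _; rewrite invr_ge0 ltW // rho_gt0.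
rewrite [leRHS]mulrC -ler_pdivrMr //.
have -> : l / 2 / r = r^-1 * ((k%:R + 1 / 2) * l) - r^-1 * (k%:R * l) by field; rewrite gt_eqF.
by move: h1 h2; lra.
Qed.

(** With u = Phi v and w = Phi u' - Phi' u the equation becomes the system
    v' = w / Phi^2, w' = - (lam - level) Phi^2 v, in which Phi'' is absent. *)
Definition quotient_sol (u : R -> R) t := u t / Phi t.
Definition quotient_flux (u u' : R -> R) t := Phi t * u' t - Phi1 t * u t.

Lemma d_quotient_sol lam u u' (t : R) : rsol p lam u u' ->
  is_derive t 1 (quotient_sol u) (quotient_flux u u' t / rho t).
Proof.
move=> hu; have [du _] := hu t; have P0 : Phi t != 0 by rewrite gt_eqF.
apply: is_derive_eq' (dMul du (dInv P0 (dPhi t))) _.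
by rewrite /quotient_flux; field.
Qed.

Lemma d_quotient_flux lam u u' (t : R) : rsol p lam u u' ->
  is_derive t 1 (quotient_flux u u') (- (lam - level t) * rho t * quotient_sol u t).
Proof.
move=> hu; have [du du'] := hu t; have P0 : Phi t != 0 by rewrite gt_eqF.
apply: is_derive_eq' (dSub (dMul (dPhi t) du') (dMul (dPhi1 t) du)) _.
by rewrite /quotient_sol /trough_potential; field.
Qed.

Lemma cell_decay lam u u' k : rsol p lam u u' -> A <= lam <= B -> delta k <= `|lam - lev k| ->
  quotient_sol u (k.+1%:R * l) != 0 ->
  `|quotient_flux u u' (k.+1%:R * l)| <= 336 * eps k.+1 ^+ 2 / l * `|quotient_sol u (k.+1%:R * l)| ->
  [/\ 2 * `|quotient_sol u (k.+1%:R * l)| <= `|quotient_sol u (k%:R * l)|,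
      `|quotient_flux u u' (k%:R * l)| <= 336 * eps k ^+ 2 / l * `|quotient_sol u (k%:R * l)| &
      forall t, k%:R * l <= t <= k.+1%:R * l ->
        `|quotient_sol u t| <= 169 * `|quotient_sol u (k%:R * l)|].
Proof.
move=> hu /andP[Al lB] dl V0 wV; set V := quotient_sol u (k.+1%:R * l) in V0 wV *.
have V1 : 0 < `|V| by rewrite normr_gt0.
have [s s2 sE] : exists2 s : R, s ^+ 2 = 1 & s * (lam - lev k) = `|lam - lev k|.
  have [h|h] := leP 0 (lam - lev k); [exists 1|exists (-1)]; rewrite ?expr1n ?sqrrN ?expr1n //.
    by rewrite mul1r ger0_norm.
  by rewrite mulN1r ltr0_norm.
have [e0 _] := andP (eps01 k).
have := @cell_decay_normalized R (fun t => V^-1 * quotient_sol u t) (fun t => V^-1 * quotient_flux u u' t)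
  rho (fun t => lam - level t) (prim rho) (prim (fun t => (rho t)^-1))
  (k%:R * l) ((k%:R + 1 / 3) * l) ((k%:R + 3 / 4) * l) (k.+1%:R * l) l (B - A) (lam - lev k)
  (delta k) (336 * eps k.+1 ^+ 2 / l) (eps k ^+ 2) s.
have half t : k%:R * l <= t <= (k%:R + 1 / 3) * l -> rho t = eps k ^+ 2.
  move=> /andP[kt tk]; have [|-> _ _ //] := @profile_trough k t.
  by rewrite kt (le_trans tk) // ler_pM2r //; lra.
case.
- by move=> t; apply: is_derive_eq' (dScale V^-1 (d_quotient_sol t hu)) _; rewrite mulrA.
- by move=> t; apply: is_derive_eq' (dScale V^-1 (d_quotient_flux t hu)) _; ring.
- by [].
- by [].
- move=> t; rewrite rho_gt0 /=; apply: exprn_ile1; first exact: ltW (Phi0 t).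
  by have /andP[] := profile_bounds t.
- move=> t t' kt tt' tk; rewrite ler_sqr ?nnegrE ?(ltW (Phi0 _)) //.
  exact: (@profile_increasing k).
- move=> t t' kt tt' tk; rewrite ler_sqr ?nnegrE ?(ltW (Phi0 _)) //.
  exact: (@profile_decreasing k).
- move=> t _; have /andP[h1 h2] := level_between t levAB.
  by rewrite ler_norml; apply/andP; split; lra.
- by move=> t kt; rewrite (@level_own k).
- exact: half.
- by rewrite ler_pM2r //; lra.
- by rewrite ler_pM2r //; lra.
- by rewrite ler_pM2r // (natS k); lra.
- exact: l0.
- by rewrite (natS k); ring.
- exact: s2.
- exact: delta0.
- by rewrite sE.
- exact: ABl.
- exact: well_barrier.
- exact: well_mass.
- by apply: divr_ge0 (ltW l0); exact: mulr_ge0 (ler0n _ 336) (sqr_ge0 _).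
- rewrite ler_pdivrMr //; have := eps_next k; set r := eps k.+1 ^+ 2; have := mulr_gt0 (delta0 k) (exprn_gt0 2 l0).
  rewrite expr2; lra.
- exact: eps_level.
- exact: trough_barrier.
- exact: eps_own.
- by rewrite -/V mulVf.
- by rewrite normrM normfV mulrC ler_pdivrMr.
have nV x : `|V^-1 * x| = `|V|^-1 * `|x| by rewrite normrM normfV.
cbn beta; rewrite !nV => h1 h2 h3; split.
- by move: h1; rewrite [leRHS]mulrC ler_pdivlMr.
- by move: h2; rewrite [leRHS]mulrCA ler_pM2l ?invr_gt0.
- by move=> t /h3; rewrite nV [leRHS]mulrCA ler_pM2l ?invr_gt0.
Qed.

Let continuous_sqr (u : R -> R) (u' : R -> R) : (forall t : R, is_derive t 1 u (u' t)) ->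
  continuous (fun t => u t ^+ 2).
Proof. by move=> du t; exact: (cvgM (is_derive_continuous (du t)) (is_derive_continuous (du t))). Qed.

Lemma cell_mass lam u u' k C : rsol p lam u u' ->
  (forall t, k%:R * l <= t <= k.+1%:R * l -> `|quotient_sol u t| <= C) ->
  prim (fun t => u t ^+ 2) (k.+1%:R * l) - prim (fun t => u t ^+ 2) (k%:R * l) <= C ^+ 2 * l.
Proof.
move=> hu uC; have cu := continuous_sqr (fun t => (hu t).1).
apply: (@le_trans _ _ (C ^+ 2 * (k.+1%:R * l) - C ^+ 2 * (k%:R * l))); last first.
  by apply: le_of_eq; rewrite (natS k); ring.
apply: (@ler_increment R _ _ _ (fun t => C ^+ 2 * t) (fun t => u t ^+ 2) (fun=> C ^+ 2)).
- by rewrite ler_pM2r // ler_nat.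
- by move=> t _; exact: is_derive_prim.
- by move=> t _; apply: is_derive_eq' (dScale _ (dId t)) _; rewrite mulr1.
move=> t kt; have uq : u t = quotient_sol u t * Phi t by rewrite /quotient_sol divfK // gt_eqF.
have /andP[_ P1] := profile_bounds t; have P2 := Phi0 t.
rewrite uq exprMn -(mulr1 (C ^+ 2)) -[quotient_sol u t ^+ 2]real_normK ?num_real //.
by apply: ler_pM; rewrite ?sqr_ge0 ?exprn_ile1 ?(ltW P2) // lerXn2r ?nnegrE // ?uC // (le_trans _ (uC t kt)).
Qed.

(** Backward induction on the cells: the values of v at the left ends at least
    double at each step, and the masses form a geometric series. *)
Lemma decay_sum lam u u' K n : rsol p lam u u' -> A <= lam <= B ->
  (forall k, (K <= k)%N -> delta k <= `|lam - lev k|) -> (K <= n)%N ->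
  quotient_sol u (n%:R * l) != 0 -> quotient_flux u u' (n%:R * l) = 0 ->
  prim (fun t => u t ^+ 2) (n%:R * l) - prim (fun t => u t ^+ 2) (K%:R * l) <=
    2 * (169 ^+ 2 * l) * quotient_sol u (K%:R * l) ^+ 2.
Proof.
move=> hu lamAB dlam Kn v0 w0; set Q := prim _; set q := quotient_sol u.
suff H d k : (K <= k)%N -> (k + d = n)%N -> [/\ q (k%:R * l) != 0,
    `|quotient_flux u u' (k%:R * l)| <= 336 * eps k ^+ 2 / l * `|q (k%:R * l)| &
    Q (n%:R * l) - Q (k%:R * l) <= 2 * (169 ^+ 2 * l) * q (k%:R * l) ^+ 2].
  by have [] := H (n - K)%N K (leqnn K) (subnKC Kn).
have Cl : 0 <= 169 ^+ 2 * l by exact: mulr_ge0 (sqr_ge0 _) (ltW l0).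
elim: d k => [|d IHd] k Kk kn.
  rewrite addn0 in kn; rewrite kn v0 w0 normr0 subrr; split; first by [].
    exact: mulr_ge0 (divr_ge0 (mulr_ge0 (ler0n _ 336) (sqr_ge0 _)) (ltW l0)) (normr_ge0 _).
  exact: mulr_ge0 (mulr_ge0 (ler0n _ 2) Cl) (sqr_ge0 _).
have [|q1 f1 m1] := IHd k.+1 (leq_trans Kk (leqnSn k)); first by rewrite addSnnS.
have [h1 h2 h3] := cell_decay hu lamAB (dlam k Kk) q1 f1.
have h4 := cell_mass hu h3; split => //.
  by rewrite -normr_gt0 (lt_le_trans _ h1) // mulr_gt0 // normr_gt0.
have h5 : 4 * q (k.+1%:R * l) ^+ 2 <= q (k%:R * l) ^+ 2.
  rewrite -[q (k%:R * l) ^+ 2]real_normK ?num_real // -[q (k.+1%:R * l) ^+ 2]real_normK ?num_real //.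
  rewrite (_ : 4 * _ = (2 * `|q (k.+1%:R * l)|) ^+ 2); last by ring.
  by rewrite lerXn2r ?nnegrE // mulr_ge0.
have h6 : 169 ^+ 2 * l * (4 * q (k.+1%:R * l) ^+ 2) <= 169 ^+ 2 * l * q (k%:R * l) ^+ 2.
  exact: ler_wpM2l h5.
have h7 : 0 <= 169 ^+ 2 * l * q (k%:R * l) ^+ 2 by exact: mulr_ge0 (sqr_ge0 _).
rewrite exprMn real_normK ?num_real // in h4; rewrite -/Q -/q in h4.
by move: m1 h4 h6 h7; set X := 169 ^+ 2; lra.
Qed.

Lemma continuous_potential : continuous p.
Proof. exact: continuous_trough_potential. Qed.

(** For each N, the solution with v = 1, w = 0 at some x = n l >= N decays from
    K l to x; normalized by its coefficients in a fundamental system, its mass on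
    [0, x] is bounded by BB, which does not depend on N. *)
Lemma exists_L2_csol_real lam : A <= lam <= B ->
  (exists K, forall k, (K <= k)%N -> delta k <= `|lam - lev k|) ->
  exists y y', [/\ csol p lam%:C y y', L2 y & exists t, y t != 0].
Proof.
move=> lamAB [K HK]; have cp := continuous_potential.
have [u1 [u1' [u2 [u2' [hu1 hu2 W]]]]] := exists_real_fundamental cp lam.
pose Q := prim (fun t => u1 t ^+ 2 + u2 t ^+ 2); pose xK := K%:R * l.
pose BB := 2 * (169 ^+ 2 * l) * ((u1 xK ^+ 2 + u2 xK ^+ 2) / Phi xK ^+ 2) + Q xK.
have fund : fundamental p lam%:C (fun t => (u1 t)%:C) (fun t => (u1' t)%:C)
    (fun t => (u2 t)%:C) (fun t => (u2' t)%:C).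
  split; [exact: rsol_csol|exact: rsol_csol|] => t.
  by rewrite -!rmorphM -rmorphB /= W.
apply: (exists_L2_csol cp (B := BB) fund) => N.
pose n := maxn K (Num.truncn (N%:R / l)).+1; pose x := n%:R * l.
have Kn : (K <= n)%N by exact: leq_maxl.
have Nx : N%:R <= x.
  rewrite /x -ler_pdivrMr //; apply: ltW; apply: lt_le_trans (truncnS_gt _) _.
  by rewrite ler_nat leq_maxr.
pose a0 := Phi x * u2' x - Phi1 x * u2 x; pose b0 := u1 x * Phi1 x - u1' x * Phi x.
have ab_u : a0 * u1 x + b0 * u2 x = Phi x by rewrite -[RHS]mulr1 -(W x) /a0 /b0; ring.
have ab_u' : a0 * u1' x + b0 * u2' x = Phi1 x by rewrite -[RHS]mulr1 -(W x) /a0 /b0; ring.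
have nrm0 : 0 < a0 ^+ 2 + b0 ^+ 2.
  rewrite lt_neqAle addr_ge0 ?sqr_ge0 // andbT eq_sym paddr_eq0 ?sqr_ge0 // !sqrf_eq0.
  apply/negP => /andP[/eqP a0' /eqP b0']; have := Phi0 x.
  by rewrite -ab_u a0' b0' !mul0r addr0 ltxx.
pose nrm := Num.sqrt (a0 ^+ 2 + b0 ^+ 2); have nrmp : 0 < nrm by rewrite sqrtr_gt0.
pose a := a0 / nrm; pose b := b0 / nrm.
have ab1 : a ^+ 2 + b ^+ 2 = 1.
  by rewrite /a /b !expr_div_n -mulrDl sqr_sqrtr ?(ltW nrm0) // divff // gt_eqF.
pose u t := a * u1 t + b * u2 t; pose u' t := a * u1' t + b * u2' t.
have hu : rsol p lam u u' by exact: rsol_lin.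
have ux : u x = Phi x / nrm by rewrite /u /a /b -ab_u; field; rewrite gt_eqF.
have ux' : u' x = Phi1 x / nrm by rewrite /u' /a /b -ab_u'; field; rewrite gt_eqF.
have v0 : quotient_sol u x != 0.
  by rewrite /quotient_sol ux mulrAC divff ?mul1r ?invr_neq0 ?gt_eqF.
have w0 : quotient_flux u u' x = 0 by rewrite /quotient_flux ux ux'; ring.
have dec := decay_sum hu lamAB HK Kn v0 w0.
have u2le t : u t ^+ 2 <= u1 t ^+ 2 + u2 t ^+ 2.
  rewrite -[leRHS]mul1r -ab1 /u -subr_ge0.
  rewrite (_ : _ - _ = (a * u2 t - b * u1 t) ^+ 2) ?sqr_ge0 //; ring.
have cu := continuous_sqr (fun t => (hu t).1).
have c12 : continuous (fun t => u1 t ^+ 2 + u2 t ^+ 2).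
  by move=> t; apply: cvgD; apply: continuous_sqr => s; [have [] := hu1 s|have [] := hu2 s].
exists a%:C, b%:C; split.
  by rewrite !normc2 /= expr0n /= !addr0.
rewrite (_ : nsq _ = fun t => u t ^+ 2); last first.
  by apply/funext => t; rewrite /nsq !ReIm /= !mul0r !mulr0 !subr0 !addr0 expr0n /= addr0.
have h1 : prim (fun t => u t ^+ 2) N%:R <= prim (fun t => u t ^+ 2) x.
  rewrite -subr_ge0 -(subrr 0).
  apply: (@ler_increment R _ _ (fun=> 0) _ (fun=> 0) (fun t => u t ^+ 2)) => //.
    by move=> t _; exact: is_derive_prim.
  by move=> t _; exact: sqr_ge0.
have xK0 : 0 <= xK by rewrite mulr_ge0 // ltW.
have h2 : prim (fun t => u t ^+ 2) xK <= Q xK.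
  have := @ler_increment R 0 xK (prim (fun t => u t ^+ 2)) Q (fun t => u t ^+ 2)
    (fun t => u1 t ^+ 2 + u2 t ^+ 2) xK0; rewrite /Q !prim0 !subr0; apply => t _.
  - exact: is_derive_prim.
  - exact: is_derive_prim.
  - exact: u2le.
have h3 : quotient_sol u xK ^+ 2 <= (u1 xK ^+ 2 + u2 xK ^+ 2) / Phi xK ^+ 2.
  by rewrite /quotient_sol expr_div_n ler_wpM2r ?u2le // invr_ge0 sqr_ge0.
have h4 : 2 * (169 ^+ 2 * l) * quotient_sol u xK ^+ 2 <=
    2 * (169 ^+ 2 * l) * ((u1 xK ^+ 2 + u2 xK ^+ 2) / Phi xK ^+ 2).
  by apply: ler_wpM2l h3; exact: mulr_ge0 (ler0n _ 2) (mulr_ge0 (sqr_ge0 _) (ltW l0)).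
apply: le_trans h1 _; rewrite /BB; move: dec h2 h4; rewrite -/x -/xK.
by set c := 2 * (169 ^+ 2 * l); lra.
Qed.

(** In the wells the potential is the level. *)
Lemma trough_potential_bounded_below : bounded_below_often p A (l / 8).
Proof.
split=> [|N]; first by rewrite divr_gt0.
pose k := (Num.truncn (N%:R / l)).+1; exists ((k%:R + 3 / 4) * l); split.
  have : N%:R <= k%:R * l by rewrite -ler_pdivrMr //; apply: ltW; exact: truncnS_gt.
  by move: l0; lra.
move=> t /andP[kt tk]; have [P1 P2] : Phi t = 1 /\ Phi2 t = 0.
  apply: (@profile_well k); apply/andP; split.
    by apply: le_trans kt; rewrite ler_pM2r //; move: th0 th1; lra.
  apply: le_trans tk _; have := mulr_gt0 th0 l0.
  have : th * l <= 1 / (8 * 1000) * l by rewrite ler_pM2r.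
  by move: l0; lra.
by rewrite /trough_potential P2 mul0r addr0; have /andP[] := level_between t levAB.
Qed.

End Decay.

(** The k-th quasi-mode is the profile cut off inside the two troughs that enclose
    the k-th well.  The cutoff is confined to the parts of these troughs where the
    level is lev k: after the switch in the first, before the switch in the second. *)
Definition cutoff_arg (k : nat) (a t : R) : R := 6 * (t / l - k%:R - a).

Lemma d_cutoff_arg k a (t : R) : is_derive t 1 (cutoff_arg k a) (6 / l).
Proof.
rewrite (_ : cutoff_arg k a = fun t => 6 / l * t - 6 * (k%:R + a)).
  by apply: is_derive_eq' (dSub (dScale _ (dId t)) (dCst _ t)) _; rewrite subr0 mulr1.
by apply/funext => s; rewrite /cutoff_arg; field; rewrite !gt_eqF.
Qed.

Lemma cutoff_arg_le0 k a t : t <= (k%:R + a) * l -> cutoff_arg k a t <= 0.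
Proof.
by rewrite -ler_pdivrMr // /cutoff_arg => h; lra.
Qed.

Lemma cutoff_arg_ge1 k a t : (k%:R + a + 1 / 6) * l <= t -> 1 <= cutoff_arg k a t.
Proof.
by rewrite -ler_pdivlMr // /cutoff_arg => h; lra.
Qed.

Definition window (F : R -> R) k t := F (cutoff_arg k (1 / 3) t) - F (cutoff_arg k 1 t).

Lemma d_window F F1 k (t : R) : (forall t : R, is_derive t 1 F (F1 t)) ->
  is_derive t 1 (window F k) (6 / l * window F1 k t).
Proof.
move=> dF; apply: is_derive_eq' (dSub (dComp (d_cutoff_arg k (1 / 3) t) (dF _))
  (dComp (d_cutoff_arg k 1 t) (dF _))) _.
by rewrite /window; ring.
Qed.

Lemma continuous_window F k : continuous F -> continuous (window F k).
Proof.
move=> cF t; have c0 (a : R) : {for t, continuous (fun t => F (cutoff_arg k a t))}.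
  exact: (continuous_comp (is_derive_continuous (d_cutoff_arg k a t)) (cF (cutoff_arg k a t))).
by apply: cvgB; exact: c0.
Qed.

Definition cutoff k := window st k.
Definition cutoff1 k t := 6 / l * window st1 k t.
Definition cutoff2 k t := 6 / l * (6 / l * window st2 k t).

Lemma cutoff_left k t : t <= (k%:R + 1 / 3) * l ->
  [/\ cutoff k t = 0, cutoff1 k t = 0 & cutoff2 k t = 0].
Proof.
move=> h; have [a0 a1 a2] := S_le0 (cutoff_arg_le0 h).
have h1 : t <= (k%:R + 1) * l by apply: le_trans h _; rewrite ler_pM2r //; lra.
have [b0 b1 b2] := S_le0 (cutoff_arg_le0 h1).
by rewrite /cutoff1 /cutoff2 /cutoff /window a0 a1 a2 b0 b1 b2 subrr !mulr0.
Qed.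

Lemma cutoff_right k t : (k%:R + 7 / 6) * l <= t ->
  [/\ cutoff k t = 0, cutoff1 k t = 0 & cutoff2 k t = 0].
Proof.
move=> h; have h1 : (k%:R + 1 / 3 + 1 / 6) * l <= t by apply: le_trans h; rewrite ler_pM2r //; lra.
have h2 : (k%:R + 1 + 1 / 6) * l <= t by apply: le_trans h; rewrite ler_pM2r //; lra.
have [a0 a1 a2] := S_ge1 (cutoff_arg_ge1 h1); have [b0 b1 b2] := S_ge1 (cutoff_arg_ge1 h2).
by rewrite /cutoff1 /cutoff2 /cutoff /window a0 a1 a2 b0 b1 b2 !subrr !mulr0.
Qed.

Lemma cutoff_middle k t : (k%:R + 1 / 2) * l <= t <= (k%:R + 1) * l ->
  [/\ cutoff k t = 1, cutoff1 k t = 0 & cutoff2 k t = 0].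
Proof.
move=> /andP[h h2]; have h1 : (k%:R + 1 / 3 + 1 / 6) * l <= t by apply: le_trans h; rewrite ler_pM2r //; lra.
have [a0 a1 a2] := S_ge1 (cutoff_arg_ge1 h1); have [b0 b1 b2] := S_le0 (cutoff_arg_le0 h2).
by rewrite /cutoff1 /cutoff2 /cutoff /window a0 a1 a2 b0 b1 b2 !subrr !mulr0 subr0.
Qed.

Lemma exists_step2_bound : exists2 K, 0 < K & forall x, `|st2 x| <= K.
Proof.
have [K [K0 HK]] := continuous_bounded 0 1 cS2; exists (K + 1) => [|x]; first by lra.
have [x0|/ltW x0] := leP x 0; first by have [_ _ ->] := S_le0 x0; rewrite normr0; lra.
have [x1|/ltW x1] := leP 1 x; first by have [_ _ ->] := S_ge1 x1; rewrite normr0; lra.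
by have := HK x; rewrite x0 x1 => /(_ isT); lra.
Qed.

Notation p := (trough_potential).
Notation Phi := profile.
Notation Phi1 := profile1.
Notation Phi2 := profile2.

Lemma cutoff_profile k t K : (forall x, `|st2 x| <= K) ->
  [/\ Phi1 t * cutoff1 k t = 0, (level t - lev k) * cutoff k t = 0 &
      `|Phi t * cutoff2 k t| <= (eps k + eps k.+1) * (72 * K / l ^+ 2)].
Proof.
move=> HK; have K0 : 0 <= K by apply: le_trans (HK 0).
have /andP[e0 _] := eps01 k; have /andP[e1 _] := eps01 k.+1.
have c2 : `|cutoff2 k t| <= 72 * K / l ^+ 2.
  have w2 : `|window st2 k t| <= 2 * K.
    by apply: le_trans (ler_normB _ _) _; rewrite mulr_natl mulr2n lerD ?HK.
  rewrite /cutoff2 mulrA normrM -expr2 ger0_norm ?sqr_ge0 //.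
  rewrite (_ : 72 * K / l ^+ 2 = (6 / l) ^+ 2 * (2 * K)); last by field; rewrite gt_eqF.
  by rewrite ler_wpM2l ?sqr_ge0.
have K1 : 0 <= 72 * K / l ^+ 2 by exact: le_trans c2.
have zero : cutoff k t = 0 -> cutoff1 k t = 0 -> cutoff2 k t = 0 ->
  [/\ Phi1 t * cutoff1 k t = 0, (level t - lev k) * cutoff k t = 0 &
      `|Phi t * cutoff2 k t| <= (eps k + eps k.+1) * (72 * K / l ^+ 2)].
  by move=> -> -> ->; rewrite !mulr0 normr0; split => //; rewrite mulr_ge0 // addr_ge0 // ltW.
have [h1|/ltW h1] := leP t ((k%:R + 1 / 3) * l).
  by have [] := cutoff_left h1.
have [h2|/ltW h2] := leP ((k%:R + 7 / 6) * l) t.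
  by have [] := cutoff_right h2.
have [h3|/ltW h3] := leP t (k.+1%:R * l).
  have -> : level t = lev k by apply: level_own; rewrite h1.
  rewrite subrr mul0r; have [h4|/ltW h4] := leP t ((k%:R + 1 / 2) * l).
    have [|-> -> _] := @profile_trough k t.
      by rewrite h4 andbT (le_trans _ h1) // ler_pM2r //; lra.
    rewrite mul0r; split => //; rewrite normrM gtr0_norm //.
    by apply: ler_pM => //; [exact: ltW|rewrite lerDl ltW].
  have [|_ -> ->] := @cutoff_middle k t; first by rewrite h4 -(natS k).
  by rewrite !mulr0 normr0; split => //; rewrite mulr_ge0 // addr_ge0 // ltW.
have -> : level t = lev k.
  apply: level_previous; rewrite h3 (le_trans h2) // ler_pM2r // (natS k); lra.
rewrite subrr mul0r; have [|-> -> _] := @profile_trough k.+1 t.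
  by rewrite h3 (le_trans h2) // ler_pM2r // (natS k); lra.
rewrite mul0r; split => //; rewrite normrM gtr0_norm //.
by apply: ler_pM => //; [exact: ltW|rewrite lerDr ltW].
Qed.

(** On the window the profile solves l[y] = (lev k) y, and the cutoff acts only
    in the two troughs, where the profile is a constant eps: the error is
    - eps times the second derivative of the cutoff, against a norm of order
    sqrt l from the well. *)
Lemma exists_quasimode k K : (forall x, `|st2 x| <= K) -> exists u f,
  [/\ minimal_operator p (u, f), 0 < normL2 u &
      normL2 (shift (lev k) u f) <= 216 * K / l ^+ 2 * (eps k + eps k.+1) * normL2 u].
Proof.
move=> HK; have cp : continuous p by exact: continuous_trough_potential.
have dP (t : R) : is_derive t 1 Phi (Phi1 t) by exact: d_profile.
have dP1 (t : R) : is_derive t 1 Phi1 (Phi2 t) by exact: d_profile1.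
have dc (t : R) : is_derive t 1 (cutoff k) (cutoff1 k t) by exact: d_window.
have dc1 (t : R) : is_derive t 1 (cutoff1 k) (cutoff2 k t) by apply: dScale; exact: d_window.
have cc2 : continuous (cutoff2 k).
  by move=> t; do 2 (apply: cvgM; first exact: cvg_cst); exact: continuous_window.
pose U t := Phi t * cutoff k t.
pose U1 t := Phi1 t * cutoff k t + Phi t * cutoff1 k t.
pose U2 t := (Phi2 t * cutoff k t + Phi1 t * cutoff1 k t) + (Phi1 t * cutoff1 k t + Phi t * cutoff2 k t).
have dU (t : R) : is_derive t 1 U (U1 t) by exact: dMul.
have dU1 (t : R) : is_derive t 1 U1 (U2 t) by apply: dAdd; exact: dMul.
have cP : continuous Phi by move=> t; exact: is_derive_continuous (dP t).
have cP1 : continuous Phi1 by move=> t; exact: is_derive_continuous (dP1 t).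
have cc : continuous (cutoff k) by move=> t; exact: is_derive_continuous (dc t).
have cc1 : continuous (cutoff1 k) by move=> t; exact: is_derive_continuous (dc1 t).
have cU2 : continuous U2.
  move=> t; apply: cvgD; (apply: cvgD; apply: cvgM);
  by [exact: continuous_profile2|exact: cP|exact: cP1|exact: cc|exact: cc1|exact: cc2].
pose a := (k%:R + 1 / 3) * l; pose b := (k%:R + 7 / 6) * l.
have k0 : 0 <= k%:R :> R by [].
have a0 : 0 < a by rewrite mulr_gt0 //; lra.
have ab : a <= b by rewrite ler_pM2r //; lra.
have out t : t <= a \/ b <= t -> [/\ cutoff k t = 0, cutoff1 k t = 0 & cutoff2 k t = 0].
  by move=> [/cutoff_left|/cutoff_right].
have out' t : t < a \/ b < t -> U t = 0 /\ U2 t = 0.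
  move=> h; have [c0 c1 c2] : [/\ cutoff k t = 0, cutoff1 k t = 0 & cutoff2 k t = 0].
    by apply: out; case: h => /ltW; [left|right].
  by rewrite /U /U2 c0 c1 c2 !mulr0 !addr0.
have min := real_test_function cp dU dU1 cU2 a0 ab out'.
have [Lu Lf _] := min.
have lower : l / 8 <= normL2 (fun t => (U t)%:C) ^+ 2.
  have cU : continuous U by move=> t; exact: is_derive_continuous (dU t).
  have := @normL2_real_ge R U ((k%:R + 3 / 4) * l) ((k%:R + 7 / 8) * l) cU Lu.
  rewrite (_ : _ - _ = l / 8); last by field.
  apply.
  - by rewrite mulr_ge0 ?(ltW l0) //; lra.
  - by rewrite ler_pM2r //; lra.
  - move=> t /andP[h1 h2]; have [Pt _] : Phi t = 1 /\ Phi2 t = 0.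
      apply: (@profile_well k); rewrite (le_trans _ h1) ?(le_trans h2) // ler_pM2r //;
      by move: th0 th1; lra.
    have [ct _ _] : [/\ cutoff k t = 1, cutoff1 k t = 0 & cutoff2 k t = 0].
      by apply: cutoff_middle; rewrite (le_trans _ h1) ?(le_trans h2) // ler_pM2r //; lra.
    by rewrite /U Pt ct mulr1.
have l8 : 0 < l / 8 by rewrite divr_gt0.
have u0 : 0 < normL2 (fun t => (U t)%:C).
  rewrite lt_neqAle normL2_ge0 andbT; apply/eqP => z0; move: lower.
  by rewrite -z0 expr0n /= leNgt l8.
exists (fun t => (U t)%:C), (fun t => (- U2 t + p t * U t)%:C); split => //.
pose g t := - (Phi t * cutoff2 k t).
have -> : shift (lev k) (fun t => (U t)%:C) (fun t => (- U2 t + p t * U t)%:C) = fun t => (g t)%:C.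
  apply/funext => t; rewrite /shift /= -rmorphM -rmorphB /=; congr (_%:C).
  have [h1 h2 _] := cutoff_profile k t HK.
  have Pt : Phi t != 0 by rewrite gt_eqF // profile_gt0.
  rewrite /g /U2 /U /trough_potential h1.
  have -> : - (Phi2 t * cutoff k t + 0 + (0 + Phi t * cutoff2 k t)) +
      (level t + Phi2 t / Phi t) * (Phi t * cutoff k t) - lev k * (Phi t * cutoff k t) =
      - (Phi t * cutoff2 k t) + Phi t * ((level t - lev k) * cutoff k t) by field.
  by rewrite h2 mulr0 addr0.
pose G := (eps k + eps k.+1) * (72 * K / l ^+ 2).
have gG t : `|g t| <= G by rewrite /g normrN; have [_ _] := cutoff_profile k t HK.
have G0 : 0 <= G by exact: le_trans (gG 0).
have cg : continuous g by move=> t; apply: cvgN; apply: cvgM; [exact: cP|exact: cc2].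
have upper : normL2 (fun t => (g t)%:C) ^+ 2 <= G ^+ 2 * (b - a).
  apply: normL2_real_le => //; first exact: ltW.
  by move=> t /out[_ _ h]; rewrite /g h mulr0 oppr0.
set n := normL2 (fun t => (U t)%:C) in u0 lower *.
have -> : 216 * K / l ^+ 2 * (eps k + eps k.+1) * n = 3 * G * n by rewrite /G; ring.
have Gn : 0 <= 3 * G * n by apply: mulr_ge0 (ltW u0); exact: mulr_ge0.
rewrite -(ler_sqr _ _) ?nnegrE ?normL2_ge0 //; apply: le_trans upper _.
have -> : (3 * G * n) ^+ 2 = G ^+ 2 * (9 * n ^+ 2) by ring.
apply: ler_wpM2l; first exact: sqr_ge0.
by rewrite /b /a; move: lower l0; lra.
Qed.

End Troughs.

(** * Energy levels *)
Section Levels.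
Variable R : realType.

(** In the coordinate y with energy = a + D / (y + 2), the nodes m + 1 / (j + 2)
    converge to every m as j grows, and [gap] is a distance which such a node
    keeps from all the other nodes and from all the integers. *)
Definition node (mj : nat * nat) : R := mj.1%:R + (mj.2.+2%:R)^-1.
Definition gap (mj : nat * nat) : R := (mj.2.+2%:R * mj.2.+3%:R)^-1.

Lemma node_itv mj : mj.1%:R + gap mj <= node mj <= mj.1%:R + 1 / 2.
Proof.
case: mj => m j; rewrite /node /gap /= !lerD2l; apply/andP; split.
  rewrite lef_pV2 ?posrE ?mulr_gt0 ?ltr0n // ler_peMr ?ler0n //.
  by rewrite ler1n.
by rewrite div1r lef_pV2 ?posrE ?ltr0n // ler_nat.
Qed.

Lemma gap_gt0 mj : 0 < gap mj. Proof. by rewrite invr_gt0 mulr_gt0 ?ltr0n. Qed.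

Lemma gap_le mj : gap mj <= 1 / 2.
Proof.
rewrite /gap div1r lef_pV2 ?posrE ?mulr_gt0 ?ltr0n //.
by rewrite -natrM ler_nat; case: mj => m j /=; rewrite mulSn -[2%N]addn0 leq_add.
Qed.

Lemma gap_eqE j : (j.+2%:R * j.+3%:R)^-1 = (j.+2%:R)^-1 - (j.+3%:R)^-1 :> R.
Proof.
have h1 : j.+2%:R != 0 :> R by rewrite pnatr_eq0.
have h2 : j.+3%:R = j.+2%:R + 1 :> R by rewrite natr1.
have h3 : j.+2%:R + 1 != 0 :> R by rewrite -h2 pnatr_eq0.
by rewrite h2; move: (j.+2%:R) h1 h3 => x h1 h3; field; rewrite h1 h3.
Qed.

Lemma inv_nat_gap i j : (i != j) -> gap (0%N, i) <= `|(i.+2%:R)^-1 - (j.+2%:R)^-1 : R|.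
Proof.
rewrite neq_ltn => /orP[ij|ji]; rewrite /gap /=.
  rewrite ger0_norm.
    by rewrite gap_eqE lerD2l lerN2 lef_pV2 ?posrE ?ltr0n // ler_nat.
  by rewrite subr_ge0 lef_pV2 ?posrE ?ltr0n // ler_nat; lia.
rewrite distrC ger0_norm; last first.
  by rewrite subr_ge0 lef_pV2 ?posrE ?ltr0n // ler_nat; lia.
case: i ji => // i ji.
have h1 : (i.+3%:R * i.+4%:R)^-1 <= (i.+2%:R * i.+3%:R)^-1 :> R.
  by rewrite lef_pV2 ?posrE ?mulr_gt0 ?ltr0n // -!natrM ler_nat leq_mul.
apply: le_trans h1 _; rewrite gap_eqE lerD2r lef_pV2 ?posrE ?ltr0n // ler_nat; lia.
Qed.

Lemma node_sep mj mj' : mj != mj' -> gap mj <= `|node mj' - node mj|.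
Proof.
move=> ne; have /andP[a1 a2] := node_itv mj; have /andP[b1 b2] := node_itv mj'.
have g := gap_le mj; have g' := gap_gt0 mj'.
have [mm|mm|mm] := ltngtP mj.1 mj'.1.
- have h : mj.1%:R + 1 <= mj'.1%:R :> R by rewrite natr1 ler_nat.
  by apply: le_trans (ler_norm _); lra.
- have h : mj'.1%:R + 1 <= mj.1%:R :> R by rewrite natr1 ler_nat.
  by rewrite distrC; apply: le_trans (ler_norm _); lra.
- rewrite /node mm distrC (_ : _ - _ = (mj.2.+2%:R)^-1 - (mj'.2.+2%:R)^-1); last by ring.
  rewrite -[gap mj]/(gap (0%N, mj.2)); apply: inv_nat_gap; apply: contra ne => /eqP h.
  by case: mj mj' mm h {a1 a2 b1 b2 g g'} => m j [m' j'] /= -> ->.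
Qed.

Lemma node_limit_sep mj (m : nat) : gap mj <= `|m%:R - node mj|.
Proof.
have /andP[a1 a2] := node_itv mj; have g := gap_le mj.
have [mm|mm] := leqP m mj.1.
  have h : m%:R <= mj.1%:R :> R by rewrite ler_nat.
  by rewrite distrC; apply: le_trans (ler_norm _); lra.
have h : mj.1%:R + 1 <= m%:R :> R by rewrite natr1 ler_nat.
by apply: le_trans (ler_norm _); lra.
Qed.

Definition energy (a D y : R) : R := a + D / (y + 2).

(** A separation g <= 1 from y costs the factor D / ((y + 2) (y + 3)), uniformly in
    y', although the coordinate change contracts distances at infinity: the
    worst case is y' = y + g. *)
Lemma energy_sep a D g y y' : 0 < D -> 0 <= y -> 0 <= y' -> g <= 1 -> g <= `|y' - y| ->
  D * g / ((y + 2) * (y + 3)) <= `|energy a D y' - energy a D y|.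
Proof.
move=> D0 y0 y0' g1 gy; have y2 : 0 < y + 2 by lra.
have y3 : 0 < y + 3 by lra. have y2' : 0 < y' + 2 by lra.
rewrite /energy (_ : _ - _ = D / ((y + 2) * (y' + 2)) * (y - y')); last first.
  by field; rewrite !gt_eqF.
rewrite normrM gtr0_norm ?divr_gt0 ?mulr_gt0 // distrC.
rewrite ler_pdivrMr ?mulr_gt0 //.
rewrite [leRHS](_ : _ =
  D * (`|y' - y| * (y + 3) / (y' + 2))); last by field; rewrite !gt_eqF.
rewrite ler_pM2l // ler_pdivlMr //.
have n0 := normr_ge0 (y' - y); have n1 := ler_norm (y' - y).
have [g0|/ltW g0] := leP 0 g; last first.
  have := mulr_ge0 n0 (ltW y3); have := mulr_le0_ge0 g0 (ltW y2'); lra.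
have h1 : g * (y' + 2) <= g * (y + 2 + `|y' - y|) by rewrite ler_wpM2l //; lra.
have h2 : g * (y + 2) <= `|y' - y| * (y + 2) by rewrite ler_wpM2r // ltW.
have h3 : g * `|y' - y| <= 1 * `|y' - y| by rewrite ler_wpM2r.
lra.
Qed.

Lemma energy_lip a D y y' : 0 < D -> 0 <= y -> 0 <= y' ->
  `|energy a D y' - energy a D y| <= D * `|y' - y|.
Proof.
move=> D0 y0 y0'; have y2 : 0 < y + 2 by lra. have y2' : 0 < y' + 2 by lra.
rewrite /energy (_ : _ - _ = D * ((y - y') / ((y + 2) * (y' + 2)))); last first.
  by field; rewrite !gt_eqF.
rewrite normrM gtr0_norm // ler_pM2l // normrM distrC normfV (gtr0_norm (mulr_gt0 _ _)) //.
rewrite ler_pdivrMr ?mulr_gt0 // ler_peMr //; nra.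
Qed.

Lemma exists_levels (a b : R) : a < b -> exists lev d lim : nat -> R,
  [/\ forall k, a < lev k < b, forall m, a < lim m < b, forall k, 0 < d k & injective lim] /\
  [/\ forall j k, j != k -> d k <= `|lev j - lev k|,
      forall m k, d k <= `|lim m - lev k| &
      forall m eta, 0 < eta -> exists k, `|lev k - lim m| < eta].
Proof.
move=> ab; pose D := b - a; have D0 : 0 < D by rewrite subr_gt0.
have /card_esym /card_set_bijP[f [_ finj fsurj]] := card_nat2.
have nd0 mj : 0 <= node mj.
  have /andP[h _] := node_itv mj; have := gap_gt0 mj; have : 0 <= mj.1%:R :> R by []; lra.
have in_ab y : 0 <= y -> a < energy a D y < b.
  move=> y0; have y2 : 0 < y + 2 by lra.
  rewrite /energy ltrDl divr_gt0 //= -ltrBrDl ltr_pdivrMr // -/D ltr_pMr //; lra.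
exists (fun k => energy a D (node (f k))),
  (fun k => D * gap (f k) / ((node (f k) + 2) * (node (f k) + 3))), (fun m => energy a D m%:R).
have g1 mj : gap mj <= 1 by have := gap_le mj; lra.
split; split.
- by move=> k; exact: in_ab.
- by move=> m; exact: in_ab.
- move=> k; have := nd0 (f k) => h; rewrite divr_gt0 ?mulr_gt0 ?gap_gt0 //; lra.
- move=> m m' /eqP; rewrite /energy => /eqP/addrI h.
  have m2 (n : nat) : n%:R + 2 != 0 :> R by rewrite gt_eqF // ltr_wpDl.
  have /mulfI/(_ _ _ h)/invr_inj/addIr/eqP := lt0r_neq0 D0.
  by rewrite eqr_nat => /eqP.
- move=> j k jk; apply: energy_sep => //; apply: node_sep.
  by apply: contra jk => /eqP /(finj _ _ (in_setT _) (in_setT _)) ->.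
- by move=> m k; apply: energy_sep => //; exact: node_limit_sep.
- move=> m eta eta0; pose j := Num.truncn (D / eta).
  have [k _ fk] := fsurj (m, j) I; exists k; rewrite fk.
  apply: le_lt_trans (energy_lip a D0 _ _) _ => //.
  rewrite /node /= [_ + _^-1]addrC addrK gtr0_norm ?invr_gt0 ?ltr0n //.
  rewrite ltr_pdivrMr ?ltr0n // mulrC -ltr_pdivrMr //.
  by apply: lt_le_trans (truncnS_gt _) _; rewrite ler_nat.
Qed.

End Levels.

(** * Operators in the limit point case *)
Section LimitPointOperator.
Variables (R : realType) (p : R -> R).
Hypotheses (cp : continuous p) (lp : limit_point p).

(** The common part of the deficiency indices and of the real solutions: L_2
    solutions lie in E, and elements of E are weak solutions. *)
Lemma has_dim_of_L2_csol (z : R[i]) (E : set (R -> R[i])) :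
  (exists y y', [/\ csol p z y y', L2 y & exists t, y t != 0]) ->
  (forall y y', csol p z y y' -> L2 y -> E y) ->
  (forall w, E w -> ker_op (adjoint_op (minimal_operator p)) z w) -> has_dim E 1.
Proof.
move=> [y [y' [hy Ly y0]]] solE Eker.
have [s1 [s1' [s2 [s2' fund]]]] := exists_fundamental cp z.
apply: (has_dim_solution_line cp lp fund hy Ly y0 (solE _ _ hy Ly)) => w /Eker[/= Lw _ orth].
split => //; apply: (weak_solution cp fund Lw) => u g ug.
by apply: orth; exact: restriction_minimal.
Qed.

Lemma csol_adjoint z y y' : csol p z y y' -> L2 y ->
  ker_op (adjoint_op (minimal_operator p)) z y.
Proof.
move=> hy Ly; apply: solution_adjoint => //; first exact: csol_Dl hy.
by apply: aeW => t _; exact: csol_sturm_liouville hy.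
Qed.

Lemma deficiency_one z : complex.Im z != 0 ->
  has_dim (ker_op (adjoint_op (minimal_operator p)) z) 1.
Proof.
move=> z0; apply: (has_dim_of_L2_csol (exists_L2_csol_nonreal cp z0)) => // y y' hy Ly.
exact: csol_adjoint hy Ly.
Qed.

Lemma has_dim_L2_solutions (z : R[i]) :
  (exists y y', [/\ csol p z y y', L2 y & exists t, y t != 0]) ->
  has_dim (solution p z `&` @L2 R) 1.
Proof.
move=> ex; apply: (has_dim_of_L2_csol ex) => [y y' hy Ly|w [[Dw ew] Lw]].
  split => //; split; first exact: csol_Dl hy.
  by apply: aeW => t _ /=; rewrite (csol_sturm_liouville _ hy) subrr.
apply: solution_adjoint => //; apply: filterS ew => t h Dt.
by have /eqP := h Dt; rewrite /= subr_eq0 => /eqP.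
Qed.

End LimitPointOperator.

(** The intervals of radius d k / 2 about the levels are disjoint, so x lies in
    at most one of them. *)
Lemma avoided_level (R : realType) (lev d : nat -> R) (x : R) : (forall k, 0 < d k) ->
  (forall j k, j != k -> d k <= `|lev j - lev k|) ->
  exists K, forall k, (K <= k)%N -> d k / 2 <= `|x - lev k|.
Proof.
move=> d0 sep; have [[k0 hk0]|nk] := pselect (exists k, `|x - lev k| < d k / 2); last first.
  by exists 0%N => k _; rewrite leNgt; apply/negP => h; apply: nk; exists k.
exists k0.+1 => k k0k; rewrite leNgt; apply/negP => h.
have kk0 : k0 != k by rewrite ltn_eqF.
have h1 := sep _ _ kk0; rewrite eq_sym in kk0; have h2 := sep _ _ kk0.
have h3 := ler_distD x (lev k0) (lev k); rewrite (distrC (lev k0) x) in h3.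
by rewrite (distrC (lev k)) in h2; lra.
Qed.

Lemma exists_trough_depths (R : realType) (d : nat -> R) (X : R) : (forall k, 0 < d k) -> 1 <= X ->
  exists eps : nat -> R, forall k, [/\ 0 < eps k, eps k * X <= 1, eps k * X <= d k & eps k.+1 * X <= d k].
Proof.
move=> d0 X1; have X0 : 0 < X by lra.
pose m k := Num.min 1 (Num.min (d k) (d k.-1)).
exists (fun k => m k / X) => k; rewrite !divfK ?gt_eqF //; split.
- by rewrite divr_gt0 // !lt_min ltr01 !d0.
- by rewrite /m ge_min lexx.
- by rewrite /m !ge_min lexx orbT.
- by rewrite /m !ge_min lexx !orbT.
Qed.

(** Each summand is the constant of one of the smallness conditions on the depths
    of the troughs. *)
Definition depth_scale (R : realType) (l D C : R) : R :=
  2000 + 44 * 1000 / l ^+ 2 + 320 * D + 8 * C.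

Lemma depth_bounds (R : realType) (l D C x y : R) : 0 < l -> 0 <= D -> 0 <= C -> 0 < x ->
  x * depth_scale l D C <= y ->
  [/\ x * 2000 <= y, x <= y * l ^+ 2 / (44 * 1000), D * x <= y / 320 & C * x <= y / 8].
Proof.
move=> l0 D0 C0 x0; rewrite /depth_scale -mulrA; have li : 0 < (l ^+ 2)^-1 by rewrite invr_gt0 exprn_gt0.
have lx : l ^+ 2 * (l ^+ 2)^-1 = 1 by rewrite divff // gt_eqF // exprn_gt0.
move: li lx; set i := (l ^+ 2)^-1; set q := l ^+ 2 => li lx h.
have q0 : 0 < q by rewrite exprn_gt0.
have h1 : 0 <= x * i by rewrite mulr_ge0 // ltW.
have h2 : 0 <= x * D by rewrite mulr_ge0 // ltW.
have h3 : 0 <= x * C by rewrite mulr_ge0 // ltW.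
split; [lra| |lra|lra].
have h4 : q * (x * (44 * 1000 * i)) <= q * y by rewrite ler_pM2l //; lra.
have h5 : q * (x * (44 * 1000 * i)) = q * i * (x * (44 * 1000)) by ring.
rewrite h5 lx in h4; lra.
Qed.

(** The cell length l is chosen so that (mu2 - mu1) l^2 is small, and the depths
    of the troughs after the distances d k of the levels. *)
Theorem proposition4p3 (R : realType) (mu1 mu2 : R) (hmu : mu1 < mu2) :
  exists p : R -> R,
    [/\ integrable_near_zero p,
        deficiency_plus (minimal_operator p) 1,
        deficiency_minus (minimal_operator p) 1,
        forall lambda : R, mu1 < lambda -> lambda < mu2 ->
          has_dim (solution p lambda%:C `&` @L2 R) 1 &
        forall A : graph R, self_adjoint A -> minimal_operator p `<=` A ->
          infinite_set [set lambda : R |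
            [/\ mu1 < lambda, lambda < mu2 & essential_spectrum A lambda%:C]]].
Proof.
pose D := mu2 - mu1; have D0 : 0 < D by rewrite subr_gt0.
have [lev [d [lim [[levI limI d0 lim_inj] [lev_sep lim_sep lim_cvg]]]]] := exists_levels hmu.
have [st [st1 [st2 [[dS dS1 cS2 S_mono] [S_le0 S_ge1]]]]] := exists_smooth_step R.
have [K K0 HK] := exists_step2_bound cS2 S_le0 S_ge1.
pose l := (20 * (1 + D))^-1; pose th : R := 1 / (8 * 1000).
have l0 : 0 < l by rewrite invr_gt0 mulr_gt0 // ltr_wpDl // ltW.
have th0 : 0 < th by rewrite /th; lra.
have th1 : th <= 1 / (8 * 1000) by exact: lexx.
pose C := 216 * K / l ^+ 2.
have C0 : 0 < C by exact: divr_gt0 (mulr_gt0 (ltr0Sn _ 215) K0) (exprn_gt0 2 l0).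
have X1 : 1 <= depth_scale l D C.
  have l2 : 0 < (l ^+ 2)^-1 by rewrite invr_gt0 exprn_gt0.
  by rewrite /depth_scale; clear -l2 D0 C0; lra.
have [eps Heps] := exists_trough_depths d0 X1.
have eps0 k : 0 < eps k by have [] := Heps k.
have eps2000 k : eps k * 2000 <= 1.
  have [_ h _ _] := Heps k.
  by have [] := depth_bounds l0 (ltW D0) (ltW C0) (eps0 k) h.
have eps01 k : 0 < eps k <= 1.
  by rewrite eps0 /=; have := eps2000 k; have := eps0 k; clear; lra.
have sq_le k : eps k ^+ 2 <= eps k.
  by have /andP[e0 e1] := eps01 k; rewrite expr2 ler_piMr // ltW.
have bound k := let: And4 _ _ h _ := Heps k in depth_bounds l0 (ltW D0) (ltW C0) (eps0 k) h.
(* eps (k + 1) has to be small compared with d k too: the flux that arrives from the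
   next trough must not disturb the k-th well *)
have boundS k := let: And4 _ _ _ h := Heps k in depth_bounds l0 (ltW D0) (ltW C0) (eps0 k.+1) h.
pose delta k := d k / 2; have delta0 k : 0 < delta k by rewrite divr_gt0.
have levAB k : mu1 <= lev k <= mu2 by have /andP[/ltW -> /ltW ->] := levI k.
have ABl : (mu2 - mu1) * l ^+ 2 <= 1 / 400.
  rewrite -/D /l exprVn ler_pdivrMr; last by rewrite exprn_gt0 // mulr_gt0 // ltr_wpDl // ltW.
  by have := sqr_ge0 D; clear -D0; nra.
have eps_small k : eps k ^+ 2 <= 1 / 2000.
  by apply: le_trans (sq_le k) _; have := eps2000 k; clear; lra.
have eps_next k : eps k.+1 ^+ 2 <= delta k * l ^+ 2 / (22 * 1000).
  by apply: le_trans (sq_le k.+1) _; have [_ + _ _] := boundS k; rewrite /delta; clear; lra.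
have eps_level k : (mu2 - mu1) * eps k ^+ 2 <= delta k / 160.
  have h := ler_wpM2l (ltW D0) (sq_le k).
  by apply: le_trans h _; have [_ _ + _] := bound k; rewrite /delta; clear; lra.
have eps_own k : eps k ^+ 2 <= delta k * l ^+ 2 / 512.
  have dl : 0 <= d k * l ^+ 2 by rewrite mulr_ge0 ?sqr_ge0 // ltW.
  by apply: le_trans (sq_le k) _; have [_ + _ _] := bound k; rewrite /delta; clear -dl; lra.
have eps_qm k : C * (eps k + eps k.+1) <= d k / 4.
  by have [_ _ _ +] := bound k; have [_ _ _ +] := boundS k; clear; lra.
pose p := trough_potential l th st st2 eps lev.
have cp : continuous p by exact: continuous_trough_potential.
have lp : limit_point p.
  apply: (limit_point_bounded_below cp); exact: (@trough_potential_bounded_below R l th st st1 st2 eps lev l0 th0 th1 S_le0 S_ge1 mu1 mu2).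
exists p; split.
- move=> c c0; apply: integrableS (continuous_integrable 0 c cp) => //.
  by move=> x /=; rewrite !in_itv /= => /andP[/ltW -> /ltW ->].
- by move=> z z0; apply: deficiency_one => //; rewrite gt_eqF.
- by move=> z z0; apply: deficiency_one => //; rewrite lt_eqF.
- move=> lam l1 l2'; apply: has_dim_L2_solutions => //.
  have lamI : mu1 <= lam <= mu2 by rewrite !ltW.
  apply: (@exists_L2_csol_real R l th st st1 st2 eps lev l0 th0 th1 dS dS1 cS2 S_mono S_le0 S_ge1 eps01
    mu1 mu2 delta) => //.
  exact: avoided_level.
- move=> A sA minA; have ess m : essential_spectrum A (lim m)%:C.
    apply: essential_spectrum_quasimodes => // eta eta0.
    have eta2 : 0 < eta / 2 by rewrite divr_gt0.
    have [k hk] := lim_cvg m _ eta2.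
    have [u [f [uf u0 ufr]]] := exists_quasimode lev l0 th0 th1 dS dS1 cS2 S_mono S_le0 S_ge1 eps01 k HK.
    exists u, f, (lev k), (d k / 4); split.
    + exact: minA.
    + exact: u0.
    + apply: le_trans ufr _; rewrite ler_wpM2r ?(ltW u0) //.
    + by have := lim_sep m k; have := d0 k; rewrite distrC; clear; lra.
    + by have := lim_sep m k; have := d0 k; rewrite distrC; clear -hk; lra.
  move=> fin; apply: infinite_nat.
  have -> : [set: nat] = lim @^-1` [set lambda : R |
      [/\ mu1 < lambda, lambda < mu2 & essential_spectrum A lambda%:C]].
    by apply/seteqP; split => // m _ /=; have /andP[h1 h2] := limI m.
  by apply: finite_preimage => //; move=> x y _ _; exact: lim_inj.
Qed.
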